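(* Let $\alpha\in(0,1)$, $d=m_1+m_2>16$, and let $\widehat M$ be an estimator with $\|\widehat M\|_\infty\le\mathbf a$ which, for some $\beta>0$, satisfies the risk bound $$\inf_{M\in\mathcal A(k_0,\mathbf a)}\mathbb P_{M}\Big(\frac{\|\widehat M-M\|_2^2}{m_1m_2}\le C_0\frac{(\sigma+\mathbf a)^2k_0d}{n}\Big)\ge 1-\beta$$ for every $k_0\in[m]$, where $C_0>0$ is the numerical constant used in the definition of $r_k$ in the context. Let $C_n$ be the random set defined in the context, where $C^*\ge2$ is a suitable universal constant and $z$ is a sufficiently large numerical constant. Assume that the noise assumption of the context holds. Then, for $m\log(d)\le n\le m_1m_2$, $C_n$ is an honest confidence set at level $\alpha+\exp(-cd)$ for the model $\mathcal A(m,\mathbf a)$, and it is adaptive for every sub-model $\mathcal A(k,\mathbf a)$, $1\le k\le m$, at level $\beta+\exp(-cd)$ (honest and adaptive as defined in the context). Here $c>0$ is a constant that does not depend on $n,m_1,m_2$.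
   Context: Notation: $m_1,m_2\ge1$ integers, $m=\min(m_1,m_2)$, $d=m_1+m_2$, $[l]=\{1,\dots,l\}$, $p=n/(m_1m_2)$ with $n\le m_1m_2$. For a matrix $A$, $\|A\|_2$ is the Frobenius norm and $\|A\|_\infty=\max_{i,j}|A_{ij}|$. For a set $\mathcal S$ of matrices, $\|\mathcal S\|_2$ is its diameter in Frobenius norm. Bernoulli model: for $(i,j)\in[m_1]\times[m_2]$ one observes $(Y_{ij},B_{ij})$, $Y_{ij}=B_{ij}(M_{ij}+\varepsilon_{ij})$, where $(M_{ij})=M_0\in\mathbb R^{m_1\times m_2}$ is unknown and the $B_{ij}$ are i.i.d. Bernoulli($p$) independent of the $\varepsilon_{ij}$. $\mathbb P_{M}$ is the law of the observations when $M_0=M$. Noise assumption: the $\varepsilon_{ij}$ are independent, $\mathbb E\varepsilon_{ij}=0$, $\mathbb E\varepsilon_{ij}^2=\sigma^2$ with $\sigma^2$ known, and $\max_{ij}|\varepsilon_{ij}|\le U$ for a constant $U>0$. For $\mathbf a>0$ and $0\le k\le m$: $\mathcal A(k,\mathbf a)=\{M\in\mathbb R^{m_1\times m_2}:\mathrm{rank}(M)\le k,\ \|M\|_\infty\le\mathbf a\}$. For $k\in[m]$, $r_k=C_0(\sigma+\mathbf a)^2dk/n$ with $C_0>0$ a numerical constant. Honest and adaptive confidence sets: let $\gamma,\gamma'>0$. A set $C_n=C_n((Y_{ij},B_{ij}),\gamma)\subset\mathcal A(m,\mathbf a)$ is an honest confidence set at level $\gamma$ for the model $\mathcal A(m,\mathbf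 a)$ if $$\liminf_n\inf_{M\in\mathcal A(m,\mathbf a)}\mathbb P_M(M\in C_n)\ge1-\gamma.$$ It is adaptive for the sub-model $\mathcal A(k,\mathbf a)$ at level $\gamma'$ if there is a constant $C=C(\gamma,\gamma')>0$ such that $$\sup_{M\in\mathcal A(k,\mathbf a)}\mathbb P_M\Big(\frac{\|C_n\|_2^2}{m_1m_2}>C\,r_k\Big)\le\gamma'\quad\text{and}\quad\sup_{M\in\mathcal A(m,\mathbf a)}\mathbb P_M\Big(\frac{\|C_n\|_2^2}{m_1m_2}>C\,r_m\Big)\le\gamma'.$$ Construction of $C_n$. Given an estimator $\widehat M$ (a function of the $(Y_{ij},B_{ij})$), for $k\in[m]$ let $\widehat M_k\in\arg\min_{A\in\mathcal A(k,\mathbf a)}\|\widehat M-A\|_2$, let $S=\{k\in[m]:\|\widehat M-\widehat M_k\|_2^2/(m_1m_2)\le r_k\}$, $k^*=\min S$, $\widetilde M=\widehat M_{k^*}$, and $$\hat r_n=\frac1n\sum_{i,j}(Y_{ij}-B_{ij}\widetilde M_{ij})^2-\sigma^2,\qquad \xi_{\alpha,U}=2U^2\sqrt{\log(\alpha^{-1})}+\frac{4U^2\log(\alpha^{-1})}{3\sqrt n}.$$ For $M\in\mathbb R^{m_1\times m_2}$ let $\bar z(M)=\frac{p}{256}\|M-\widetilde M\|_2^2+z(UC^* )^2dk^*$. Then $$C_n=\Big\{M\in\mathbb R^{m_1\times m_2}:\ \frac{\|M-\widetilde M\|_2^2}{m_1m_2}\le128\Big(\hat r_n+\frac{\mathbf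 a^2zdk^*+\bar z(M)}{n}+\frac{\xi_{\alpha,U}}{\sqrt n}\Big)\Big\}.$$
   Formalization: The displayed C_n need not lie in A(m,a), as the definition of honest requires, so honesty is stated for the intersection of C_n with A(m,a) (same coverage); adaptivity is stated for the full C_n, with C allowed to depend on the levels and on the fixed α, β, a, σ, U, C_0, z. *)

(* Defs.v *)
From HB Require Import structures.
From mathcomp Require Import all_boot all_order all_algebra.
From mathcomp Require Import all_classical all_reals all_analysis.

Set Implicit Arguments.
Unset Strict Implicit.
Unset Printing Implicit Defensive.

Import Order.TTheory GRing.Theory Num.Theory.
Import numFieldNormedType.Exports.

Local Open Scope classical_set_scope.
Local Open Scope ring_scope.

Section Matrices.
Context {R : realType} {m1 m2 : nat}.

Definition frob (A : 'M[R]_(m1, m2)) : R :=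
  Num.sqrt (\sum_i \sum_j A i j ^+ 2).

(* The added 0 makes the diameter of the empty set 0 rather than -oo. *)
Definition frob_diam (S : set 'M[R]_(m1, m2)) : \bar R :=
  ereal_sup (0%E |` [set (frob (A - B))%:E | A in S & B in S]).

(* `|M| is the library norm on matrices, i.e. the maximum of the `|M i j|. *)
Definition low_rank (k : nat) (a : R) : set 'M[R]_(m1, m2) :=
  [set M : 'M[R]_(m1, m2) | (\rank M <= k)%N /\ `|M| <= a].

End Matrices.

Section Independence.
Local Open Scope ereal_scope.
Context {R : realType} {d : measure_display} {Om : measurableType d}.
Variable P : probability Om R.

(* Taking A i = setT outside a subset of indices gives the product rule for
   every subfamily. *)
Definition mutually_independent {d' : measure_display}
    {T : measurableType d'} {I : finType} (X : I -> Om -> T) : Prop :=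
  forall A : I -> set T, (forall i, measurable (A i)) ->
    P [set w | forall i, A i (X i w)] = \prod_(i : I) P (X i @^-1` A i).

Definition independent {d1 d2 : measure_display} {T1 : measurableType d1}
    {T2 : measurableType d2} (X : Om -> T1) (Y : Om -> T2) : Prop :=
  forall (A1 : set T1) (A2 : set T2), measurable A1 -> measurable A2 ->
    P (X @^-1` A1 `&` Y @^-1` A2) = P (X @^-1` A1) * P (Y @^-1` A2).

End Independence.

(* The product sigma-algebra on matrices, generated by the entries. *)
Definition mx_cylinders {d : measure_display} (T : measurableType d)
    (m1 m2 : nat) : set (set 'M[T]_(m1, m2)) :=
  [set C | exists i j (A : set T), measurable A /\
     C = [set M : 'M[T]_(m1, m2) | A (M i j)]].

Definition real_mx (R : realType) (m1 m2 : nat) :=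
  g_sigma_algebraType (@mx_cylinders _ (measurableTypeR R) m1 m2).
HB.instance Definition _ R m1 m2 := Measurable.on (real_mx R m1 m2).

Definition bool_mx (m1 m2 : nat) :=
  g_sigma_algebraType (@mx_cylinders _ bool m1 m2).
HB.instance Definition _ m1 m2 := Measurable.on (bool_mx m1 m2).

(* The space of the data (Y, B). *)
Notation data R m1 m2 := (real_mx R m1 m2 * bool_mx m1 m2)%type.

(* The noise and the sampling mask on one probability space; their law does
   not depend on the unknown matrix. *)
Record design (R : realType) (m1 m2 : nat) := Design {
  design_display : measure_display ;
  design_space : measurableType design_display ;
  design_prob : probability design_space R ;
  noise : 'I_m1 -> 'I_m2 -> {RV design_prob >-> R} ;
  bmask : 'I_m1 -> 'I_m2 -> {RV design_prob >-> bool}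
}.

Section Model.
Context {R : realType} {m1 m2 : nat}.
Variable D : design R m1 m2.

Definition noise_mx (w : design_space D) : real_mx R m1 m2 :=
  \matrix_(i, j) noise D i j w.

Definition mask_mx (w : design_space D) : bool_mx m1 m2 :=
  \matrix_(i, j) bmask D i j w.

Definition observation (M : 'M[R]_(m1, m2)) (w : design_space D) :
    data R m1 m2 :=
  (\matrix_(i, j) ((bmask D i j w)%:R * (M i j + noise D i j w)), mask_mx w).

Definition law (M : 'M[R]_(m1, m2)) : set (data R m1 m2) -> \bar R :=
  pushforward (design_prob D) (observation M).

Definition bernoulli_sampling (n : nat) : Prop :=
  [/\ forall i j (A : set bool), distribution (design_prob D) (bmask D i j) A =
         bernoulli_prob (n%:R / (m1 * m2)%:R) A,
      mutually_independent (design_prob D)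
        (fun (ij : 'I_m1 * 'I_m2) w => bmask D ij.1 ij.2 w)
    & independent (design_prob D) mask_mx noise_mx].

Definition noise_assumption (sigma U : R) : Prop :=
  [/\ mutually_independent (design_prob D)
        (fun (ij : 'I_m1 * 'I_m2) w => noise D ij.1 ij.2 w),
      forall i j, ('E_(design_prob D)[noise D i j] = 0)%E,
      forall i j, ('E_(design_prob D)[(fun w => noise D i j w ^+ 2)%R])%E =
        (sigma ^+ 2)%:E
    & {ae design_prob D, forall w, forall i j, `|noise D i j w| <= U}].

End Model.

Definition rate {R : realType} (C0 sigma a : R) (m1 m2 n k : nat) : R :=
  C0 * (sigma + a) ^+ 2 * ((m1 + m2) * k)%:R / n%:R.

Section Construction.
Context {R : realType} {m1 m2 : nat}.
Variables (n : nat) (C0 alpha a sigma U Cstar z : R).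
Variables (Mhat : data R m1 m2 -> 'M[R]_(m1, m2))
  (Mproj : nat -> data R m1 m2 -> 'M[R]_(m1, m2)).

Local Notation m := (minn m1 m2).
Local Notation p := (n%:R / (m1 * m2)%:R : R).

Definition estimator (F : data R m1 m2 -> 'M[R]_(m1, m2)) : Prop :=
  measurable_fun setT (F : data R m1 m2 -> real_mx R m1 m2).

(* Mproj k is an arbitrary measurable selection of the argmin. *)
Definition best_approximations : Prop :=
  forall k : nat, (1 <= k <= m)%N ->
    estimator (Mproj k) /\
    forall x, low_rank k a (Mproj k x) /\
      forall A, low_rank k a A -> frob (Mhat x - Mproj k x) <= frob (Mhat x - A).

Definition risk_bound (D : design R m1 m2) (beta : R) : Prop :=
  forall k0 : nat, (1 <= k0 <= m)%N ->
    ((1 - beta)%:E <= ereal_inf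
      [set law D M [set x | (frob (Mhat x - M) ^+ 2 / (m1 * m2)%:R <=
                             rate C0 sigma a m1 m2 n k0)%R]
      | M in low_rank k0 a])%E.

Definition inS (x : data R m1 m2) (k : nat) : bool :=
  frob (Mhat x - Mproj k x) ^+ 2 / (m1 * m2)%:R <= rate C0 sigma a m1 m2 n k.

(* The default value m is immaterial: m belongs to S as soon as `|Mhat x| <= a,
   since then Mproj m x = Mhat x. *)
Definition kstar (x : data R m1 m2) : nat :=
  \big[minn/m]_(1 <= k < m.+1 | inS x k) k.

Definition Mtilde (x : data R m1 m2) : 'M[R]_(m1, m2) := Mproj (kstar x) x.

Definition rhat (x : data R m1 m2) : R :=
  n%:R^-1 * (\sum_i \sum_j (x.1 i j - (x.2 i j)%:R * Mtilde x i j) ^+ 2)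
  - sigma ^+ 2.

Definition xi : R :=
  2 * U ^+ 2 * Num.sqrt (ln (alpha^-1)) +
  4 * U ^+ 2 * ln (alpha^-1) / (3 * Num.sqrt n%:R).

Definition zbar (x : data R m1 m2) (M : 'M[R]_(m1, m2)) : R :=
  p / 256 * frob (M - Mtilde x) ^+ 2 +
  z * (U * Cstar) ^+ 2 * ((m1 + m2) * kstar x)%:R.

(* The set ranges over all matrices; it has to be intersected with the model
   low_rank m a to meet the inclusion clause of honest below. *)
Definition conf_set (x : data R m1 m2) : set 'M[R]_(m1, m2) :=
  [set M : 'M[R]_(m1, m2) | frob (M - Mtilde x) ^+ 2 / (m1 * m2)%:R <=
    128 * (rhat x
           + (a ^+ 2 * z * ((m1 + m2) * kstar x)%:R + zbar x M) / n%:R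
           + xi / Num.sqrt n%:R)].

End Construction.

Section ConfidenceSets.
Context {R : realType} {m1 m2 : nat -> nat}.
Variables (D : forall n, design R (m1 n) (m2 n)) (a : R).
Variable Cn : forall n, data R (m1 n) (m2 n) -> set 'M[R]_(m1 n, m2 n).

(* Levels are sequences because the levels of interest involve exp(-c d) with
   d = m1 n + m2 n; for a constant sequence gamma the second clause says that
   liminf_n inf_M P_M(M in C_n) >= 1 - gamma. *)
Definition honest (gamma : nat -> R) : Prop :=
  (forall n x, Cn x `<=` @low_rank R (m1 n) (m2 n) (minn (m1 n) (m2 n)) a) /\
  (0 <= limn_einf (fun n =>
     ereal_inf [set law (D n) M [set x | Cn x M]
               | M in low_rank (minn (m1 n) (m2 n)) a]
     - (1 - gamma n)%:E))%E.

(* k n is the rank of the sub-model when the sample size is n. The constant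
   C = C(gamma, gamma') depends on n only through the two levels. *)
Definition adaptive (n0 : nat) (C0 sigma : R) (C : R -> R -> R)
    (k : nat -> nat) (gamma gamma' : nat -> R) : Prop :=
  forall n, (n0 <= n)%N ->
  let too_large r : set (data R (m1 n) (m2 n)) :=
    [set x | ((C (gamma n) (gamma' n) *
               rate C0 sigma a (m1 n) (m2 n) n r)%:E <
              frob_diam (Cn x) ^+ 2 * ((m1 n * m2 n)%:R^-1)%:E)%E] in
  (ereal_sup [set law (D n) M (too_large (k n)) | M in low_rank (k n) a]
     <= (gamma' n)%:E)%E /\
  (ereal_sup [set law (D n) M (too_large (minn (m1 n) (m2 n)))
             | M in low_rank (minn (m1 n) (m2 n)) a] <= (gamma' n)%:E)%E.

End ConfidenceSets.

(* Main.v *)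
(* After multiplication by n, the condition M \in C_n is a lower bound for
   S = sum B X^2 + 2 <B eps, X> + (sum B eps^2 - n sigma^2), X = M - Mtilde, and
   a bound on the diameter of C_n is an upper bound for S.

   Uniformity over the low-rank X comes from <G, X>^2 <= rank X * |G|_op^2 * |X|_2^2
   and from moments E tr (G G^T)^q <= d (K U^2 q)^q of the sparse noise matrix
   G = B eps, with q = 2^e of order p d >= log d.  Expanding the trace over closed
   walks, each walk with v vertices contributes at most p^(v-1); regrouping by
   kernel compares the sum with the same sum for a dense q x q matrix of bounded
   entries, whose moments are controlled by a net.  The quadratic term sum B X^2
   is treated in the same way after symmetrization and contraction.  For honesty
   M - Mtilde is centred at a near-minimizer of the distance from M to the matrices
   of rank k, so that the remaining deviations at rank k are of probability
   O(1 / (d k)), and the sum over k tends to 0; the noise energy deviates with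
   probability at most alpha^(4/3) < alpha.  For adaptivity Markov's inequality
   suffices, as the constant may depend on gamma' - beta. *)

From HB Require Import structures.
From mathcomp Require Import all_boot all_order all_algebra.
From mathcomp Require Import zify ring lra.
From mathcomp Require Import all_classical all_reals all_analysis.
From mathcomp Require Import measurable_realfun.
Require Import Defs.

Set Implicit Arguments.
Unset Strict Implicit.
Unset Printing Implicit Defensive.

Import Order.TTheory GRing.Theory Num.Theory.
Import numFieldNormedType.Exports.

Local Open Scope ring_scope.

(** * Operator norms, ranks and traces of powers *)

Section InnerProduct.
Context {R : realFieldType}.
Implicit Types m n : nat.

(** Every tail bound comes from Markov's inequality applied to a moment. Closed walks without a
    simple edge, the combinatorial core of the trace method, are never enumerated: in a dense
    centred matrix whose moments of order at least 2 are at least 1, each such walk has weight at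
    least 1, so the expected trace bounds their number. A size of order [q] is enough, since a walk
    meets at most [q] rows and [q] columns; only there is a crude net affordable. For honesty, [M]
    may have full rank and the selected rank is random, so [M - Mtilde] is not of low rank. One
    fixed matrix per rank carries the part of high rank. A second moment suffices for it, and
    near-minimality makes its norm comparable to that of [M - Mtilde], so that its fluctuation is
    absorbed by a fraction of [p |M - Mtilde|^2]. Suprema over infinite sets of matrices are never
    integrated: there are finitely many masks, and each bad mask selects one witness. As [n <= d^2],
    the dimension tends to infinity with [n], which is why bounds polynomial in [1 / d] are enough
    for the limit inferior. *)

Definition ip m n (A B : 'M[R]_(m, n)) : R := \tr (A *m B^T).

Lemma ipE m n (A B : 'M[R]_(m, n)) : ip A B = \sum_i \sum_j A i j * B i j.
Proof.
by apply: eq_bigr => i _; rewrite mxE; apply: eq_bigr => j _; rewrite mxE.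
Qed.

Lemma ipC m n (A B : 'M[R]_(m, n)) : ip A B = ip B A.
Proof. by rewrite /ip -mxtrace_tr trmx_mul trmxK. Qed.

Lemma ipDl m n (A B C : 'M[R]_(m, n)) : ip (A + B) C = ip A C + ip B C.
Proof. by rewrite /ip mulmxDl mxtraceD. Qed.

Lemma ipZl m n c (A C : 'M[R]_(m, n)) : ip (c *: A) C = c * ip A C.
Proof. by rewrite /ip -scalemxAl mxtraceZ. Qed.

Lemma ipNl m n (A C : 'M[R]_(m, n)) : ip (- A) C = - ip A C.
Proof. by rewrite -scaleN1r ipZl mulN1r. Qed.

Lemma ipDr m n (A B C : 'M[R]_(m, n)) : ip C (A + B) = ip C A + ip C B.
Proof. by rewrite ipC ipDl !(ipC C). Qed.

Lemma ipZr m n c (A C : 'M[R]_(m, n)) : ip C (c *: A) = c * ip C A.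
Proof. by rewrite ipC ipZl ipC. Qed.

Lemma ipNr m n (A C : 'M[R]_(m, n)) : ip C (- A) = - ip C A.
Proof. by rewrite ipC ipNl ipC. Qed.

Lemma ip0r m n (A : 'M[R]_(m, n)) : ip A 0 = 0.
Proof. by rewrite /ip trmx0 mulmx0 mxtrace0. Qed.

Lemma ip0l m n (A : 'M[R]_(m, n)) : ip 0 A = 0.
Proof. by rewrite ipC ip0r. Qed.

Lemma ip_ge0 m n (A : 'M[R]_(m, n)) : 0 <= ip A A.
Proof.
by rewrite ipE; do 2!apply: sumr_ge0 => ? _; rewrite -expr2 sqr_ge0.
Qed.

Lemma ip_eq0 m n (A : 'M[R]_(m, n)) : (ip A A == 0) = (A == 0).
Proof.
apply/eqP/eqP => [|->]; last by rewrite /ip mul0mx mxtrace0.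
rewrite ipE => /psumr_eq0P A0; apply/matrixP => i j; rewrite mxE.
have {}A0 : \sum_k A i k * A i k = 0.
  by apply: A0 => // k _; apply: sumr_ge0 => ? _; rewrite -expr2 sqr_ge0.
move/psumr_eq0P: A0 => A0; apply/eqP; rewrite -sqrf_eq0 expr2 A0 //.
by move=> ? _; rewrite -expr2 sqr_ge0.
Qed.

Lemma ip_mulmxl m n k (A : 'M[R]_(m, n)) (B : 'M[R]_(n, k)) (C : 'M[R]_(m, k)) :
  ip (A *m B) C = ip A (C *m B^T).
Proof. by rewrite /ip trmx_mul trmxK mulmxA. Qed.

Lemma ip_tr m n (A B : 'M[R]_(m, n)) : ip A^T B^T = ip A B.
Proof. by rewrite /ip trmxK mxtrace_mulC -mxtrace_tr trmx_mul trmxK. Qed.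

Lemma ip_CS m n (A B : 'M[R]_(m, n)) : ip A B ^+ 2 <= ip A A * ip B B.
Proof.
have [B0|/eqP B0] := eqVneq (ip B B) 0.
  move/eqP: (B0); rewrite ip_eq0 => /eqP ->.
  by rewrite !ip0r expr0n mulr0.
have Bp : 0 < ip B B by rewrite lt_def ip_ge0 andbT; apply/eqP.
have := ip_ge0 (ip B B *: A - ip A B *: B).
rewrite !(ipDl, ipDr, ipNl, ipNr, ipZl, ipZr) (ipC B A) => H.
rewrite -subr_ge0 -(pmulr_rge0 _ Bp); apply: le_trans H _.
by rewrite le_eqVlt; apply/orP; left; apply/eqP; ring.
Qed.

Lemma ip_mulmx_le m n k (A : 'M[R]_(m, n)) (B : 'M[R]_(n, k)) :
  ip (A *m B) (A *m B) <= ip A A * ip B B.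
Proof.
have rowE (p r : nat) (C : 'M[R]_(p, r)) i : ip (row i C) (row i C) = \sum_j C i j * C i j.
  by rewrite ipE big_ord1; apply: eq_bigr => j _; rewrite !mxE.
rewrite ipE (ipE A A) mulr_suml; apply: ler_sum => i _.
rewrite -(ip_tr B B) (ipE B^T) mulr_sumr; apply: ler_sum => j _.
rewrite -!rowE -expr2 mxE.
apply: le_trans (ip_CS _ _); rewrite ipE big_ord1 le_eqVlt; apply/orP; left.
apply/eqP; congr (_ ^+ 2); by apply: eq_bigr => l _; rewrite !mxE.
Qed.

Lemma ip_sqr_mulmx_tr m n (u : 'rV[R]_m) (G : 'M[R]_(m, n)) :
  ip (u *m G) (u *m G) = ip (u *m (G *m G^T)) u.
Proof. by rewrite ip_mulmxl ipC mulmxA. Qed.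

End InnerProduct.

Section LowRank.
Context {R : realFieldType}.

(** [tau] bounds the square of the operator norm of [G] on row vectors. An inequality in place of a
    supremum keeps the statements free of square roots and of questions of attainment. *)
Definition opbound m n (G : 'M[R]_(m, n)) (tau : R) :=
  forall u : 'rV[R]_m, ip (u *m G) (u *m G) <= tau * ip u u.

(* Peeling off a unit vector of the row space decreases the rank, and the two
   pieces are orthogonal. *)
Lemma ip_rank_tr m n (G X : 'M[R]_(m, n)) (tau : R) (r : nat) :
  0 <= tau -> opbound G^T tau -> (\rank X <= r)%N ->
  ip G X ^+ 2 <= r%:R * tau * ip X X.
Proof.
move=> tau0 Gtau; elim: r X => [|r IH] X.
  rewrite leqn0 mxrank_eq0 => /eqP ->.
  by rewrite !mul0r ip0r expr0n.
have [->|X0] := eqVneq X 0.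
  by move=> _; rewrite !ip0r expr0n mulr0.
move=> rX; have /rowV0Pn[v vX v0] := X0.
have vv : 0 < ip v v by rewrite lt_def ip_ge0 ip_eq0 v0.
(* [c *m v] projects the rows of [X] onto the line of [v], so that the rows of [X'] are orthogonal
   to [v]. *)
pose c : 'cV[R]_m := (ip v v)^-1 *: (X *m v^T).
pose X' := X - c *m v.
have vvE : v *m v^T = (ip v v)%:M by rewrite [LHS]mx11_scalar /ip /mxtrace big_ord1.
have X'v : X' *m v^T = 0.
  rewrite mulmxBl -mulmxA vvE mul_mx_scalar scalerA divff ?gt_eqF //.
  by rewrite scale1r subrr.
have rX' : (\rank X' <= r)%N.
  rewrite -ltnS; apply: leq_trans rX; apply: rank_ltmx.
  rewrite ltmxE addmx_sub ?eqmx_opp ?mulmx_sub //=.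
  apply/negP => XX'; have /submxP[w vE] := submx_trans vX XX'.
  by move: vv; rewrite /ip {1}vE -mulmxA X'v mulmx0 mxtrace0 ltxx.
have XE : X = c *m v + X' by rewrite addrC subrK.
clearbody X'.
have orth : ip (c *m v) X' = 0 by rewrite ip_mulmxl X'v /ip trmx0 mulmx0 mxtrace0.
have nX : ip X X = ip c c * ip v v + ip X' X'.
  rewrite XE !(ipDl, ipDr) (ipC X') orth addr0 add0r; congr (_ + _).
  by rewrite ip_mulmxl -mulmxA vvE mul_mx_scalar ipZr mulrC.
have nG : ip G (c *m v) ^+ 2 <= tau * (ip c c * ip v v).
  rewrite ipC ip_mulmxl; apply: le_trans (ip_CS _ _) _.
  have -> : ip (G *m v^T) (G *m v^T) = ip (v *m G^T) (v *m G^T).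
    by rewrite -[LHS]ip_tr trmx_mul trmxK.
  by rewrite mulrCA ler_wpM2l ?ip_ge0.
have := IH _ rX'; set g' := ip G X'; set g := ip G (c *m v) in nG * => nG'.
rewrite {1}XE ipDr -/g -/g' nX -natr1.
set x := ip c c * ip v v in nG *; set y := ip X' X' in nG' *.
have x0 : 0 <= x by rewrite mulr_ge0 ?ip_ge0.
have y0 : 0 <= y by rewrite ip_ge0.
have r0 : 0 <= r%:R :> R by rewrite ler0n.
move: nG nG' r0; set rr := r%:R : R => nG nG' r0.
clearbody x y rr g g'.
(* The cross term [2 * (g * g')] is split as [rr * tau * x + tau * y]; with this weighting
   everything adds up exactly to [(rr + 1) * tau * (x + y)]. *)
have : (g * g') ^+ 2 <= (tau * x) * (rr * tau * y).
  by rewrite exprMn ler_pM ?sqr_ge0.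
have sq : 0 <= rr * tau * x + tau * y by rewrite addr_ge0 // !mulr_ge0.
move=> H; have : 2 * (g * g') <= rr * tau * x + tau * y.
  rewrite (le_trans (ler_norm _)) // -(ler_pXn2r (n := 2)) ?nnegrE //.
  rewrite real_normK ?num_real // exprMn.
  have := sqr_ge0 (rr * tau * x - tau * y); move: H; lra.
move=> H2; rewrite sqrrD; lra.
Qed.

Lemma ip_rank m n (G X : 'M[R]_(m, n)) (tau : R) (r : nat) :
  0 <= tau -> opbound G tau -> (\rank X <= r)%N ->
  ip G X ^+ 2 <= r%:R * tau * ip X X.
Proof.
move=> t0 Gt rX; rewrite -!(ip_tr _ X).
by apply: ip_rank_tr; rewrite ?trmxK ?mxrank_tr.
Qed.

Definition mpow n (H : 'M[R]_n) (l : nat) : 'M[R]_n := iter l (mulmx H) 1%:M.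

Lemma mpowS n (H : 'M[R]_n) l : mpow H l.+1 = H *m mpow H l.
Proof. by []. Qed.

Lemma mpow_sqr n (H : 'M[R]_n) l : mpow (H *m H) l = mpow H l.*2.
Proof. by elim: l => // l IH; rewrite doubleS !mpowS IH mulmxA. Qed.

(** By Cauchy-Schwarz [|u G|^4 <= |u G G^T|^2 |u|^2], and passing from [G] to [G *m G^T] squares the
    Gram matrix; the base case is the Frobenius bound. Repeated squaring replaces diagonalization,
    which is why [q] is a power of two wherever an operator norm is read off a trace. *)
Lemma trace_pow_opbound m n (G : 'M[R]_(m, n)) (s : nat) (u : 'rV[R]_m) :
  ip (u *m G) (u *m G) ^+ (2 ^ s) <=
    \tr (mpow (G *m G^T) (2 ^ s)) * ip u u ^+ (2 ^ s).
Proof.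
elim: s n G => [|s IH] n G.
  rewrite expn0 !expr1 mpowS mulmx1 mulrC; exact: ip_mulmx_le.
have := IH _ (G *m G^T); rewrite trmx_mul trmxK mpow_sqr -muln2 -expnSr => {}IH.
rewrite {1}expnS exprM.
have : ip (u *m G) (u *m G) ^+ 2 <=
   ip (u *m (G *m G^T)) (u *m (G *m G^T)) * ip u u.
  by rewrite ip_sqr_mulmx_tr ip_CS.
rewrite -(@ler_pXn2r _ (2 ^ s)) ?expn_gt0 ?nnegrE ?sqr_ge0 //; last first.
  by rewrite mulr_ge0 ?ip_ge0.
move=> H; apply: le_trans H _; rewrite exprMn.
apply: le_trans (ler_wpM2r _ IH) _; first by rewrite exprn_ge0 ?ip_ge0.
by rewrite -mulrA -exprD addnn -muln2 -expnSr.
Qed.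

(** The converse direction, for the dense matrix: the trace is a sum of [m] diagonal entries
    [<e H^l, e>], each at most [tau ^+ l] by Cauchy-Schwarz. *)
Lemma trace_pow_le m n (G : 'M[R]_(m, n)) (tau : R) (l : nat) :
  0 <= tau -> opbound G tau -> opbound G^T tau ->
  \tr (mpow (G *m G^T) l) <= m%:R * tau ^+ l.
Proof.
move=> t0 G1 G2; set H := G *m G^T.
have opH k (u : 'rV[R]_m) :
    ip (u *m mpow H k) (u *m mpow H k) <= (tau ^+ k) ^+ 2 * ip u u.
  elim: k u => [|k IH] u; first by rewrite mulmx1 !expr1n mul1r.
  rewrite mpowS mulmxA; apply: le_trans (IH _) _;
    rewrite (exprSr tau k) (exprMn 2) -(mulrA (tau ^+ k ^+ 2)).
  rewrite ler_wpM2l ?sqr_ge0 // /H mulmxA expr2 -mulrA.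
  apply: le_trans (G2 _) _; rewrite ler_wpM2l //; exact: G1.
rewrite -[m in m%:R]card_ord mulr_natl -sumr_const ler_sum // => i _.
pose e : 'rV[R]_m := delta_mx 0 i.
have eE : ip e e = 1.
  by rewrite /ip trmx_delta mul_delta_mx /mxtrace big_ord1 mxE !eqxx.
have <- : ip (e *m mpow H l) e = mpow H l i i.
  rewrite -rowE /ip trmx_delta -colE /mxtrace big_ord1 !mxE.
  by [].
apply: le_trans (ler_norm _) _.
rewrite -(@ler_pXn2r _ 2) ?nnegrE ?exprn_ge0 // real_normK ?num_real //.
by apply: le_trans (ip_CS _ _) _; rewrite eE mulr1 -[leRHS]mulr1 -eE opH.
Qed.

End LowRank.

(** * Closed walks in a bipartite graph and the expansion of traces *)

Section Walks.

(** One entry of [G *m G^T] is a sum of products [G a j * G x j]; the two edges added per step are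
    these two factors, so that a product of entries of the Gram matrix becomes a product of [G]
    along a bipartite walk. *)
Fixpoint wedges {S T : Type} (a : S) (s : seq S) (js : seq T) : seq (S * T) :=
  if s is x :: s' then
    if js is j :: js' then (a, j) :: (x, j) :: wedges x s' js' else [::]
  else [::].

(* The edges of the closed walk s_q, j_1, s_1, j_2, s_2, ..., j_q, s_q. *)
Definition cedges {S T : Type} (s : seq S) (js : seq T) : seq (S * T) :=
  if s is x :: s' then wedges (last x s') s js else [::].

Lemma wedges_map {S T S' T' : Type} (f : S -> S') (g : T -> T') a s js :
  wedges (f a) (map f s) (map g js) =
  map (fun e => (f e.1, g e.2)) (wedges a s js).
Proof. by elim: s a js => [|x s IH] a [|j js] //=; rewrite IH. Qed.

Lemma cedges_map {S T S' T' : Type} (f : S -> S') (g : T -> T') s js :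
  cedges (map f s) (map g js) = map (fun e => (f e.1, g e.2)) (cedges s js).
Proof. by case: s => // x s; rewrite /cedges -wedges_map /= last_map. Qed.

Lemma wedges_mem {S T : eqType} (a : S) s (js : seq T) e :
  e \in wedges a s js -> (e.1 \in a :: s) && (e.2 \in js).
Proof.
elim: s a js => [|x s IH] a [|j js] //=.
rewrite !inE => /or3P[/eqP ->|/eqP ->|/IH] /=; rewrite ?eqxx ?orbT //.
by rewrite inE => /andP[-> ->]; rewrite !orbT.
Qed.

Lemma cedges_mem {S T : eqType} (s : seq S) (js : seq T) e :
  e \in cedges s js -> (e.1 \in s) && (e.2 \in js).
Proof.
case: s => // x s /wedges_mem; rewrite inE => /andP[/orP[/eqP ->|->] ->] //.
by rewrite mem_last.
Qed.

Lemma size_wedges {S T : eqType} (a : S) s (js : seq T) : size s = size js ->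
  size (wedges a s js) = (size s).*2.
Proof. by elim: s a js => [|x s IH] a [|j js] //= [/IH ->]. Qed.

Lemma size_cedges {S T : eqType} (s : seq S) (js : seq T) : size s = size js ->
  size (cedges s js) = (size s).*2.
Proof. by case: s => // x s sz; rewrite /cedges size_wedges. Qed.

(** A connected graph on v vertices has at least v - 1 edges: when the walk is extended at the
    front, each vertex met for the first time brings an edge met for the first time. *)
Lemma size_undup_wedges {S T : eqType} (a : S) s (js : seq T) :
  size s = size js ->
  (size (undup (a :: s)) + size (undup js) <= (size (undup (wedges a s js))).+1)%N.
Proof.
elim: s a js => [|x s IH] a [|j js] //= [sz].
have := IH x js sz; set w := wedges x s js.
rewrite -[if x \in s then _ else _]/(undup (x :: s)); set v := undup (x :: s).
have wj y : (y, j) \in w -> (y \in x :: s) && (j \in js) by move=> /wedges_mem.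
move=> {}IH; have [jjs|jjs] := boolP (j \in js).
  have [ax|ax] := boolP (a \in x :: s).
    by apply: leq_trans IH _; rewrite ltnS; do 2!case: ifP => _ //=; rewrite ltnW.
  rewrite ifN; first by rewrite /= addSn ltnS; apply: leq_trans IH _; case: ifP => _ /=.
  rewrite inE xpair_eqE eqxx andbT negb_or; apply/andP; split.
    by move: ax; rewrite inE negb_or => /andP[].
  by apply: contra ax => /wj /andP[].
have xw : (x, j) \notin w by apply: contra jjs => /wj /andP[].
rewrite (negPf xw) (in_cons (x, j)) xpair_eqE eqxx andbT.
have aw : (a, j) \notin w by apply: contra jjs => /wj /andP[].
rewrite (negPf aw) orbF.
have [ax|ax] := boolP (a \in x :: s); first by rewrite /= addnS ltnS; apply: leq_trans IH _;
  case: ifP => _ /=.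
rewrite ifN /=; first by rewrite addnS addSn !ltnS.
by move: ax; rewrite inE negb_or => /andP[].
Qed.

Lemma size_undup_cedges {S T : eqType} (s : seq S) (js : seq T) :
  (0 < size s)%N -> size s = size js ->
  (size (undup s) + size (undup js) <= (size (undup (cedges s js))).+1)%N.
Proof.
case: s => // x s _ sz; apply: leq_trans (size_undup_wedges (last x s) sz).
rewrite leq_add2r /=; case: ifP => _ //; case: ifP => //.
Qed.

Section Expansion.
Context {R : realFieldType}.

Lemma sum_tupleS (V : nmodType) (T : finType) l (F : seq T -> V) :
  \sum_(t : l.+1.-tuple T) F t = \sum_x \sum_(t : l.-tuple T) F (x :: t).
Proof.
rewrite pair_big /=.
rewrite (reindex (fun xt : T * l.-tuple T => [tuple of xt.1 :: xt.2])) //=.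
exists (fun t => (thead t, [tuple of behead t])) => [[x t] _|t _] /=.
  by congr (_, _); apply: val_inj.
by rewrite [RHS]tuple_eta.
Qed.

Fixpoint pprod n (H : 'M[R]_n) (a : 'I_n) (s : seq 'I_n) : R :=
  if s is x :: s' then H a x * pprod H x s' else 1.

Lemma mpow_pprod n (H : 'M[R]_n) l a b :
  mpow H l a b = \sum_(s : l.-tuple 'I_n | last a s == b) pprod H a s.
Proof.
elim: l a => [|l IH] a.
  rewrite mxE big_mkcond /= (eq_bigr (fun _ => (a == b)%:R)); last first.
    by move=> t _; rewrite tuple0 /=; case: eqP.
  by rewrite sumr_const card_tuple.
rewrite mpowS mxE [RHS]big_mkcond /=.
rewrite [RHS](sum_tupleS l (fun t => if last a t == b then pprod H a t else 0)).
apply: eq_bigr => x _; rewrite IH mulr_sumr [LHS]big_mkcond.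
by apply: eq_bigr => t _.
Qed.

Lemma pprod_wedges m n (G : 'M[R]_(m, n)) a (s : seq 'I_m) :
  pprod (G *m G^T) a s = \sum_(js : (size s).-tuple 'I_n)
    \prod_(e <- wedges a s js) G e.1 e.2.
Proof.
elim: s a => [|x s IH] a.
  rewrite (eq_bigr (fun _ => 1)); last by move=> t _; rewrite big_nil.
  by rewrite sumr_const card_tuple.
rewrite [RHS](sum_tupleS (size s) (fun js => \prod_(e <- wedges a (x :: s) js) G e.1 e.2)).
rewrite /= IH mxE mulr_suml; apply: eq_bigr => j _.
rewrite mulr_sumr; apply: eq_bigr => js _.
by rewrite !big_cons /= mxE mulrA.
Qed.

Lemma trace_pow_walks m n (G : 'M[R]_(m, n)) q : (0 < q)%N ->
  \tr (mpow (G *m G^T) q) = \sum_(s : q.-tuple 'I_m) \sum_(js : q.-tuple 'I_n)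
    \prod_(e <- cedges s js) G e.1 e.2.
Proof.
case: q => // q _; rewrite /mxtrace.
under eq_bigr do rewrite mpow_pprod big_mkcond /=.
rewrite exchange_big /=; apply: eq_bigr => s _.
(* A closed walk starts at its last row vertex, so a single diagonal index survives. *)
case: s => -[//|x s] sz; rewrite -big_mkcond /= (big_pred1 (last x s)); last first.
  by move=> i; rewrite /= eq_sym.
have := pprod_wedges G (last x s) (x :: s); rewrite (eqP sz) => <-.
by [].
Qed.

End Expansion.
End Walks.

(** * Kernels of closed walks *)

Section Kernels.
Local Open Scope nat_scope.

(* Two sequences have the same canon iff they have the same equalities between
   entries. *)
Definition canon {T : eqType} (s : seq T) : seq nat :=
  map (index^~ (undup s)) s.

Lemma undup_map_in (S T : eqType) (f : S -> T) (s : seq S) :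
  {in s &, injective f} -> undup (map f s) = map f (undup s).
Proof.
elim: s => //= x s IH inj.
have fs : (f x \in map f s) = (x \in s).
  apply/mapP/idP => [[y ys /inj fxy]|xs]; last by exists x.
  by rewrite fxy ?mem_head // inE ys orbT.
rewrite fs IH; first by case: ifP.
by move=> y z ys zs; apply: inj; rewrite inE ?ys ?zs orbT.
Qed.

Lemma index_map_in (S T : eqType) (f : S -> T) (s : seq S) x :
  {in s &, injective f} -> x \in s -> index (f x) (map f s) = index x s.
Proof.
elim: s => //= y s IH inj; rewrite inE => xs.
have -> : (f y == f x) = (y == x).
  apply/eqP/eqP => [/inj -> //|-> //]; by rewrite ?mem_head // inE.
case: eqP => // yx; rewrite IH //.
  by move=> z t zs ts; apply: inj; rewrite inE ?zs ?ts orbT.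
by case/orP: xs => // /eqP xy; case: yx.
Qed.

Lemma canon_map (S T : eqType) (f : S -> T) (s : seq S) :
  {in s &, injective f} -> canon (map f s) = canon s.
Proof.
move=> inj; rewrite /canon -map_comp; apply/eq_in_map => x xs /=.
rewrite undup_map_in // index_map_in ?mem_undup // => y z.
by rewrite !mem_undup; apply: inj.
Qed.

Lemma index_undup_inj (T : eqType) (s : seq T) :
  {in s &, injective (index^~ (undup s))}.
Proof.
move=> x y xs ys ixy.
by rewrite -(nth_index x (_ : x \in undup s)) ?mem_undup // ixy nth_index ?mem_undup.
Qed.

Lemma size_undup_canon (T : eqType) (s : seq T) :
  size (undup (canon s)) = size (undup s).
Proof. by rewrite undup_map_in ?size_map //; apply: index_undup_inj. Qed.

Definition nosingle {T : eqType} (E : seq T) : bool :=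
  all (fun e => count_mem e E != 1) E.

Lemma nosingle_map (S T : eqType) (f : S -> T) (E : seq S) :
  {in E &, injective f} -> nosingle (map f E) = nosingle E.
Proof.
move=> inj; rewrite /nosingle all_map; apply: eq_in_all => e eE /=.
rewrite count_map; congr (_ != _); apply: eq_in_count => x xE /=.
by apply/eqP/eqP => [/inj ->|->].
Qed.

Section Pairs.
Variables (S T S' T' : eqType).

Lemma cedges_canon (s : seq S) (js : seq T) :
  nosingle (cedges (canon s) (canon js)) = nosingle (cedges s js) /\
  size (undup (cedges (canon s) (canon js))) = size (undup (cedges s js)).
Proof.
rewrite cedges_map.
have inj : {in cedges s js &,
    injective (fun e : S * T => (index e.1 (undup s), index e.2 (undup js)))}.
  move=> [x j] [y k] /cedges_mem /andP[/= xs jj] /cedges_mem /andP[/= ys kj].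
  by case=> /index_undup_inj -> // /index_undup_inj ->.
by rewrite nosingle_map // undup_map_in // size_map.
Qed.

End Pairs.

Lemma cedges_canon_eq (S T S' T' : eqType) (s : seq S) (js : seq T)
    (s' : seq S') (js' : seq T') :
  canon s = canon s' -> canon js = canon js' ->
  nosingle (cedges s js) = nosingle (cedges s' js') /\
  size (undup (cedges s js)) = size (undup (cedges s' js')).
Proof.
move=> ss jj; have [<- <-] := cedges_canon s js; rewrite ss jj.
by have [-> ->] := cedges_canon s' js'.
Qed.

Lemma size_undup_canon_eq (S S' : eqType) (s : seq S) (s' : seq S') :
  canon s = canon s' -> size (undup s) = size (undup s').
Proof. by move=> ss; rewrite -(size_undup_canon s) ss size_undup_canon. Qed.

(** A sequence is recovered from its [canon] and the list [undup] of its values. The element [s] of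
    the class supplies the defaults of [nth] and [insubd]. *)
Lemma card_canon_le (T : finType) (S : eqType) q (s0 : seq S) :
  0 < q ->
  #|[set s : q.-tuple T | canon s == canon s0]| <= #|T| ^ size (undup s0).
Proof.
case: q => // q _; set A := [set _ | _]; have [->|[s sA]] := set_0Vmem A.
  by rewrite cards0.
pose x0 := thead s.
set v := size _; rewrite -card_tuple.
pose F (u : v.-tuple T) := map (nth x0 u) (canon s0).
pose F' (u : v.-tuple T) : q.+1.-tuple T := insubd s (F u).
apply: leq_trans (leq_imset_card F' predT); apply: subset_leq_card.
apply/fintype.subsetP => t; rewrite inE => /eqP tc.
have vt : size (undup t) == v by rewrite (size_undup_canon_eq tc).
apply/imsetP; exists (Tuple vt) => //; apply: val_inj.
have FE : F (Tuple vt) = t.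
  rewrite /F -tc /canon -map_comp /= -[RHS]map_id; apply/eq_in_map => x xt /=.
  by rewrite nth_index // mem_undup.
by rewrite /F' FE insubdK // -topredE /= size_tuple.
Qed.

(** Relabelling the values of [s0] by a repetition-free tuple keeps its [canon], and different
    tuples give different sequences. *)
Lemma card_canon_ge (T : finType) (S : eqType) q (s0 : q.-tuple S) :
  #|T| ^_ size (undup s0) <= #|[set s : q.-tuple T | canon s == canon s0]|.
Proof.
case: q s0 => [|q] s0.
  rewrite (tuple0 s0) ffactn0 card_gt0; apply/finset.set0Pn; exists [tuple].
  by rewrite inE.
have [x0 _|T0] := pickP T; last first.
  have -> : #|T| = 0 by apply: eq_card0 => x; have := T0 x.
  have : 0 < size (undup s0).
    have : thead s0 \in undup s0 by rewrite mem_undup mem_tnth.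
    by case: (undup s0).
  by case: (size _).
set v := size _.
have <- := card_uniq_tuples v (fun _ : T => true).
pose F (u : v.-tuple T) : (q.+1).-tuple T :=
  [tuple of map (fun x => nth x0 u (index x (undup s0))) s0].
have FI x : x \in s0 -> index x (undup s0) < v by rewrite /v index_mem mem_undup.
rewrite -(card_in_imset (f := F)); last first.
  move=> u w _ _ /(congr1 val)/= /eq_in_map uw; apply: eq_from_tnth => k.
  have ks : nth (thead s0) (undup s0) k \in s0.
    by rewrite -mem_undup mem_nth.
  have := uw _ ks; rewrite index_uniq ?undup_uniq // => H.
  by rewrite !(tnth_nth x0).
apply: subset_leq_card; apply/fintype.subsetP => t /imsetP[u]; rewrite inE => /andP[_ uu] ->.
rewrite inE; apply/eqP; apply: canon_map => x y xs ys /eqP.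
rewrite nth_uniq ?size_tuple ?FI // => /eqP; exact: index_undup_inj.
Qed.

(** This fixes the alphabet size [2q]: every factor [2q - i] with [i < v <= q] is at least [q]. *)
Lemma leq_expn_ffact q v : v <= q -> q ^ v <= (q.*2) ^_ v.
Proof.
move=> vq; rewrite ffact_prod -[X in _ ^ X]card_ord -prod_nat_const.
by apply: leq_prod => i _; have := ltn_ord i; lia.
Qed.

End Kernels.

Lemma sum_bool_card (R : pzSemiRingType) (T : finType) (P : pred T) :
  \sum_(x : T) (P x)%:R = #|[set x | P x]|%:R :> R.
Proof.
rewrite -sum1_card natr_sum [RHS]big_mkcond; apply: eq_bigr => x _.
by rewrite inE; case: (P x).
Qed.

(* Walks in [m1] x [m2] are compared with walks in the small complete graph
   [2q] x [2q] having the same kernel; there are at most d ^ v, resp. at least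
   q ^ v, walks with a given kernel with v vertices, and at least v - 1 edges. *)
Lemma walk_comparison (R : realFieldType) (m1 m2 q : nat) (p : R) :
  (0 < q)%N -> 0 <= p <= 1 -> (m1 + m2)%:R * p <= q%:R ->
  \sum_(s : q.-tuple 'I_m1) \sum_(js : q.-tuple 'I_m2)
     (nosingle (cedges s js))%:R * p ^+ size (undup (cedges s js)) <=
  (m1 + m2)%:R * \sum_(s : q.-tuple 'I_q.*2) \sum_(js : q.-tuple 'I_q.*2)
     (nosingle (cedges s js))%:R.
Proof.
move=> q0 /andP[p0 p1] dp; set d := (m1 + m2)%:R.
have Q0 : 0 < q%:R :> R by rewrite ltr0n.
have d0 : 0 <= d by rewrite ler0n.
rewrite mulr_sumr; under [leRHS]eq_bigr do rewrite mulr_sumr.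
pose V (S T : eqType) (s : seq S) (js : seq T) := (size (undup s) + size (undup js))%N.
(* The weight depends on the kernel of the walk only. Division by [q ^ V] compensates the small
   walks, at least [q ^ V] in number, that share the kernel of a given large walk. *)
pose W (S T : eqType) (s : seq S) (js : seq T) : R :=
  (nosingle (cedges s js))%:R * p ^+ size (undup (cedges s js)) / q%:R ^+ V S T s js.
have WE (S T S' T' : eqType) (s : seq S) (js : seq T) (s' : seq S') (js' : seq T') :
    canon s = canon s' -> canon js = canon js' -> W _ _ s js = W _ _ s' js'.
  move=> ss jj; rewrite /W /V (size_undup_canon_eq ss) (size_undup_canon_eq jj).
  by have [-> ->] := cedges_canon_eq ss jj.
have W0 (S T : eqType) (s : seq S) (js : seq T) : 0 <= W _ _ s js.
  by rewrite /W !mulr_ge0 ?invr_ge0 ?exprn_ge0.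
have le1 m (s : q.-tuple 'I_m) : q%:R ^+ size (undup s) <=
    \sum_(s' : q.-tuple 'I_q.*2) (canon s' == canon s)%:R :> R.
  rewrite sum_bool_card -natrX ler_nat.
  apply: leq_trans (leq_expn_ffact _) _; first by rewrite -[leqRHS](size_tuple s) size_undup.
  by have := card_canon_ge 'I_q.*2 s; rewrite card_ord.
have le2 m (S : eqType) (s' : seq S) : \sum_(s : q.-tuple 'I_m) (canon s' == canon s)%:R <=
    m%:R ^+ size (undup s') :> R.
  rewrite sum_bool_card -natrX ler_nat.
  have := @card_canon_le 'I_m S q s' q0; rewrite card_ord; apply: leq_trans.
  by apply: eq_leq; apply: eq_card => s; rewrite !inE eq_sym.
apply: (@le_trans _ _ (\sum_(s : q.-tuple 'I_m1) \sum_(js : q.-tuple 'I_m2)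
   \sum_(s' : q.-tuple 'I_q.*2) \sum_(js' : q.-tuple 'I_q.*2)
     W _ _ s' js' * ((canon s' == canon s)%:R * (canon js' == canon js)%:R))).
  apply: ler_sum => s _; apply: ler_sum => js _.
  apply: (@le_trans _ _ (W _ _ s js * (q%:R ^+ size (undup s) * q%:R ^+ size (undup js)))).
    by rewrite -exprD /W divfK // expf_neq0 // gt_eqF.
  apply: (@le_trans _ _ (\sum_(s' : q.-tuple 'I_q.*2) \sum_(js' : q.-tuple 'I_q.*2)
     W _ _ s js * ((canon s' == canon s)%:R * (canon js' == canon js)%:R))).
    under eq_bigr do rewrite -mulr_sumr -mulr_sumr.
    rewrite -mulr_sumr -mulr_suml ler_wpM2l //.
    by apply: ler_pM; rewrite ?exprn_ge0 ?ler0n ?le1.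
  rewrite le_eqVlt; apply/orP; left; apply/eqP.
  apply: eq_bigr => s' _; apply: eq_bigr => js' _.
  case: eqP => [ss|]; last by rewrite !mul0r !mulr0.
  case: eqP => [jj|]; last by rewrite !mulr0.
  by rewrite (WE _ _ _ _ _ _ _ _ ss jj).
under [leLHS]eq_bigr => s _ do rewrite exchange_big /=.
rewrite exchange_big /=; apply: ler_sum => s' _.
under [leLHS]eq_bigr => s _ do rewrite exchange_big /=.
rewrite exchange_big /=; apply: ler_sum => js' _.
under eq_bigr do rewrite -mulr_sumr -mulr_sumr.
rewrite -mulr_sumr -mulr_suml.
apply: (@le_trans _ _ (W _ _ s' js' * (d ^+ size (undup s') * d ^+ size (undup js')))).
  rewrite ler_wpM2l //; apply: ler_pM; rewrite ?sumr_ge0 //.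
    by apply: le_trans (le2 _ _ _) _; rewrite lerXn2r ?nnegrE ?ler0n // /d ler_nat leq_addr.
  by apply: le_trans (le2 _ _ _) _; rewrite lerXn2r ?nnegrE ?ler0n // /d ler_nat leq_addl.
rewrite -exprD /W -!mulrA [leRHS]mulrC ler_wpM2l ?ler0n //.
have V0 : (0 < V _ _ s' js')%N.
  have : tnth s' (Ordinal q0) \in undup s' by rewrite mem_undup mem_tnth.
  by rewrite /V; case: (undup s').
have ee : (V _ _ s' js' <= (size (undup (cedges s' js'))).+1)%N.
  by apply: size_undup_cedges; rewrite ?size_tuple.
rewrite -/(V _ _ s' js'); move: V0 ee; case: (V _ _ s' js') => // v _; rewrite ltnS => ve.
apply: (@le_trans _ _ (p ^+ v * ((q%:R ^+ v.+1)^-1 * d ^+ v.+1))).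
  rewrite ler_wpM2r ?mulr_ge0 ?invr_ge0 ?exprn_ge0 ?(ltW Q0) //.
  exact: ler_wiXn2l.
(* With [v.+1] vertices and at least [v] edges, one vertex is left without an edge of its own: it
   costs the factor [d / q], and each of the others costs [d * p / q <= 1]. *)
have -> : p ^+ v * ((q%:R ^+ v.+1)^-1 * d ^+ v.+1) = d / q%:R * (d * p / q%:R) ^+ v.
  by rewrite !exprSr !exprMn exprVn; field; rewrite !expf_neq0 // gt_eqF.
have x1 : (d * p / q%:R) ^+ v <= 1.
  by rewrite exprn_ile1 ?divr_ge0 ?mulr_ge0 ?(ltW Q0) // ler_pdivrMr // mul1r.
apply: (@le_trans _ _ (d / q%:R)).
  by rewrite ler_piMr // divr_ge0 // ltW.
by rewrite ler_pdivrMr // ler_peMr // ler1n.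
Qed.

(** * Products of moments *)

Section Multiplicities.
Context {R : realFieldType} {I : finType}.

Lemma prod_count (E : seq I) (F : I -> R) :
  \prod_(e <- E) F e = \prod_i F i ^+ count_mem i E.
Proof.
elim: E => [|x E IH]; first by rewrite big_nil big1 // => i _; rewrite expr0.
rewrite big_cons IH (bigD1 x) //= [RHS](bigD1 x) //= eqxx exprS mulrA.
congr (_ * _); apply: eq_bigr => i /negPf ix.
by rewrite eq_sym ix.
Qed.

Lemma prod_mem_expr (E : seq I) (p : R) :
  \prod_i (if i \in E then p else 1) = p ^+ size (undup E).
Proof.
rewrite -big_mkcond /= prodr_const; congr (_ ^+ _).
by rewrite -(card_uniqP (undup_uniq E)); apply: eq_card => i; rewrite mem_undup.
Qed.

(** An entry met exactly once has mean zero and kills the product; an entry met more often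
    contributes a single factor [p] whatever its multiplicity. *)
Lemma prod_moments_le (E : seq I) (p U : R) (M : I -> nat -> R) :
  0 <= p -> 0 <= U ->
  (forall i, M i 0%N = 1) -> (forall i, M i 1%N = 0) ->
  (forall i k, (0 < k)%N -> `|M i k| <= p * U ^+ k) ->
  \prod_i M i (count_mem i E) <=
    (nosingle E)%:R * p ^+ size (undup E) * U ^+ size E.
Proof.
move=> p0 U0 M0 M1 MU; have [nsE|] := boolP (nosingle E); last first.
  case/allPn => e eE; rewrite negbK => /eqP c1.
  by rewrite (bigD1 e) //= c1 M1 !mul0r.
rewrite mul1r -prod_mem_expr.
have -> : U ^+ size E = \prod_(e <- E) U.
  by rewrite big_const_seq count_predT iter_mulr_1.
rewrite (prod_count E (fun=> U)) -big_split /=.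
apply: le_trans (ler_norm _) _; rewrite normr_prod.
apply: ler_prod => i _; rewrite normr_ge0 /=; case: ifP => iE.
  by apply: MU; rewrite -has_count has_pred1.
by rewrite (count_memPn _) ?iE // M0 normr1 expr0 mulr1.
Qed.

(** The reverse comparison, for the dense matrix: walks without a simple edge have weight at least
    1, and the others do not contribute negatively. *)
Lemma prod_moments_ge (E : seq I) (M : I -> nat -> R) :
  (forall i, M i 0%N = 1) -> (forall i, M i 1%N = 0) ->
  (forall i k, (1 < k)%N -> 1 <= M i k) ->
  (nosingle E)%:R <= \prod_i M i (count_mem i E).
Proof.
move=> M0 M1 MU; have [nsE|_] := boolP (nosingle E).
  elim/big_ind : _ => // [x y x1 y1|i _]; first by rewrite -[1]mul1r ler_pM.
  have [/(allP nsE) c1|ci] := boolP (i \in E).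
    case: (count_mem i E) c1 => [|[|k]] // _; first by rewrite M0.
    exact: MU.
  by rewrite (count_memPn ci) M0.
apply: prodr_ge0 => i _; case: (count_mem i E) => [|[|k]].
- by rewrite M0.
- by rewrite M1.
- exact: le_trans (MU _ _ _).
Qed.

End Multiplicities.

(** * Expectations under finite product measures *)

Section ProductExpectation.
Context {R : realFieldType} {I V : finType}.
Variable w : V -> R.

Definition pweight (x : {ffun I -> V}) : R := \prod_i w (x i).

Definition Ex (f : {ffun I -> V} -> R) : R := \sum_x pweight x * f x.

Lemma Ex_prod (g : I -> V -> R) :
  Ex (fun x => \prod_i g i (x i)) = \prod_i \sum_v w v * g i v.
Proof.
rewrite bigA_distr_bigA; apply: eq_bigr => x _.
by rewrite /pweight -big_split.
Qed.

Lemma eq_Ex f g : f =1 g -> Ex f = Ex g.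
Proof. by move=> fg; apply: eq_bigr => x _; rewrite fg. Qed.

Lemma ExD f g : Ex (fun x => f x + g x) = Ex f + Ex g.
Proof. by rewrite -big_split; apply: eq_bigr => x _; rewrite mulrDr. Qed.

Lemma ExZ c f : Ex (fun x => c * f x) = c * Ex f.
Proof. by rewrite mulr_sumr; apply: eq_bigr => x _; rewrite mulrCA. Qed.

Lemma Ex_sum (J : Type) (r : seq J) (P : pred J) (F : J -> {ffun I -> V} -> R) :
  Ex (fun x => \sum_(j <- r | P j) F j x) = \sum_(j <- r | P j) Ex (F j).
Proof.
by rewrite /Ex exchange_big; apply: eq_bigr => x _; rewrite mulr_sumr.
Qed.

Hypothesis w0 : forall v, 0 <= w v.
Hypothesis w1 : \sum_v w v = 1.

Lemma pweight_ge0 x : 0 <= pweight x.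
Proof. exact: prodr_ge0. Qed.

Lemma le_Ex f g : (forall x, f x <= g x) -> Ex f <= Ex g.
Proof. by move=> fg; apply: ler_sum => x _; rewrite ler_wpM2l ?pweight_ge0. Qed.

Lemma Ex_ge0 f : (forall x, 0 <= f x) -> 0 <= Ex f.
Proof. by move=> f0; apply: sumr_ge0 => x _; rewrite mulr_ge0 ?pweight_ge0. Qed.

Lemma sum_pweight : \sum_x pweight x = 1.
Proof. by rewrite /pweight -(bigA_distr_bigA (fun=> w)) big1. Qed.

Lemma Ex_cst c : Ex (fun=> c) = c.
Proof. by rewrite /Ex -mulr_suml sum_pweight mul1r. Qed.

Lemma Ex_coord i (g : V -> R) : Ex (fun x => g (x i)) = \sum_v w v * g v.
Proof.
have -> : Ex (fun x => g (x i)) =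
    Ex (fun x => \prod_j (fun j v => if j == i then g v else 1) j (x j)).
  by apply: eq_Ex => x; rewrite (bigD1 i) //= eqxx big1 ?mulr1 // => j /negPf ->.
rewrite (Ex_prod (fun j v => if j == i then g v else 1)) (bigD1 i) //= eqxx [X in _ * X]big1
  ?mulr1 // => j /negPf ->.
by rewrite -[RHS]w1; apply: eq_bigr => v _; rewrite mulr1.
Qed.

Lemma Ex_coord2 i j (g h : V -> R) : i != j ->
  Ex (fun x => g (x i) * h (x j)) = Ex (fun x => g (x i)) * Ex (fun x => h (x j)).
Proof.
move=> ij; rewrite !Ex_coord.
have -> : Ex (fun x => g (x i) * h (x j)) =
    Ex (fun x => \prod_k (fun k v => if k == i then g v else
      if k == j then h v else 1) k (x k)).
  apply: eq_Ex => x; rewrite (bigD1 i) //= eqxx (bigD1 j) ?[j == i]eq_sym //=.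
  rewrite (negPf ij) eqxx big1 ?mulr1 // => k /andP[/negPf -> /negPf ->] //.
rewrite (Ex_prod (fun k v => if k == i then g v else if k == j then h v else 1)).
rewrite (bigD1 i) //= eqxx (bigD1 j) ?[j == i]eq_sym //=.
rewrite (negPf ij) eqxx [X in _ * (_ * X)]big1 ?mulr1 // => k /andP[/negPf -> /negPf ->].
by rewrite -[RHS]w1; apply: eq_bigr => v _; rewrite mulr1.
Qed.

Lemma Ex_sqr_sum (h : I -> V -> R) :
  (forall i, \sum_v w v * h i v = 0) ->
  Ex (fun x => (\sum_i h i (x i)) ^+ 2) = \sum_i \sum_v w v * h i v ^+ 2.
Proof.
move=> h0.
rewrite (eq_Ex (g := fun x => \sum_i \sum_j h i (x i) * h j (x j))); last first.
  by move=> x; rewrite expr2 mulr_suml; apply: eq_bigr => i _; rewrite mulr_sumr.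
rewrite Ex_sum; apply: eq_bigr => i _; rewrite Ex_sum (bigD1 i) //= big1 ?addr0.
  by rewrite (Ex_coord i (fun v => h i v * h i v)); apply: eq_bigr => v _; rewrite expr2.
by move=> j ji; rewrite Ex_coord2 1?eq_sym // Ex_coord h0 mul0r.
Qed.

End ProductExpectation.

(** * Moments of sums over closed walks *)

Section ExpBounds.
Context {R : realType}.

(** The linear term stays outside the exponential so that it cancels under a centred law, which
    leaves a sub-Gaussian bound. *)
Lemma expR_le_quadratic (x : R) : expR x <= x + expR (2 * x ^+ 2).
Proof.
have e2 := expR_ge1Dx (2 * x ^+ 2).
have [x0|x0] := leP x 0.
  have y0 : 0 < 1 - x by lra.
  have : expR x <= (1 - x)^-1.
    by rewrite -[x in expR x]opprK expRN lef_pV2 ?posrE ?expR_gt0 ?expR_ge1Dx.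
  have : (1 - x)^-1 <= 1 + x + 2 * x ^+ 2.
    by rewrite -[leLHS]mul1r ler_pdivrMr //; nra.
  lra.
have [x1|x1] := leP x 2^-1; last first.
  have : expR x <= expR (2 * x ^+ 2) by rewrite ler_expR; nra.
  lra.
have y0 : 0 < 1 - x by lra.
have : expR x <= (1 - x)^-1.
  by rewrite -[x in expR x]opprK expRN lef_pV2 ?posrE ?expR_gt0 ?expR_ge1Dx.
have : (1 - x)^-1 <= 1 + x + 2 * x ^+ 2.
  by rewrite -[leLHS]mul1r ler_pdivrMr //; nra.
lra.
Qed.

Lemma expr_le_fact_expR (x : R) n : (0 < n)%N -> 0 <= x -> x ^+ n <= n`!%:R * expR x.
Proof.
case: n => // n _ x0; have H := expR_ge1Dxn n x0.
rewrite mulrC -ler_pdivrMr ?ltr0n ?fact_gt0 //; lra.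
Qed.

Lemma even_expr_le_expR (x : R) q : (0 < q)%N ->
  x ^+ q.*2 <= q.*2`!%:R * (expR x + expR (- x)).
Proof.
move=> q0; have q20 : (0 < q.*2)%N by rewrite double_gt0.
rewrite mulrDr; have [x0|x0] := leP 0 x.
  by rewrite ler_wpDr ?mulr_ge0 ?expR_ge0 // expr_le_fact_expR.
rewrite ler_wpDl ?mulr_ge0 ?expR_ge0 //.
by rewrite -[x in x ^+ _]opprK exprNn -signr_odd odd_double mul1r expr_le_fact_expR // oppr_ge0
  ltW.
Qed.

Lemma sum_geom_half n : \sum_(j < n) (2^-1 : R) ^+ j <= 2.
Proof.
have -> : \sum_(j < n) (2^-1 : R) ^+ j = 2 - 2 * 2^-1 ^+ n.
  by elim: n => [|n IH]; rewrite ?big_ord0 ?expr0 ?mulr1 ?subrr // big_ord_recr IH exprS /=; lra.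
by rewrite lerBlDr lerDl mulr_ge0 // exprn_ge0.
Qed.

(** Since [expR (- j ^ 2) <= 2 ^ (- j)], each half of the range is bounded by a geometric series. *)
Lemma sum_gauss_le (K : nat) :
  \sum_(k < K + K.+1) expR (- (k%:R - K%:R) ^+ 2) <= 4 :> R.
Proof.
have half (j : nat) : expR (- j%:R ^+ 2) <= 2^-1 ^+ j :> R.
  rewrite expRN expr2 expRM_natl.
  rewrite -exprVn; case: j => [|j]; first by rewrite !expr0.
  rewrite lerXn2r ?nnegrE ?invr_ge0 ?expR_ge0 // lef_pV2 ?posrE ?expR_gt0 //.
  apply: le_trans (expR_ge1Dx _); have : 1 <= j.+1%:R :> R by rewrite ler1n.
  lra.
rewrite big_split_ord /=.
have -> : 4 = 2 + 2 :> R by lra.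
apply: lerD; last first.
  apply: le_trans (sum_geom_half K.+1); apply: ler_sum => j _.
  apply: le_trans (half j); rewrite natrD.
  by rewrite le_eqVlt; apply/orP; left; apply/eqP; congr expR; ring.
rewrite (reindex_inj rev_ord_inj) /=; apply: le_trans (sum_geom_half K).
apply: ler_sum => j _; apply: (@le_trans _ _ (2^-1 ^+ j.+1)); last first.
  by rewrite exprS ler_piMl ?exprn_ge0 // invf_le1 ?ler1n.
apply: le_trans (half j.+1); rewrite natrB //.
by rewrite le_eqVlt; apply/orP; left; apply/eqP; congr expR; ring.
Qed.

End ExpBounds.

(** * A net of the unit ball and the moments of a dense random matrix *)

Section Net.
Context {R : realType}.
Variable r : nat.
Hypothesis r0 : (0 < r)%N.

Local Notation K := (5 * r)%N.

(** Integer vectors with coordinates in [[-K, K]], encoded by finite functions so that the net is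
    summed over by [\sum]. Restricted by [innet] and scaled by [1 / (4 sqrt r)], they lie in the
    ball of radius 5/4. *)
Definition netv (z : {ffun 'I_r -> 'I_(K + K.+1)}) : 'rV[R]_r :=
  \row_i ((z i)%:R - K%:R).

Definition innet z := ip (netv z) (netv z) <= 25 * r%:R.

(** The indicator of [|z|^2 <= 25 r] is at most [expR (25 r - |z|^2)], and the sum of the latter
    over the grid factorizes over the coordinates. *)
Lemma card_net : \sum_z (innet z)%:R <= (expR 25 * 4) ^+ r :> R.
Proof.
apply: (@le_trans _ _ (\sum_(z : {ffun 'I_r -> 'I_(K + K.+1)}) \prod_i (expR 25 * expR (- ((z
  i)%:R - K%:R) ^+ 2)))).
  apply: ler_sum => z _; rewrite big_split /= prodr_const card_ord -expRM_natl.
  rewrite -expR_sum -expRD; case: (boolP (innet z)) => zn; last exact: expR_ge0.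
  rewrite -[1%:R]expR0 ler_expR sumrN; move: zn; rewrite /innet ipE big_ord1.
  rewrite (eq_bigr (fun i => ((z i)%:R - K%:R) ^+ 2)); last first.
    by move=> i _; rewrite !mxE expr2.
  lra.
rewrite -(bigA_distr_bigA (fun _ (k : 'I_(K + K.+1)) => expR 25 * expR (- (k%:R - K%:R) ^+ 2))).
rewrite prodr_const card_ord lerXn2r ?nnegrE ?mulr_ge0 ?expR_ge0 //.
  by apply: sumr_ge0 => k _; rewrite mulr_ge0 ?expR_ge0.
by rewrite -mulr_sumr ler_wpM2l ?expR_ge0 // sum_gauss_le.
Qed.

Lemma net_round (u : 'rV[R]_r) : ip u u <= 1 ->
  exists2 z, innet z &
    let e := u - (4 * Num.sqrt r%:R)^-1 *: netv z in ip e e <= 4^-1 ^+ 2.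
Proof.
move=> u1; set s : R := Num.sqrt r%:R.
have R0 : 1 <= r%:R :> R by rewrite ler1n.
have s2 : s ^+ 2 = r%:R by rewrite sqr_sqrtr ?ler0n.
have s1 : 1 <= s by rewrite -[leLHS]sqrtr1 ler_sqrt ?ltr0n.
have s0 : 0 < s by apply: lt_le_trans s1.
have ssr : s <= r%:R by rewrite -s2; nra.
have uE : ip u u = \sum_i u 0 i ^+ 2 by rewrite ipE big_ord1; apply: eq_bigr => i _;
  rewrite expr2.
have ui i : `|u 0 i| <= 1.
  rewrite -(@ler_pXn2r _ 2) ?nnegrE // expr1n real_normK ?num_real //.
  apply: le_trans u1; rewrite uE (bigD1 i) //= lerDl.
  by apply: sumr_ge0 => ? _; rewrite sqr_ge0.
pose x i := 4 * s * u 0 i; pose f i := Num.floor (x i).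
have xr i : - (4 * r%:R) <= x i <= 4 * r%:R.
  by have := ui i; rewrite ler_norml /x => /andP[a b]; apply/andP; split; nra.
have fx i : (f i)%:~R <= x i by exact: floor_le.
have xf i : x i < (f i)%:~R + 1 by have := floorD1_gt (x i); rewrite intrD.
pose g i : int := f i + K%:Z.
have fK i : 0 <= g i.
  rewrite -(ler_int R) /g intrD; have := xf i; have /andP[+ _] := xr i.
  rewrite -pmulrn natrM; lra.
have fK2 i : (`|g i|%N < K + K.+1)%N.
  rewrite -(ltr_nat R) natr_absz ger0_norm // /g intrD natrD -pmulrn -natr1 !natrM.
  have := fx i; have /andP[_ +] := xr i; lra.
have zE i : (`|g i|%N)%:R - K%:R = (f i)%:~R :> R.
  by rewrite natr_absz ger0_norm // /g intrD -pmulrn addrK.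
have xs i : x i ^+ 2 = 16 * r%:R * u 0 i ^+ 2 by rewrite /x !exprMn s2; ring.
have sumx : \sum_i x i ^+ 2 <= 16 * r%:R.
  rewrite (eq_bigr (fun i => 16 * r%:R * u 0 i ^+ 2)) // -mulr_sumr -uE.
  by rewrite ler_piMr // mulr_ge0.
exists [ffun i => Ordinal (fK2 i)].
  rewrite /innet ipE big_ord1.
  (* From [y^2 <= 5/4 x^2 + 5 (x - y)^2] and a rounding error of at most 1 per coordinate; the two
     parts sum to [20 r + 5 r]. *)
  apply: (@le_trans _ _ (\sum_(i < r) (5 / 4 * x i ^+ 2 + 5))).
    apply: ler_sum => i _; rewrite !mxE !ffunE /= zE.
    have := fx i; have := xf i; set y := (f i)%:~R; set v := x i => h1 h2.
    have : (v - y) ^+ 2 <= 1 by rewrite expr_le1 //; lra.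
    have := sqr_ge0 (v / 2 + 2 * (v - y)); lra.
  rewrite big_split /= -mulr_sumr sumr_const card_ord -[_ *+ r]mulr_natr; lra.
rewrite /= ipE big_ord1.
apply: (@le_trans _ _ (\sum_(i < r) (16 * r%:R)^-1)).
  apply: ler_sum => i _; rewrite !mxE !ffunE /= zE.
  have -> : u 0 i - (4 * s)^-1 * (f i)%:~R = (4 * s)^-1 * (x i - (f i)%:~R).
    by rewrite mulrBr /x mulrA mulVf ?mul1r // gt_eqF // mulr_gt0.
  rewrite -expr2 exprMn exprVn exprMn s2 -natrX /= ler_piMr ?invr_ge0 ?mulr_ge0 //.
  by rewrite expr_le1 //; have := fx i; have := xf i; lra.
rewrite sumr_const card_ord -[_ *+ r]mulr_natr.
have rn0 : r%:R != 0 :> R by rewrite gt_eqF // ltr0n.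
have -> : (16 * r%:R)^-1 * r%:R = 16^-1 :> R by field.
lra.
Qed.

Definition bil (Y : 'M[R]_r) (u v : 'rV[R]_r) : R := ip (u *m Y) v.

Lemma bilDl Y u u' v : bil Y (u + u') v = bil Y u v + bil Y u' v.
Proof. by rewrite /bil mulmxDl ipDl. Qed.

Lemma bilDr Y u v v' : bil Y u (v + v') = bil Y u v + bil Y u v'.
Proof. by rewrite /bil ipDr. Qed.

Lemma bilZl Y c u v : bil Y (c *: u) v = c * bil Y u v.
Proof. by rewrite /bil -scalemxAl ipZl. Qed.

Lemma bilZr Y c u v : bil Y u (c *: v) = c * bil Y u v.
Proof. by rewrite /bil ipZr. Qed.

(* If A is the norm of Y, rounding both arguments to the net gives
   A <= N + (9/16) A. *)
Lemma net_opbound (Y : 'M[R]_r) (N : R) : 0 <= N ->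
  (forall z w, innet z -> innet w -> bil Y (netv z) (netv w) <= 16 * r%:R * N) ->
  opbound Y ((3 * N) ^+ 2) /\ opbound Y^T ((3 * N) ^+ 2).
Proof.
move=> N0 HN.
pose S : set R := [set x | exists u v, [/\ ip u u <= 1, ip v v <= 1 & x = bil Y u v]]%classic.
have R0 : 0 < r%:R :> R by rewrite ltr0n.
have bilCS u v : bil Y u v ^+ 2 <= ip u u * ip Y Y * ip v v.
  apply: le_trans (ip_CS _ _) _; rewrite ler_wpM2r ?ip_ge0 //.
  exact: ip_mulmx_le.
have ip00 : ip (0 : 'rV[R]_r) 0 <= 1 by rewrite ip0r.
have S0 : S 0 by exists 0, 0; split; rewrite // /bil ip0r.
have ubS : has_ubound S.
  exists (ip Y Y + 1) => _ [u [v [u1 v1 ->]]].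
  have := bilCS u v; have : ip u u * ip Y Y * ip v v <= ip Y Y.
    rewrite -[leRHS]mulr1 ler_pM ?mulr_ge0 ?ip_ge0 //.
    by rewrite -[leRHS]mul1r ler_wpM2r ?ip_ge0.
  by have := ip_ge0 Y; nra.
have supS : has_sup S by split => //; exists 0.
pose A := sup S.
have A0 : 0 <= A by apply: sup_upper_bound.
have hom a b u v : 0 < a -> 0 < b -> ip u u <= a ^+ 2 -> ip v v <= b ^+ 2 ->
    bil Y u v <= A * (a * b).
  move=> a0 b0 ua vb; rewrite -ler_pdivrMr ?mulr_gt0 //.
  apply: sup_upper_bound => //; exists (a^-1 *: u), (b^-1 *: v).
  rewrite bilZl bilZr !(ipZl, ipZr) !mulrA -!expr2; split.
  - by rewrite exprVn mulrC ler_pdivrMr ?exprn_gt0 // mul1r.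
  - by rewrite exprVn mulrC ler_pdivrMr ?exprn_gt0 // mul1r.
  - by rewrite mulrC invfM.
set s : R := Num.sqrt r%:R.
have s2 : s ^+ 2 = r%:R by rewrite sqr_sqrtr ?ler0n.
have s0 : 0 < s by rewrite sqrtr_gt0.
have c2 : (4 * s)^-1 ^+ 2 * (25 * r%:R) <= (5 / 4) ^+ 2.
  rewrite exprVn exprMn s2 invfM -mulrA (mulrC 25) (mulrA r%:R^-1) mulVf ?gt_eqF //.
  lra.
have A3 : A <= N + 9 / 16 * A.
  apply: ge_sup; first by exists 0.
  move=> _ [u [v [u1 v1 ->]]].
  have [z zn /= ez] := net_round u1; have [w wn /= ew] := net_round v1.
  rewrite -/s in ez ew; set u0 := (4 * s)^-1 *: netv z in ez *.
  set v0 := (4 * s)^-1 *: netv w in ew *.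
  have nu0 : ip u0 u0 <= (5 / 4) ^+ 2.
    rewrite ipZl ipZr mulrA -expr2; apply: le_trans c2.
    by rewrite ler_wpM2l ?sqr_ge0.
  have -> : u = u0 + (u - u0) by rewrite addrC subrK.
  have -> : v = v0 + (v - v0) by rewrite addrC subrK.
  (* The second argument is rounded only in the term with [u0]; the two errors are [5/4 * 1/4] and
     [1/4 * 1]. *)
  rewrite bilDl [in X in X + _]bilDr.
  have -> : v0 + (v - v0) = v by rewrite addrC subrK.
  have H1 : bil Y u0 v0 <= N.
    rewrite bilZl bilZr mulrA -invfM mulrC ler_pdivrMr ?mulr_gt0 //.
    apply: le_trans (HN _ _ zn wn) _; rewrite mulrC ler_wpM2l //.
    by move: s2; nra.
  have H2 : bil Y u0 (v - v0) <= A * (5 / 4 * 4^-1) by apply: hom.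
  have H3 : bil Y (u - u0) v <= A * (4^-1 * 1) by apply: hom => //; rewrite expr1n.
  lra.
have AN : A <= 3 * N by lra.
have bsq u v : bil Y u v ^+ 2 <= (3 * N) ^+ 2 * ip u u * ip v v.
  have [->|u0] := eqVneq u 0; first by rewrite /bil mul0mx ip0l ip0r expr0n mulr0 mul0r.
  have [->|v0] := eqVneq v 0; first by rewrite /bil !ip0r expr0n mulr0.
  have pu : 0 < ip u u by rewrite lt_def ip_ge0 ip_eq0 u0.
  have pv : 0 < ip v v by rewrite lt_def ip_ge0 ip_eq0 v0.
  pose a := Num.sqrt (ip u u); pose b := Num.sqrt (ip v v).
  have a2 : a ^+ 2 = ip u u by rewrite sqr_sqrtr ?ip_ge0.
  have b2 : b ^+ 2 = ip v v by rewrite sqr_sqrtr ?ip_ge0.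
  have a0 : 0 < a by rewrite sqrtr_gt0.
  have b0 : 0 < b by rewrite sqrtr_gt0.
  have ab0 : 0 <= a * b by rewrite mulr_ge0 ?ltW.
  have H1 : bil Y u v <= 3 * N * (a * b).
    by apply: le_trans (hom a b u v a0 b0 _ _) _; rewrite ?a2 ?b2 // ler_wpM2r.
  have H2 : - bil Y u v <= 3 * N * (a * b).
    rewrite -mulN1r -bilZl; apply: le_trans (hom a b _ v a0 b0 _ _) _; rewrite ?a2 ?b2 //.
      by rewrite ipZl ipZr !mulN1r opprK.
    by rewrite ler_wpM2r.
  rewrite -a2 -b2 -mulrA -!exprMn.
  rewrite -real_normK ?num_real // lerXn2r ?nnegrE //.
    by rewrite mulr_ge0 // mulr_ge0.
  by rewrite ler_norml H1 andbT lerNl.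
(* Taking [v = u Y] in the bilinear bound gives [|u Y|^4 <= (3 N)^2 |u|^2 |u Y|^2], where one factor
   is cancelled; the transpose is treated alike. *)
have self (v : 'rV[R]_r) (x : R) : ip v v ^+ 2 <= x * ip v v -> 0 <= x -> ip v v <= x.
  move=> H x0; have [->//|v0] := eqVneq (ip v v) 0.
  by rewrite -(@ler_pM2r _ (ip v v)) ?lt_def ?v0 ?ip_ge0 // -expr2.
split=> u; apply: self; rewrite ?mulr_ge0 ?sqr_ge0 ?ip_ge0 //.
  exact: bsq u (u *m Y).
have := bsq (u *m Y^T) u; rewrite /bil ip_mulmxl [ip _ (_ *m _)]ipC.
by rewrite trmxK [leRHS]mulrAC.
Qed.

Lemma bilE (Y : 'M[R]_r) u v :
  bil Y u v = \sum_i \sum_j u 0 i * v 0 j * Y i j.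
Proof.
rewrite /bil ipE big_ord1 [RHS]exchange_big; apply: eq_bigr => j _.
rewrite !mxE mulr_suml; apply: eq_bigr => i _; ring.
Qed.

(* A centred two-point law whose moments of order at least 2 are at least 1. *)
Definition dense_weight (b : bool) : R := if b then 3^-1 else 2 / 3.
Definition dense_value (b : bool) : R := if b then 2 else -1.
Definition dense_mx (x : {ffun 'I_r * 'I_r -> bool}) : 'M[R]_r :=
  \matrix_(i, j) dense_value (x (i, j)).

Lemma dense_weight_ge0 b : 0 <= dense_weight b.
Proof. by case: b; rewrite /dense_weight; lra. Qed.

Definition dense_moment (k : nat) : R := \sum_b dense_weight b * dense_value b ^+ k.

Lemma dense_moment0 : dense_moment 0 = 1.
Proof. by rewrite /dense_moment big_bool /dense_weight /dense_value /=; lra. Qed.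

Lemma dense_moment1 : dense_moment 1 = 0.
Proof. by rewrite /dense_moment big_bool /dense_weight /dense_value /=; lra. Qed.

Lemma dense_moment_ge1 k : (1 < k)%N -> 1 <= dense_moment k.
Proof.
have -> : dense_moment k = 3^-1 * 2 ^+ k + 2 / 3 * (-1) ^+ k.
  by rewrite /dense_moment big_bool.
case: k => [|[|[|k]]] // _; first lra.
have k2 : 1 <= 2 ^+ k :> R by rewrite exprn_ege1 // ler1n.
have k1 : -1 <= (-1) ^+ k.+3 :> R.
  by rewrite -signr_odd; case: (odd _); rewrite ?expr0 ?expr1; lra.
rewrite [2 ^+ k.+3]exprS [2 ^+ k.+2]exprS [2 ^+ k.+1]exprS; lra.
Qed.

(** The entries are independent and contribute at most [expR (8 t^2)] each. The squared coefficients
    sum to [theta^2 |z|^2 |w|^2 <= 625 r], hence 5000. *)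
Lemma expR_netbil (theta : R) z w :
  theta ^+ 2 = r%:R^-1 -> innet z -> innet w ->
  Ex dense_weight (fun x => expR (theta * bil (dense_mx x) (netv z) (netv w)))
  <= expR (5000 * r%:R).
Proof.
move=> th2 zn wn.
pose t (ij : 'I_r * 'I_r) := theta * (netv z 0 ij.1 * netv w 0 ij.2).
rewrite (eq_Ex _ (g := fun x => \prod_ij (fun ij b =>
    expR (t ij * dense_value b)) ij (x ij))); last first.
  move=> x; rewrite -expR_sum; congr expR.
  rewrite bilE pair_big mulr_sumr; apply: eq_bigr => -[i j] _ /=.
  by rewrite /dense_mx mxE /t /= !mulrA.
rewrite (Ex_prod _ (fun ij b => expR (t ij * dense_value b))).
apply: (@le_trans _ _ (\prod_ij expR (8 * t ij ^+ 2))).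
  apply: ler_prod => ij _; apply/andP; split.
    by apply: sumr_ge0 => b _; rewrite mulr_ge0 ?dense_weight_ge0 ?expR_ge0.
  have -> : \sum_b dense_weight b * expR (t ij * dense_value b) =
    3^-1 * expR (t ij * 2) + 2 / 3 * expR (t ij * -1) by rewrite big_bool.
  set y := t ij.
  have := expR_le_quadratic (y * 2); have := expR_le_quadratic (y * -1).
  have -> : 2 * (y * 2) ^+ 2 = 8 * y ^+ 2 by ring.
  have : expR (2 * (y * -1) ^+ 2) <= expR (8 * y ^+ 2).
    by rewrite ler_expR; have := sqr_ge0 y; nra.
  lra.
rewrite -expR_sum ler_expR -mulr_sumr.
rewrite (eq_bigr (fun ij => theta ^+ 2 * (netv z 0 ij.1 ^+ 2 * netv w 0 ij.2 ^+ 2))); last first.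
  by move=> ij _; rewrite /t !exprMn.
rewrite -mulr_sumr th2 -(pair_big xpredT xpredT (fun i j => netv z 0 i ^+ 2 * netv w 0 j ^+ 2))
  /=.
under eq_bigr do rewrite -mulr_sumr.
rewrite -mulr_suml; move: zn wn; rewrite /innet !ipE !big_ord1 => zn wn.
have R0 : 0 < r%:R :> R by rewrite ltr0n.
have zw : (\sum_i netv z 0 i ^+ 2) * (\sum_i netv w 0 i ^+ 2) <=
    (25 * r%:R) * (25 * r%:R).
  by apply: ler_pM; rewrite ?sumr_ge0 // => i _; rewrite ?sqr_ge0.
have -> : 5000 * r%:R = 8 * (r%:R^-1 * (25 * r%:R * (25 * r%:R))) :> R.
  by field; rewrite gt_eqF.
by rewrite ler_wpM2l // ler_wpM2l ?invr_ge0 ?(ltW R0).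
Qed.

(** [x ^ (2q)] is at most [(2q)!] times [expR x + expR (- x)], used with the form divided by
    [sqrt r]. As [r = 2q], the factor [(2q)! / r ^ q] is at most [r ^ q], and this is where the
    growth [q ^ q] of the moments arises. *)
Lemma netbil_moment q z w : r = q.*2 -> innet z -> innet w ->
  Ex dense_weight (fun x => (bil (dense_mx x) (netv z) (netv w) / (16 * r%:R)) ^+ q.*2)
  <= 2 * expR (5000 * r%:R) * r%:R ^+ q.
Proof.
move=> rq zn wn.
have q0 : (0 < q)%N by move: r0; rewrite rq double_gt0.
have R0 : 0 < r%:R :> R by rewrite ltr0n.
set s : R := Num.sqrt r%:R.
have s2 : s ^+ 2 = r%:R by rewrite sqr_sqrtr ?ler0n.
have s0 : 0 < s by rewrite sqrtr_gt0.
have key x : (bil (dense_mx x) (netv z) (netv w) / (16 * r%:R)) ^+ q.*2 <=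
    r%:R ^+ q * (expR (s^-1 * bil (dense_mx x) (netv z) (netv w)) +
       expR (- s^-1 * bil (dense_mx x) (netv z) (netv w))).
  set b := bil _ _ _.
  have -> : b / (16 * r%:R) = 16^-1 * (s^-1) * (s^-1 * b).
    by rewrite -s2; field; rewrite gt_eqF.
  rewrite exprMn mulNr.
  apply: le_trans (ler_wpM2l _ (even_expr_le_expR _ q0)) _.
    by rewrite exprn_ge0 // mulr_ge0 ?invr_ge0 ?ltW.
  rewrite mulrA ler_wpM2r ?addr_ge0 ?expR_ge0 //.
  apply: (@le_trans _ _ ((s^-1) ^+ q.*2 * r%:R ^+ q.*2)).
    apply: ler_pM; rewrite ?exprn_ge0 ?mulr_ge0 ?invr_ge0 ?ler0n ?(ltW s0) //.
      by rewrite exprMn ler_piMl ?exprn_ge0 ?invr_ge0 ?(ltW s0) // exprn_ile1 // ; lra.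
    rewrite -natrX ler_nat rq -ffactnn ffact_prod.
    rewrite -[X in (_ <= _ ^ X)%N]card_ord -prod_nat_const.
    by apply: leq_prod => i _; rewrite leq_subr.
  by rewrite -muln2 mulnC !exprM exprVn s2 -exprMn mulrC expr2 -mulrA mulfV ?mulr1 // gt_eqF.
apply: le_trans (le_Ex dense_weight_ge0 key) _.
rewrite ExZ ExD [leRHS]mulrC ler_wpM2l ?exprn_ge0 ?ler0n //.
have := @expR_netbil s^-1 z w _ zn wn; have := @expR_netbil (- s^-1) z w _ zn wn.
by rewrite sqrrN exprVn s2 => /(_ erefl) + /(_ erefl); lra.
Qed.

End Net.

(** The maximum over the net is bounded by a sum of even powers, so that only moments of single
    bilinear forms are needed; the number of net points is exponential in [q], which is harmless
    after a q-th root. *)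
Lemma trace_dense_le (R : realType) (q : nat) (q0 : (0 < q)%N)
    (x : {ffun 'I_q.*2 * 'I_q.*2 -> bool}) :
  \tr (mpow (@dense_mx R _ x *m (dense_mx x)^T) q) <=
  q.*2%:R * 9 ^+ q * \sum_z \sum_w (@innet R q.*2 z)%:R * (@innet R q.*2 w)%:R *
     (bil (dense_mx x) (netv z) (netv w) / (16 * q.*2%:R)) ^+ q.*2.
Proof.
set r := q.*2; have r0 : (0 < r)%N by rewrite double_gt0.
have R0 : 0 < r%:R :> R by rewrite ltr0n.
set Y := dense_mx x.
pose f z w : R := bil Y (netv z) (netv w) / (16 * r%:R).
pose N := \big[Num.max/0]_(zw | @innet R r zw.1 && @innet R r zw.2) f zw.1 zw.2.
set S := \sum_z _.
have even0 (y : R) : 0 <= y ^+ r by rewrite /r -mul2n exprM exprn_ge0 ?sqr_ge0.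
have t0 z w : 0 <= (@innet R r z)%:R * (@innet R r w)%:R * f z w ^+ r.
  by rewrite !mulr_ge0 ?ler0n.
have S0 : 0 <= S by do 2!(apply: sumr_ge0 => ? _).
have NS : N ^+ r <= S.
  rewrite /N; elim/big_ind: _ => [|y y' hy hy'|[z w] /andP[/= zn wn]].
  - by rewrite expr0n eqn0Ngt r0.
  - by rewrite /Num.max; case: ifP.
  - rewrite /S (bigD1 z) //= (bigD1 w) //= zn wn !mul1r -addrA lerDl addr_ge0 //.
      by apply: sumr_ge0 => ? _; rewrite !mulr_ge0 ?ler0n ?even0.
    by do 2!(apply: sumr_ge0 => ? _).
have N0 : 0 <= N by apply: bigmax_ge_id.
have [] := @net_opbound R r r0 Y N N0.
  move=> z w zn wn; rewrite mulrC -ler_pdivrMr ?mulr_gt0 //.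
  apply: (le_bigmax_cond 0 (fun zw => f zw.1 zw.2) (j := (z, w))).
  by rewrite /= zn wn.
move=> o1 o2; apply: le_trans (trace_pow_le _ (sqr_ge0 _) o1 o2) _.
rewrite -mulrA ler_wpM2l ?ler0n // exprAC exprMn.
rewrite (_ : (3 ^+ q * N ^+ q) ^+ 2 = 9 ^+ q * N ^+ r); last first.
  by rewrite exprMn -!exprM mulnC exprM /r -mul2n mulnC; congr (_ ^+ _ * _); ring.
by rewrite ler_wpM2l ?exprn_ge0.
Qed.

Lemma dense_walks (R : realType) : exists2 K : R, 1 <= K &
  forall q, (0 < q)%N ->
  \sum_(s : q.-tuple 'I_q.*2) \sum_(js : q.-tuple 'I_q.*2)
     (nosingle (cedges s js))%:R <= (K * q%:R) ^+ q.
Proof.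
(* Up to the power [q]: 144 is [8 * 9 * 2], with 9 from [(3 * N) ^+ 2], 2 from [r = 2q] and 8
   absorbing the prefactor [4 * q]; [(expR 25 * 4) ^+ 4] counts pairs of net points, and [W0 ^+ 2]
   stands for [expR (5000 r)]. *)
pose W0 := expR (5000 : R); pose K : R := 144 * (expR 25 * 4) ^+ 4 * W0 ^+ 2.
have e1 (y : R) : 0 <= y -> 1 <= expR y by move=> y0; rewrite -expR0 ler_expR.
have K1 : 1 <= K.
  have h1 : 1 <= (expR 25 * 4) ^+ 4 :> R.
    by rewrite exprn_ege1 //; have := e1 25; lra.
  have h2 : 1 <= W0 ^+ 2 by apply: exprn_ege1; apply: e1; exact: ler0n.
  rewrite /K; move: (_ ^+ 4) (_ ^+ 2) h1 h2 => x y x1 y1.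
  have : x * y >= 1 by rewrite -[1]mulr1 ler_pM.
  by rewrite -mulrA; lra.
exists K => // q q0.
set r := q.*2; have r0 : (0 < r)%N by rewrite double_gt0.
pose T (x : {ffun 'I_r * 'I_r -> bool}) : R := \tr (mpow (dense_mx x *m (dense_mx x)^T) q).
apply: (@le_trans _ _ (Ex (dense_weight (R:=R)) T)).
  rewrite (eq_Ex _ (fun x => trace_pow_walks (dense_mx x) q0)).
  rewrite Ex_sum; apply: ler_sum => s _; rewrite Ex_sum; apply: ler_sum => js _.
  set E := cedges s js.
  rewrite (eq_Ex _ (g := fun x => \prod_i (fun i v => @dense_value R v ^+ count_mem i E) i (x
    i))); last first.
    move=> x; rewrite -(prod_count E (fun i => dense_value (x i))).
    by apply: eq_bigr => -[i j] _; rewrite mxE.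
  rewrite (Ex_prod _ (fun i v => @dense_value R v ^+ count_mem i E)).
  apply: (prod_moments_ge E (M := fun _ k => @dense_moment R k)) => *.
  - exact: dense_moment0.
  - exact: dense_moment1.
  - exact: dense_moment_ge1.
have := le_Ex (@dense_weight_ge0 R) (fun x => trace_dense_le R q0 x) => /= H.
apply: le_trans H _; rewrite -/r ExZ Ex_sum.
pose B : R := 2 * expR (5000 * r%:R) * r%:R ^+ q.
have B0 : 0 <= B by rewrite !mulr_ge0 ?expR_ge0 ?exprn_ge0 ?ler0n.
apply: (@le_trans _ _ (r%:R * 9 ^+ q * (((expR 25 * 4) ^+ r) ^+ 2 * B))).
  rewrite ler_wpM2l ?mulr_ge0 ?ler0n ?exprn_ge0 //.
  apply: (@le_trans _ _ (\sum_z \sum_w (@innet R r z)%:R * (@innet R r w)%:R * B)).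
    apply: ler_sum => z _; rewrite Ex_sum; apply: ler_sum => w _; rewrite ExZ.
    case: (boolP (innet z)) => zn; last by rewrite !mul0r.
    case: (boolP (innet w)) => wn; last by rewrite mulr0 !mul0r.
    by rewrite !mul1r netbil_moment.
  under eq_bigr do rewrite -mulr_suml -mulr_sumr.
  rewrite -!mulr_suml ler_wpM2r // expr2.
  have := @card_net R r; set c := \sum_z _ => cn.
  by apply: ler_pM => //; apply: sumr_ge0 => *; rewrite ler0n.
rewrite /B /K.
have -> : ((expR 25 * 4) ^+ r) ^+ 2 = ((expR 25 * 4) ^+ 4) ^+ q :> R.
  by rewrite -!exprM /r -muln2 -mulnA mulnC.
have -> : expR (5000 * r%:R) = (W0 ^+ 2) ^+ q :> R.
  by rewrite -exprM mul2n -expRM_natr.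
set X := _ ^+ 4; set W := _ ^+ 2.
have -> : r%:R = 2 * q%:R :> R by rewrite /r -mul2n natrM.
have q8 : 4 * q%:R <= 8 ^+ q :> R.
  rewrite (_ : 8 = 4 * 2) ?exprMn; last by ring.
  apply: ler_pM => //; last by rewrite -natrX ler_nat ltnW // ltn_expl.
  by case: q q0 {T B B0 r r0} => // k _; rewrite exprS ler_peMr // exprn_ege1 // ler1n.
have X0 : 0 <= X by rewrite exprn_ge0 // mulr_ge0 ?expR_ge0.
have W00 : 0 <= W by rewrite exprn_ge0 ?expR_ge0.
clearbody X W; set Q := X ^+ q * W ^+ q * q%:R ^+ q.
have Q0 : 0 <= Q by rewrite !mulr_ge0 ?exprn_ge0 ?ler0n.
clear T B B0 K K1.
have -> : 2 * q%:R * 9 ^+ q * (X ^+ q * (2 * W ^+ q * (2 * q%:R) ^+ q)) =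
    (4 * q%:R) * ((9 * 2) ^+ q * Q) by rewrite /Q !exprMn; ring.
have -> : (144 * X * W * q%:R) ^+ q = 8 ^+ q * ((9 * 2) ^+ q * Q).
  rewrite /Q mulrA -exprMn (_ : 8 * (9 * 2) = 144); last by ring.
  by rewrite !exprMn !mulrA.
by rewrite ler_wpM2r // mulr_ge0 ?exprn_ge0 // mulr_ge0.
Qed.

(** A property of [K], so that one constant serves both the signed mask (with [U = 1]) and the
    observed noise. [M i k] stands for the k-th moment of entry [i] of a sparse centred matrix. *)
Definition walk_moment_const (R : realType) (K : R) : Prop :=
  forall (m1 m2 q : nat) (p U : R) (M : 'I_m1 * 'I_m2 -> nat -> R),
  (0 < q)%N -> 0 <= p <= 1 -> (m1 + m2)%:R * p <= q%:R -> 0 <= U ->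
  (forall i, M i 0%N = 1) -> (forall i, M i 1%N = 0) ->
  (forall i k, (0 < k)%N -> `|M i k| <= p * U ^+ k) ->
  \sum_(s : q.-tuple 'I_m1) \sum_(js : q.-tuple 'I_m2)
    \prod_i M i (count_mem i (cedges s js)) <=
  (m1 + m2)%:R * (K * U ^+ 2 * q%:R) ^+ q.

Lemma walk_moment_bound (R : realType) :
  exists2 K : R, 1 <= K & walk_moment_const K.
Proof.
have [K K1 HK] := dense_walks R; exists K => // m1 m2 q p U M q0 p01 dp U0 M0 M1 MU.
have p0 : 0 <= p by case/andP: p01.
apply: (@le_trans _ _ (\sum_(s : q.-tuple 'I_m1) \sum_(js : q.-tuple 'I_m2)
   (nosingle (cedges s js))%:R * p ^+ size (undup (cedges s js)) * U ^+ q.*2)).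
  apply: ler_sum => s _; apply: ler_sum => js _.
  have -> : q.*2 = size (cedges s js) by rewrite size_cedges ?size_tuple.
  exact: prod_moments_le.
under eq_bigr do rewrite -mulr_suml.
rewrite -mulr_suml.
apply: le_trans (ler_wpM2r _ (walk_comparison q0 p01 dp)) _; first by rewrite exprn_ge0.
rewrite -[leLHS]mulrA ler_wpM2l ?ler0n //.
have -> : U ^+ q.*2 = (U ^+ 2) ^+ q by rewrite -exprM mul2n.
apply: le_trans (ler_wpM2r _ (HK q q0)) _; first by rewrite exprn_ge0 ?sqr_ge0.
by rewrite -exprMn mulrAC.
Qed.

(** * Symmetrization and contraction *)

Section Symmetrization.
Context {R : realType} {I T : finType}.
Implicit Types (g c : T -> R).

Definition bern (p : R) (b : bool) : R := if b then p else 1 - p.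
Definition coin (b : bool) : R := 2^-1.
Definition sgn (b : bool) : R := if b then 1 else -1.

Lemma bern_ge0 p : 0 <= p <= 1 -> forall b, 0 <= bern p b.
Proof. by move=> p01 []; rewrite /bern; lra. Qed.

Lemma bern_sum p : \sum_b bern p b = 1.
Proof. by rewrite big_bool /=; ring. Qed.

Lemma coin_ge0 b : 0 <= coin b.
Proof. by rewrite invr_ge0. Qed.

Lemma coin_sum : \sum_b coin b = 1.
Proof. by rewrite big_bool /coin /=; field. Qed.

(** A penalized supremum. Starting the maximum at 0 makes it nonnegative, also over an empty index
    type, as Markov's inequality requires. The penalty [c] carries a fraction of [p |X|^2], which
    localizes the process. *)
Definition psup g c : R := \big[Num.max/0]_t (g t - c t).

Lemma psup_ge0 g c : 0 <= psup g c.
Proof. exact: bigmax_ge_id. Qed.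

Lemma psup_ge g c t : g t - c t <= psup g c.
Proof. exact: (le_bigmax_cond 0 (fun t => g t - c t)). Qed.

Lemma psup_le g c M : 0 <= M -> (forall t, g t - c t <= M) -> psup g c <= M.
Proof. by move=> M0 gM; apply: bigmax_le. Qed.

Lemma eq_psup g g' c : g =1 g' -> psup g c = psup g' c.
Proof. by move=> gg; apply: eq_bigr => t _; rewrite gg. Qed.

Lemma psup_attained g c : psup g c = 0 \/ exists t, psup g c = g t - c t.
Proof.
rewrite /psup; elim/big_ind: _ => [|x y hx hy|t _]; first by left.
  by rewrite /Num.max; case: ifP.
by right; exists t.
Qed.

Lemma psup_mid g g' c :
  psup (fun t => (g t + g' t) / 2) c <= (psup g c + psup g' c) / 2.
Proof.
apply: psup_le => [|t].
  by rewrite divr_ge0 // addr_ge0 // psup_ge0.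
by have := psup_ge g c t; have := psup_ge g' c t; lra.
Qed.

(** If both suprema are attained, at [t] and [t'], then [x t - x t'] or its opposite, whichever is
    nonnegative, dominates [y t - y t']. The value 0 acts as a further index where [x] and [y]
    vanish; the bound [|y| <= |x|] covers that case. *)
Lemma psup_contract_step (u x y c : T -> R) :
  (forall t, `|y t| <= `|x t|) -> (forall t t', `|y t - y t'| <= `|x t - x t'|) ->
  psup (fun t => u t + y t) c + psup (fun t => u t - y t) c <=
  psup (fun t => u t + x t) c + psup (fun t => u t - x t) c.
Proof.
move=> yx yxl; set P := psup (fun t => u t + x t) c; set N := psup (fun t => u t - x t) c.
have Pt t : u t + x t - c t <= P := psup_ge _ _ _.
have Nt t : u t - x t - c t <= N := psup_ge _ _ _.
have P0 : 0 <= P := psup_ge0 _ _; have N0 : 0 <= N := psup_ge0 _ _.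
have b1 t : `|y t| <= `|x t| -> u t + y t - c t <= P + N /\ u t - y t - c t <= P + N.
  move: (Pt t) (Nt t); do 2!(case: ler0P => ? // ); move=> *; split; lra.
case: (psup_attained (fun t => u t + y t) c) => [->|[t ->]];
  case: (psup_attained (fun t => u t - y t) c) => [->|[t' ->]] //.
- by rewrite addr0 addr_ge0.
- by rewrite add0r; have [] := b1 t' (yx t').
- by rewrite addr0; have [] := b1 t (yx t).
- have := yxl t t'; move: (Pt t) (Nt t) (Pt t') (Nt t').
  by do 2!(case: ler0P => ? //); move=> *; lra.
Qed.

Definition flip (i : I) (s : {ffun I -> bool}) : {ffun I -> bool} :=
  [ffun j => if j == i then ~~ s j else s j].

Lemma flipK i : involutive (flip i).
Proof.
by move=> s; apply/ffunP => j; rewrite !ffunE; case: eqP => // _; rewrite negbK.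
Qed.

Lemma Ex_coin_flip i (f : {ffun I -> bool} -> R) :
  Ex coin f = Ex coin (fun s => f (flip i s)).
Proof.
rewrite /Ex (reindex_inj (inv_inj (flipK i))); apply: eq_bigr => s _.
by congr (_ * _); apply: eq_bigr.
Qed.

Lemma Ex_coin_neg (f : {ffun I -> bool} -> R) :
  Ex coin f = Ex coin (fun s => f [ffun i => ~~ s i]).
Proof.
rewrite /Ex (reindex_inj (h := fun s : {ffun I -> bool} => [ffun i => ~~ s i])).
  by apply: eq_bigr => s _; congr (_ * _); apply: eq_bigr.
apply: inv_inj => s; apply/ffunP => i; by rewrite !ffunE negbK.
Qed.

Lemma contraction (x y : T -> I -> R) c :
  (forall t i, `|y t i| <= `|x t i|) ->
  (forall t t' i, `|y t i - y t' i| <= `|x t i - x t' i|) ->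
  Ex coin (fun s => psup (fun t => \sum_i sgn (s i) * y t i) c) <=
  Ex coin (fun s => psup (fun t => \sum_i sgn (s i) * x t i) c).
Proof.
move=> yx yxl.
pose mix (J : seq I) t i := if i \in J then x t i else y t i.
pose F J := Ex coin (fun s => psup (fun t => \sum_i sgn (s i) * mix J t i) c).
have step i J : i \notin J -> F J <= F (i :: J).
  move=> iJ.
  (* Averaging over the flip of sign [i] pairs the two signs of that coordinate, all the others
     being frozen in [u]. *)
  have dbl J' : F J' = 2^-1 * Ex coin (fun s =>
      psup (fun t => \sum_j sgn (s j) * mix J' t j) c +
      psup (fun t => \sum_j sgn (flip i s j) * mix J' t j) c).
    rewrite ExD -(Ex_coin_flip i (fun s => psup (fun t => \sum_j sgn (s j) * mix J' t j) c)).
    by rewrite /F; field.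
  rewrite !dbl ler_wpM2l ?invr_ge0 //; apply: (le_Ex coin_ge0) => s.
  pose u t := \sum_(j | j != i) sgn (s j) * mix J t j.
  have E J' z : (forall t, mix J' t i = z t) ->
      (forall t j, j != i -> mix J' t j = mix J t j) ->
      psup (fun t => \sum_j sgn (s j) * mix J' t j) c +
      psup (fun t => \sum_j sgn (flip i s j) * mix J' t j) c =
      psup (fun t => u t + z t) c + psup (fun t => u t - z t) c.
    move=> zi mJ.
    have s1 t : \sum_j sgn (s j) * mix J' t j = u t + sgn (s i) * z t.
      rewrite (bigD1 i) //= zi addrC; congr (_ + _).
      by apply: eq_bigr => j ji; rewrite mJ.
    have s2 t : \sum_j sgn (flip i s j) * mix J' t j = u t + sgn (~~ s i) * z t.
      rewrite (bigD1 i) //= zi addrC ffunE eqxx; congr (_ + _).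
      by apply: eq_bigr => j ji; rewrite mJ // ffunE (negPf ji).
    rewrite (eq_psup _ s1) (eq_psup _ s2); case: (s i); rewrite /sgn /=.
      by congr (_ + _); apply: eq_psup => t; ring.
    by rewrite addrC; congr (_ + _); apply: eq_psup => t; ring.
  rewrite (E J (y^~ i)); first last.
  - by [].
  - by move=> t; rewrite /mix (negPf iJ).
  rewrite (E (i :: J) (x^~ i)); first last.
  - by move=> t j ji; rewrite /mix in_cons (negPf ji).
  - by move=> t; rewrite /mix mem_head.
  exact: psup_contract_step (fun t => yx t i) (fun t t' => yxl t t' i).
have all J : uniq J -> F [::] <= F J.
  by elim: J => // i J IH /= /andP[iJ uJ]; apply: le_trans (IH uJ) (step _ _ iJ).
have := all _ (enum_uniq I); rewrite /F.
rewrite [in X in _ <= X -> _](eq_Ex _ (g := fun s => psup (fun t => \sum_i sgn (s i) * x t i)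
  c)) //.
by move=> s; apply: eq_psup => t; apply: eq_bigr => i _; rewrite /mix mem_enum.
Qed.

Lemma Ex_exchange (V V' : finType) (w : V -> R) (w' : V' -> R)
    (f : {ffun I -> V} -> {ffun I -> V'} -> R) :
  Ex w (fun x => Ex w' (f x)) = Ex w' (fun y => Ex w (f^~ y)).
Proof.
rewrite /Ex; under eq_bigr do rewrite mulr_sumr.
rewrite exchange_big; apply: eq_bigr => y _; rewrite mulr_sumr.
by apply: eq_bigr => x _; rewrite mulrCA.
Qed.

Definition maskv (b : bool) : R := if b then 1 else 0.

Lemma bern_mean p : \sum_b bern p b * maskv b = p.
Proof. by rewrite big_bool /= mulr1 mulr0 addr0. Qed.

(** An independent copy enters by Jensen's inequality, and the signs by exchanging the two copies on
    a random set of coordinates. The difference is then split as a half-sum of two processes, which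
    puts the factor 2 inside the supremum and leaves the penalty [c] at full strength. *)
Lemma symmetrization p (f : T -> I -> R) c : 0 <= p <= 1 ->
  Ex (bern p) (fun b => psup (fun t => \sum_i (p - maskv (b i)) * f t i) c) <=
  Ex (bern p) (fun b => Ex coin (fun s =>
    psup (fun t => \sum_i sgn (s i) * (2 * maskv (b i) * f t i)) c)).
Proof.
move=> p01; have w0 := bern_ge0 p01; have w1 := bern_sum p.
pose Phi (d : I -> R) := psup (fun t => \sum_i d i * f t i) c.
have ePhi d d' : d =1 d' -> Phi d = Phi d'.
  by move=> dd; apply: eq_psup => t; apply: eq_bigr => i _; rewrite dd.
have Phi0 d : 0 <= Phi d by apply: psup_ge0.
apply: (@le_trans _ _ (Ex (bern p) (fun b => Ex (bern p) (fun b' : {ffun I -> bool} =>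
    Phi (fun i => maskv (b' i) - maskv (b i)))))).
  apply: (le_Ex w0) => b; apply: psup_le => [|t].
    by apply: (Ex_ge0 w0) => b'; apply: psup_ge0.
  have -> : \sum_i (p - maskv (b i)) * f t i - c t =
      Ex (bern p) (fun b' : {ffun I -> bool} => \sum_i (maskv (b' i) - maskv (b i)) * f t i - c
        t).
    rewrite ExD Ex_cst // Ex_sum; congr (_ - _); apply: eq_bigr => i _.
    rewrite (eq_Ex _ (g := fun b' : {ffun I -> bool} => f t i * (maskv (b' i) - maskv (b i))));
      last first.
      by move=> b'; rewrite mulrC.
    by rewrite ExZ ExD Ex_cst // (Ex_coord w1 i maskv) bern_mean mulrC.
  by apply: (le_Ex w0) => b'; apply: psup_ge.
set A := Ex _ _.
pose half (s : {ffun I -> bool}) (b b' : {ffun I -> bool}) : {ffun I -> bool} :=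
  [ffun i => if s i then b i else b' i].
have AE (s : {ffun I -> bool}) : A = Ex (bern p) (fun b => Ex (bern p) (fun b' =>
    Phi (fun i => sgn (s i) * (maskv (b' i) - maskv (b i))))).
  rewrite /A /Ex; under eq_bigr do rewrite mulr_sumr.
  under [RHS]eq_bigr do rewrite mulr_sumr.
  rewrite !pair_big /=.
  rewrite (reindex_inj (h := fun bb : {ffun I -> bool} * {ffun I -> bool} =>
    (half s bb.1 bb.2, half s bb.2 bb.1))) /=; last first.
    apply: inv_inj => -[b b']; congr (_, _); apply/ffunP => i; rewrite !ffunE /=;
      by case: (s i).
  apply: eq_bigr => -[b b'] _ /=; rewrite !mulrA -!big_split /=; congr (_ * _).
    by apply: eq_bigr => i _; rewrite !ffunE; case: (s i) => //; rewrite mulrC.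
  apply: ePhi => i; rewrite !ffunE; case: (s i); rewrite /sgn; ring.
have -> : A = Ex coin (fun s : {ffun I -> bool} => A) by rewrite (Ex_cst coin_sum).
pose V (s b : {ffun I -> bool}) := Phi (fun i => 2 * sgn (s i) * maskv (b i)).
apply: (@le_trans _ _ (Ex coin (fun s : {ffun I -> bool} => 2^-1 * Ex (bern p) (V s) +
     2^-1 * Ex (bern p) (V [ffun i => ~~ s i])))).
  apply: (le_Ex coin_ge0) => s; rewrite (AE s).
  apply: (@le_trans _ _ (Ex (bern p) (fun b => Ex (bern p) (fun b' =>
      2^-1 * V s b' + 2^-1 * V [ffun i => ~~ s i] b)))).
    apply: (le_Ex w0) => b; apply: (le_Ex w0) => b'.
    have := psup_mid (fun t => \sum_i 2 * sgn (s i) * maskv (b' i) * f t i)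
      (fun t => \sum_i 2 * sgn ([ffun i => ~~ s i] i) * maskv (b i) * f t i) c.
    rewrite (eq_psup (g' := fun t => \sum_i sgn (s i) * (maskv (b' i) - maskv (b i)) * f t i));
      last first.
      move=> t; rewrite -big_split mulr_suml; apply: eq_bigr => i _ /=.
      by rewrite ffunE; case: (s i); rewrite /sgn /=; field.
    rewrite /V /Phi; lra.
  rewrite (eq_Ex _ (g := fun b => 2^-1 * Ex (bern p) (V s) + 2^-1 * V [ffun i => ~~ s i] b)).
    by rewrite ExD !ExZ !Ex_cst.
  by move=> b; rewrite ExD !ExZ !Ex_cst.
rewrite ExD !ExZ -(Ex_coin_neg (fun s => Ex (bern p) (V s))) -mulrDl.
rewrite (_ : 2^-1 + 2^-1 = 1) ?mul1r; last by field.
rewrite Ex_exchange; apply: (le_Ex w0) => b; apply: (le_Ex coin_ge0) => s.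
rewrite le_eqVlt; apply/orP; left; apply/eqP.
by apply: eq_psup => t; apply: eq_bigr => i _; ring.
Qed.

End Symmetrization.

(** * Uniform bounds for random masks *)

Section TraceBounds.
Context {R : realType}.

Lemma trace_pow_ge0 m n (G : 'M[R]_(m, n)) e :
  0 <= \tr (mpow (G *m G^T) (2 ^ e)).
Proof.
case: m G => [|m] G; first by rewrite /mxtrace big_ord0.
have := trace_pow_opbound G e (const_mx 1); set u := const_mx 1.
have u0 : 0 < ip u u ^+ (2 ^ e).
  rewrite exprn_gt0 // lt_def ip_ge0 andbT ip_eq0.
  by apply/eqP => /matrixP /(_ 0 0); rewrite !mxE => /eqP; rewrite oner_eq0.
move=> H; rewrite -(pmulr_lge0 _ u0); apply: le_trans H.
by rewrite exprn_ge0 ?ip_ge0.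
Qed.

Lemma nth_root_exists (y : R) q : (0 < q)%N -> 0 <= y ->
  exists2 t, 0 <= t & t ^+ q = y.
Proof.
move=> q0 y0; exists (y `^ q%:R^-1); first exact: powR_ge0.
by rewrite -powR_mulrn ?powR_ge0 // -powRrM mulVf ?powRr1 // pnatr_eq0 -lt0n.
Qed.

Lemma opbound_trace m n (G : 'M[R]_(m, n)) e : exists tau,
  [/\ 0 <= tau, tau ^+ (2 ^ e) = \tr (mpow (G *m G^T) (2 ^ e)) & opbound G tau].
Proof.
have q0 : (0 < 2 ^ e)%N by rewrite expn_gt0.
have [tau t0 tE] := nth_root_exists q0 (trace_pow_ge0 G e).
exists tau; split => // u; rewrite -(@ler_pXn2r _ (2 ^ e)) ?nnegrE ?mulr_ge0 ?ip_ge0 //.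
by rewrite exprMn tE; apply: trace_pow_opbound.
Qed.

End TraceBounds.

Lemma ip_pairE (R : realFieldType) m1 m2 (A B : 'M[R]_(m1, m2)) :
  ip A B = \sum_(i : 'I_m1 * 'I_m2) A i.1 i.2 * B i.1 i.2.
Proof. by rewrite ipE pair_big. Qed.

Section SignedMasks.
Context {R : realType} {m1 m2 : nat}.
Local Notation I := ('I_m1 * 'I_m2)%type.

Definition signed_mask (s b : {ffun I -> bool}) : 'M[R]_(m1, m2) :=
  \matrix_(i, j) (sgn (s (i, j)) * maskv (b (i, j))).

(** The signs cancel the odd moments and leave the even ones equal to [p]: an instance of the walk
    bound with [U = 1]. *)
Lemma trace_signed_mask K p q : walk_moment_const K -> (0 < q)%N -> 0 <= p <= 1 ->
  (m1 + m2)%:R * p <= q%:R ->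
  Ex (bern p) (fun b => Ex coin (fun s =>
     \tr (mpow (signed_mask s b *m (signed_mask s b)^T) q))) <=
  (m1 + m2)%:R * (K * q%:R) ^+ q.
Proof.
move=> HK q0 p01 dp.
pose cs k : R := \sum_v coin v * sgn v ^+ k.
pose M (i : I) k : R := \sum_v bern p v * (maskv v ^+ k * cs k).
have p0 : 0 <= p by case/andP: p01.
have := HK m1 m2 q p 1 M q0 p01 dp ler01; rewrite expr1n mulr1.
have cs1 k : `|cs k| <= 1.
  have -> : cs k = 2^-1 * 1 ^+ k + 2^-1 * (-1) ^+ k by rewrite /cs big_bool.
  rewrite expr1n -signr_odd; case: (odd k); rewrite ?expr0 ?expr1 ler_norml; lra.
have ME i k : (0 < k)%N -> M i k = p * cs k.
  move=> k0; have -> : M i k = p * (1 ^+ k * cs k) + (1 - p) * (0 ^+ k * cs k).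
    by rewrite /M big_bool.
  by rewrite expr1n expr0n eqn0Ngt k0 !mul0r mul1r mulr0 addr0.
have H0 i : M i 0%N = 1.
  have c0 : cs 0%N = 1 by rewrite /cs big_bool /coin /=; field.
  rewrite /M c0 -[RHS](bern_sum p); apply: eq_bigr => v _; by rewrite expr0 !mulr1.
have H1 i : M i 1%N = 0.
  rewrite ME // (_ : cs 1%N = 0) ?mulr0 //.
  by rewrite /cs big_bool /coin /sgn /=; field.
have H2 i k : (0 < k)%N -> `|M i k| <= p * 1 ^+ k.
  by move=> k0; rewrite ME // normrM (ger0_norm p0) ler_wpM2l // expr1n.
move=> /(_ H0 H1 H2); apply: le_trans; rewrite le_eqVlt; apply/orP; left; apply/eqP.
rewrite (eq_Ex _ (g := fun b => \sum_(s : q.-tuple 'I_m1) \sum_(js : q.-tuple 'I_m2)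
    \prod_i (fun i v => maskv v ^+ count_mem i (cedges s js) *
                        cs (count_mem i (cedges s js))) i (b i))).
  rewrite Ex_sum; apply: eq_bigr => s _; rewrite Ex_sum; apply: eq_bigr => js _.
  by rewrite (Ex_prod _ (fun i v => maskv v ^+ count_mem i (cedges s js) *
                        cs (count_mem i (cedges s js)))).
move=> b; rewrite (eq_Ex _ (fun s => trace_pow_walks (signed_mask s b) q0)).
rewrite Ex_sum; apply: eq_bigr => s _; rewrite Ex_sum; apply: eq_bigr => js _.
set E := cedges s js.
rewrite (eq_Ex _ (g := fun x => \prod_i (fun i v =>
    sgn v ^+ count_mem i E * maskv (b i) ^+ count_mem i E) i (x i))).
  rewrite (Ex_prod _ (fun i v => sgn v ^+ count_mem i E * maskv (b i) ^+ count_mem i E)).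
  apply: eq_bigr => i _; rewrite mulrC /cs mulr_suml; apply: eq_bigr => v _.
  by rewrite mulrA.
move=> x; under [RHS]eq_bigr do rewrite -exprMn.
rewrite -(prod_count E (fun i => sgn (x i) * maskv (b i))).
by apply: eq_bigr => -[i j] _; rewrite mxE.
Qed.

Lemma ip_signed_mask s b (X : 'M[R]_(m1, m2)) :
  ip (signed_mask s b) X = \sum_i sgn (s i) * (maskv (b i) * X i.1 i.2).
Proof.
rewrite ip_pairE; apply: eq_bigr => -[i j] _ /=.
by rewrite mxE mulrA.
Qed.

Lemma ip_signed_mask_sqr p (X : 'M[R]_(m1, m2)) : 0 <= p <= 1 ->
  Ex (bern p) (fun b => Ex coin (fun s => ip (signed_mask s b) X ^+ 2)) = p * ip X X.
Proof.
move=> p01.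
rewrite (eq_Ex _ (g := fun b => \sum_i (fun i v => (maskv v * X i.1 i.2) ^+ 2) i (b i))).
  rewrite Ex_sum ip_pairE mulr_sumr; apply: eq_bigr => i _ /=.
  rewrite (Ex_coord (bern_sum p) i (fun v => (maskv v * X i.1 i.2) ^+ 2)).
  by rewrite big_bool /bern /maskv /=; ring.
move=> b; rewrite (eq_Ex _ (g := fun s => (\sum_i (fun i v =>
   sgn v * (maskv (b i) * X i.1 i.2)) i (s i)) ^+ 2)).
  rewrite (Ex_sqr_sum coin_sum (h := fun i v => sgn v * (maskv (b i) * X i.1 i.2))).
    by apply: eq_bigr => i _; rewrite big_bool /coin /sgn /=; field.
  by move=> i; rewrite big_bool /coin /sgn /=; field.
by move=> s; rewrite ip_signed_mask.
Qed.

(** Turns the part of [y] above a threshold into a q-th power, so that a trace moment bounds the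
    expected excess. *)
Lemma pos_part_le_expr (y T : R) q : (0 < q)%N -> 0 <= y -> 0 < T ->
  y - T <= T * (y / T) ^+ q.
Proof.
move=> q0 y0 T0; have T00 := ltW T0; have yT : 0 <= y / T by rewrite divr_ge0.
have [le1|ge1] := leP 1 (y / T).
  apply: (@le_trans _ _ (T * (y / T))); last by rewrite ler_wpM2l // ler_eXnr.
  by rewrite mulrC divfK ?gt_eqF // lerBlDr lerDl.
have : y < T by rewrite -[T]mul1r -ltr_pdivrMr.
have : 0 <= T * (y / T) ^+ q by rewrite mulr_ge0 ?exprn_ge0.
lra.
Qed.

Lemma ler_AGM2 (u v x : R) : 0 <= u -> 0 <= v -> x ^+ 2 <= 4 * (u * v) -> x <= u + v.
Proof.
move=> u0 v0 H; rewrite (le_trans (ler_norm _)) // -(@ler_pXn2r _ 2) ?nnegrE ?addr_ge0 //.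
rewrite real_normK ?num_real //; have := sqr_ge0 (u - v); lra.
Qed.

(** [X t] is a fixed matrix [D] of arbitrary rank plus [L t] of rank at most [r]. After
    symmetrization and contraction the process is [8 a <G, D + L t>] with [G] the signed mask. The
    part in [L t] is handled by the operator norm of [G], the part in [D] by the variance of the
    single variable [<G, D>], and the penalty pays for both. *)
Lemma signed_mask_process (T : finType) (K p a cut : R) (r e : nat)
    (D : 'M[R]_(m1, m2)) (L : T -> 'M[R]_(m1, m2)) (sg : bool) (c : T -> R) :
  let q := (2 ^ e)%N in let X t := D + L t in
  walk_moment_const K -> 0 < p <= 1 -> (m1 + m2)%:R * p <= q%:R -> 0 < a -> 0 < cut ->
  (forall t, (\rank (L t) <= r)%N) ->
  (forall t i j, `|X t i j| <= 2 * a) ->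
  (forall t, p / 32 * ip (L t) (L t) + p / 8 * ip D D + cut <= c t) ->
  Ex (bern p) (fun b => psup (fun t =>
     \sum_i (p - maskv (b i)) * (sgn sg * X t i.1 i.2 ^+ 2)) c) <=
  cut * (m1 + m2)%:R * (512 * a ^+ 2 * r%:R * K * q%:R / (p * cut)) ^+ q + 128 * a ^+ 2.
Proof.
move=> q X HK /andP[p0 p1] dp a0 cut0 rL Xa cE.
have p01 : 0 <= p <= 1 by rewrite ltW.
have q0 : (0 < q)%N by rewrite expn_gt0.
have pc0 : 0 <= p * cut := mulr_ge0 (ltW p0) (ltW cut0).
have ar0 : 0 <= 512 * a ^+ 2 * r%:R := mulr_ge0 (mulr_ge0 (ler0n _ _) (sqr_ge0 a)) (ler0n _ _).
have a128 : 0 <= 128 * a ^+ 2 := mulr_ge0 (ler0n _ _) (sqr_ge0 a).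
have B0 := divr_ge0 ar0 pc0.
have nsg : `|sgn sg : R| = 1 by case: sg; rewrite /sgn ?normrN normr1.
apply: le_trans (symmetrization _ _ p01) _.
pose tr s b := \tr (mpow (signed_mask s b *m (signed_mask s b)^T) q).
(* The last coefficient makes the variance [p * ip D D] cancel to [128 * a ^+ 2]; for [D = 0] the
   division by zero yields 0 and the bound persists. *)
pose W s b : R := cut * (512 * a ^+ 2 * r%:R / (p * cut)) ^+ q * tr s b +
   128 * a ^+ 2 / (p * ip D D) * ip (signed_mask s b) D ^+ 2.
apply: (@le_trans _ _ (Ex (bern p) (fun b => Ex coin (fun s => W s b)))); last first.
  rewrite (eq_Ex _ (g := fun b =>
     cut * (512 * a ^+ 2 * r%:R / (p * cut)) ^+ q * Ex coin (tr^~ b) +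
     128 * a ^+ 2 / (p * ip D D) * Ex coin (fun s => ip (signed_mask s b) D ^+ 2))).
    rewrite ExD !ExZ ip_signed_mask_sqr // lerD //.
      apply: le_trans (ler_wpM2l _ (trace_signed_mask HK q0 p01 dp)) _.
        exact: mulr_ge0 (ltW cut0) (exprn_ge0 _ B0).
      rewrite le_eqVlt; apply/orP; left; apply/eqP.
      rewrite -!mulrA; congr (_ * _); rewrite mulrCA; congr (_ * _).
      by rewrite -exprMn; congr (_ ^+ _); rewrite -!mulrA; congr (_ * _);
         rewrite -?mulrA; congr (_ * (_ * _)); ring.
    have [->|DD] := eqVneq (ip D D) 0.
      by rewrite !mulr0.
    by rewrite divfK // mulf_neq0 // gt_eqF.
  by move=> b; rewrite ExD !ExZ.
apply: (le_Ex (bern_ge0 p01)) => b.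
apply: (@le_trans _ _ (Ex coin (fun s => psup (fun t =>
    \sum_i sgn (s i) * (8 * a * (maskv (b i) * X t i.1 i.2))) c))).
  (* On [[-2a, 2a]] the map [x -> 2 x^2] vanishes at 0 and is Lipschitz with constant [8 * a]. *)
  apply: (@contraction _ _ _ (fun t i => 8 * a * (maskv (b i) * X t i.1 i.2))
    (fun t i => 2 * maskv (b i) * (sgn sg * X t i.1 i.2 ^+ 2)) c) => [t|t t'] i.
    have := Xa t i.1 i.2; case: (b i); rewrite /maskv ?mulr0 ?mul0r ?normr0 // => Xt.
    rewrite mulr1 mul1r !normrM nsg mul1r [`|8|]ger0_norm // [`|2|]ger0_norm //.
    by rewrite (gtr0_norm a0); have := normr_ge0 (X t i.1 i.2); nra.
  have := Xa t i.1 i.2; have := Xa t' i.1 i.2.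
  case: (b i); rewrite /maskv ?mulr0 ?mul0r ?subrr ?normr0 // => Xt' Xt.
  rewrite mulr1 !mul1r -!mulrBr subr_sqr !normrM nsg mul1r.
  rewrite [`|8|]ger0_norm // [`|2|]ger0_norm // (gtr0_norm a0).
  have s4 : `|X t i.1 i.2 + X t' i.1 i.2| <= 4 * a.
    by apply: le_trans (ler_normD _ _) _; lra.
  by have := normr_ge0 (X t i.1 i.2 - X t' i.1 i.2); nra.
apply: (le_Ex coin_ge0) => s; apply: psup_le => [|t].
  apply: addr_ge0.
    exact: mulr_ge0 (mulr_ge0 (ltW cut0) (exprn_ge0 _ B0)) (trace_pow_ge0 _ _).
  exact: mulr_ge0 (divr_ge0 a128 (mulr_ge0 (ltW p0) (ip_ge0 D))) (sqr_ge0 _).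
have -> : \sum_i sgn (s i) * (8 * a * (maskv (b i) * X t i.1 i.2)) =
    8 * a * ip (signed_mask s b) (X t).
  by rewrite ip_signed_mask mulr_sumr; apply: eq_bigr => i _; ring.
have [tau [tau0 tauE tauG]] := opbound_trace (signed_mask s b) e.
have gL := ip_rank tau0 tauG (rL t).
rewrite /X ipDr mulrDr; have cEt := cE t.
rewrite /W /tr -tauE; set g1 := ip _ (L t) in gL *; set g2 := ip _ D.
set l := ip (L t) (L t) in gL cEt; set d := ip D D in cEt *.
have l0 : 0 <= l by apply: ip_ge0.
have d0 : 0 <= d by apply: ip_ge0.
have pn0 : p != 0 by rewrite gt_eqF.
have P1 : 8 * a * g1 <= p / 32 * l + 512 * a ^+ 2 * r%:R * tau / p.
  apply: ler_AGM2.
  - exact: mulr_ge0 (divr_ge0 (ltW p0) (ler0n _ _)) l0.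
  - exact: divr_ge0 (mulr_ge0 ar0 tau0) (ltW p0).
  - rewrite exprMn (_ : 4 * _ = (8 * a) ^+ 2 * (r%:R * tau * l)); last by field.
    by rewrite ler_wpM2l ?sqr_ge0.
have P2 : 8 * a * g2 <= p / 8 * d + 128 * a ^+ 2 / (p * d) * g2 ^+ 2.
  have [dz|dn] := eqVneq d 0.
    have -> : g2 = 0.
      by move/eqP: dz; rewrite /d ip_eq0 /g2 => /eqP ->; rewrite ip0r.
    by rewrite dz expr0n !mulr0 addr0.
  apply: ler_AGM2.
  - exact: mulr_ge0 (divr_ge0 (ltW p0) (ler0n _ _)) d0.
  - exact: mulr_ge0 (divr_ge0 a128 (mulr_ge0 (ltW p0) d0)) (sqr_ge0 _).
  - by rewrite le_eqVlt; apply/orP; left; apply/eqP; field; rewrite dn pn0.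
have P3 : 512 * a ^+ 2 * r%:R * tau / p - cut <=
    cut * (512 * a ^+ 2 * r%:R / (p * cut)) ^+ q * tau ^+ q.
  have -> : 512 * a ^+ 2 * r%:R / (p * cut) = 512 * a ^+ 2 * r%:R / p / cut.
    by rewrite invfM mulrA.
  rewrite -[leRHS]mulrA -exprMn (_ : _ / p / cut * tau = 512 * a ^+ 2 * r%:R * tau / p / cut).
    apply: pos_part_le_expr q0 _ cut0.
    exact: divr_ge0 (mulr_ge0 ar0 tau0) (ltW p0).
  by field; rewrite pn0 gt_eqF.
move: P1 P2 P3 cEt; rewrite -/q; lra.
Qed.

(** The index type consists of the bad masks, each carrying a matrix that witnesses its badness. A
    supremum over infinitely many matrices thus becomes a finite maximum, and Markov's inequality
    applies. *)
Lemma mask_process_tail (K p a cut : R) (r e : nat) (D : 'M[R]_(m1, m2))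
    (bad : pred {ffun I -> bool}) (X : {b | bad b} -> 'M[R]_(m1, m2))
    (sg : bool) (c : {b | bad b} -> R) :
  let q := (2 ^ e)%N in
  walk_moment_const K -> 0 < p <= 1 -> (m1 + m2)%:R * p <= q%:R -> 0 < a -> 0 < cut ->
  (forall t, (\rank (X t - D)%R <= r)%N) ->
  (forall t i j, `|X t i j| <= 2 * a) ->
  (forall t, p / 32 * ip (X t - D) (X t - D) + p / 8 * ip D D + cut <= c t) ->
  (forall t : {b | bad b}, 2 * cut <= \sum_i (p - maskv (val t i)) * (sgn sg * X t i.1 i.2 ^+
    2) - c t) ->
  Ex (bern p) (fun b => (bad b)%:R) <=
  (m1 + m2)%:R * (512 * a ^+ 2 * r%:R * K * q%:R / (p * cut)) ^+ q + 128 * a ^+ 2 / cut.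
Proof.
move=> q HK p01 dp a0 cut0 rX Xa cE badX.
have p010 : 0 <= p <= 1 by case/andP: p01 => /ltW -> ->.
have XE t : D + (X t - D) = X t by rewrite addrC subrK.
have Xa' t i j : `|(D + (X t - D)) i j| <= 2 * a by rewrite XE.
have := signed_mask_process sg HK p01 dp a0 cut0 rX Xa' cE; set E := Ex _ _ => H.
set y := _ ^+ _ in H *.
have d0 : 0 <= (m1 + m2)%:R :> R by [].
have lo : 2 * cut * Ex (bern p) (fun b => (bad b)%:R) <= E.
  rewrite -ExZ; apply: (le_Ex (bern_ge0 p010)) => b.
  case: (boolP (bad b)) => bb; last by rewrite mulr0 psup_ge0.
  rewrite mulr1; apply: le_trans (badX (Sub b bb)) _.
  rewrite SubK; set h := fun t : {b | bad b} => _.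
  apply: le_trans (psup_ge h c (Sub b bb)); rewrite lerD2r /h le_eqVlt.
  by apply/orP; left; apply/eqP; apply: eq_bigr => i _; rewrite XE.
have b0 : 0 <= Ex (bern p) (fun b => (bad b)%:R).
  by apply: (Ex_ge0 (bern_ge0 p010)) => b; rewrite ler0n.
rewrite -(ler_pM2l cut0) mulrDr mulrA [cut * (_ / _)]mulrCA divff ?gt_eqF // mulr1.
apply: le_trans H; apply: le_trans lo; rewrite -mulrA.
have : 0 <= cut * Ex (bern p) (fun b => (bad b)%:R) by rewrite mulr_ge0 // ltW.
lra.
Qed.

(** [D] is a centre of the set [C], possibly of full rank, with [ip D D] controlled by [ip X X] for
    every [X] in [C]. Hence the sacrificed half of [p * ip X X] also pays for the fluctuation along
    [D]. *)
Lemma mask_lower_tail (K p a cut eta : R) (r e : nat) (D : 'M[R]_(m1, m2))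
    (C : set 'M[R]_(m1, m2)) :
  let q := (2 ^ e)%N in
  walk_moment_const K -> 0 < p <= 1 -> (m1 + m2)%:R * p <= q%:R -> 0 < a -> 0 < cut ->
  p * eta ^+ 2 <= cut ->
  (forall X, C X -> [/\ (\rank (X - D)%R <= r)%N, forall i j, `|X i j| <= 2 * a &
     ip D D <= 2 * ip X X + 2 * eta ^+ 2]) ->
  Ex (bern p) (fun b => `[< exists2 X, C X &
     \sum_i maskv (b i) * X i.1 i.2 ^+ 2 < p / 2 * ip X X - 4 * cut >]%:R) <=
  (m1 + m2)%:R * (512 * a ^+ 2 * r%:R * K * q%:R / (p * cut)) ^+ q + 128 * a ^+ 2 / cut.
Proof.
move=> q HK p01 dp a0 cut0 pe HC; have p0 : 0 <= p by case/andP: p01 => /ltW.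
pose bad (b : {ffun I -> bool}) := `[< exists2 X, C X &
     \sum_i maskv (b i) * X i.1 i.2 ^+ 2 < p / 2 * ip X X - 4 * cut >].
have wit (t : {b | bad b}) : {X | C X &
     \sum_i maskv (val t i) * X i.1 i.2 ^+ 2 < p / 2 * ip X X - 4 * cut}.
  by apply: cid2; have /asboolP := valP t.
pose X t := s2val (wit t); have CX t : C (X t) := s2valP (wit t).
have bX t := s2valP' (wit t).
apply: (@mask_process_tail K p a cut r e D bad X true
  (fun t => p / 2 * ip (X t) (X t) + 2 * cut)) => // t.
- by have [] := HC _ (CX t).
- by have [] := HC _ (CX t).
- have [_ _ DX] := HC _ (CX t).
  have : ip (X t - D) (X t - D) <= 2 * ip (X t) (X t) + 2 * ip D D.
    have := ip_ge0 (X t + D).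
    by rewrite !(ipDl, ipDr, ipNl, ipNr); lra.
  set x := ip (X t) (X t) in DX *; set y := ip _ _; set z := ip D D in DX * => yz.
  have h1 : p * z <= p * (2 * x + 2 * eta ^+ 2) by rewrite ler_wpM2l.
  have h2 : p * y <= p * (2 * x + 2 * z) by rewrite ler_wpM2l.
  have h3 : 0 <= p * x by rewrite mulr_ge0 // ip_ge0.
  lra.
- have := bX t; rewrite -/(X t) => bt.
  have -> : \sum_i (p - maskv (val t i)) * (sgn true * X t i.1 i.2 ^+ 2) =
      p * ip (X t) (X t) - \sum_i maskv (val t i) * X t i.1 i.2 ^+ 2.
    rewrite ip_pairE mulr_sumr -sumrB; apply: eq_bigr => i _.
    by rewrite /sgn; ring.
  lra.
Qed.

(** The matrices of [C] themselves have low rank and bounded norm, so the centre is 0 and the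
    penalty is constant. *)
Lemma mask_upper_tail (K p a cut rho2 : R) (r e : nat) (C : set 'M[R]_(m1, m2)) :
  let q := (2 ^ e)%N in
  walk_moment_const K -> 0 < p <= 1 -> (m1 + m2)%:R * p <= q%:R -> 0 < a -> 0 < cut ->
  p * rho2 <= cut ->
  (forall X, C X -> [/\ (\rank X <= r)%N, forall i j, `|X i j| <= 2 * a &
     ip X X <= rho2]) ->
  Ex (bern p) (fun b => `[< exists2 X, C X &
     5 * cut < \sum_i maskv (b i) * X i.1 i.2 ^+ 2 >]%:R) <=
  (m1 + m2)%:R * (512 * a ^+ 2 * r%:R * K * q%:R / (p * cut)) ^+ q + 128 * a ^+ 2 / cut.
Proof.
move=> q HK p01 dp a0 cut0 pe HC; have p0 : 0 <= p by case/andP: p01 => /ltW.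
pose bad (b : {ffun I -> bool}) := `[< exists2 X, C X &
     5 * cut < \sum_i maskv (b i) * X i.1 i.2 ^+ 2 >].
have wit (t : {b | bad b}) : {X | C X &
     5 * cut < \sum_i maskv (val t i) * X i.1 i.2 ^+ 2}.
  by apply: cid2; have /asboolP := valP t.
pose X t := s2val (wit t); have CX t : C (X t) := s2valP (wit t).
have bX t := s2valP' (wit t).
apply: (@mask_process_tail K p a cut r e 0 bad X false (fun t => 2 * cut)) => // t.
- by rewrite subr0; have [] := HC _ (CX t).
- by have [] := HC _ (CX t).
- have [_ _ Xr] := HC _ (CX t); rewrite subr0 ip0r mulr0.
  have h : p * ip (X t) (X t) <= p * rho2 by rewrite ler_wpM2l.
  have := ip_ge0 (X t); nra.
- have := bX t; rewrite -/(X t) => bt; have [_ _ Xr] := HC _ (CX t).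
  have h : p * ip (X t) (X t) <= p * rho2 by rewrite ler_wpM2l.
  have -> : \sum_i (p - maskv (val t i)) * (sgn false * X t i.1 i.2 ^+ 2) =
      \sum_i maskv (val t i) * X t i.1 i.2 ^+ 2 - p * ip (X t) (X t).
    rewrite ip_pairE mulr_sumr -sumrB; apply: eq_bigr => i _.
    by rewrite /sgn; ring.
  lra.
Qed.

End SignedMasks.

Local Open Scope classical_set_scope.
Local Open Scope ring_scope.

(** * Expectations of bounded functions *)

Section BoundedExpectation.
Context {d : measure_display} {T : measurableType d} {R : realType}.
Variable P : probability T R.
Implicit Types f g : T -> R.

(** Bounded everywhere rather than almost everywhere: the class is closed under sums and products,
    and integrability is automatic. The noise enters it through [clamp]. *)
Definition bmeas f : Prop :=
  measurable_fun setT f /\ exists K : R, forall w, `|f w| <= K.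

Definition EE f : R := \int[P]_w f w.

Lemma bmeas_integrable f : bmeas f -> P.-integrable setT (EFin \o f).
Proof.
move=> [mf [K fK]]; apply: measurable_bounded_integrable => //.
  by apply: (@le_lt_trans _ _ 1%E); [rewrite -(probability_setT P)|exact: ltry].
exists K; split; first exact: num_real.
by move=> x Kx w _ /=; apply: le_trans (fK w) (ltW Kx).
Qed.

Lemma bmeas_cst c : bmeas (fun=> c).
Proof. by split; [exact: measurable_cst|exists `|c|]. Qed.

Lemma bmeasD f g : bmeas f -> bmeas g -> bmeas (fun w => f w + g w).
Proof.
move=> [mf [K fK]] [mg [L gL]]; split; first exact: measurable_funD.
by exists (K + L) => w; apply: le_trans (ler_normD _ _) (lerD (fK w) (gL w)).
Qed.

Lemma bmeasM f g : bmeas f -> bmeas g -> bmeas (fun w => f w * g w).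
Proof.
move=> [mf [K fK]] [mg [L gL]]; split; first exact: measurable_funM.
by exists (K * L) => w; rewrite normrM ler_pM.
Qed.

Lemma bmeasZ c f : bmeas f -> bmeas (fun w => c * f w).
Proof. by apply: bmeasM; apply: bmeas_cst. Qed.

Lemma bmeasB f g : bmeas f -> bmeas g -> bmeas (fun w => f w - g w).
Proof.
move=> bf bg; have := bmeasD bf (bmeasZ (-1) bg).
by congr bmeas; apply/funext => w; rewrite mulN1r.
Qed.

Lemma bmeasX f n : bmeas f -> bmeas (fun w => f w ^+ n).
Proof.
move=> bf; elim: n => [|n IH]; first by under eq_fun do rewrite expr0; exact: bmeas_cst.
by under eq_fun do rewrite exprS; apply: bmeasM.
Qed.

Lemma bmeas_sum (I : Type) (r : seq I) (Q : pred I) (F : I -> T -> R) :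
  (forall i, bmeas (F i)) -> bmeas (fun w => \sum_(i <- r | Q i) F i w).
Proof.
move=> bF; elim: r => [|i r IH].
  by under eq_fun do rewrite big_nil; exact: bmeas_cst.
under eq_fun do rewrite big_cons; case: (Q i) => //; exact: bmeasD.
Qed.

Lemma bmeas_prod (I : Type) (r : seq I) (Q : pred I) (F : I -> T -> R) :
  (forall i, bmeas (F i)) -> bmeas (fun w => \prod_(i <- r | Q i) F i w).
Proof.
move=> bF; elim: r => [|i r IH].
  by under eq_fun do rewrite big_nil; exact: bmeas_cst.
under eq_fun do rewrite big_cons; case: (Q i) => //; exact: bmeasM.
Qed.

Lemma bmeas_indic A : measurable A -> bmeas (\1_A).
Proof.
move=> mA; split; first exact: measurable_indic.
exists 1 => w; rewrite indicE; case: (w \in A); by rewrite ?normr1 ?normr0.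
Qed.

Lemma EE_cst c : EE (fun=> c) = c.
Proof. by rewrite /EE Rintegral_cst //= probability_setT mulr1. Qed.

Lemma EED f g : bmeas f -> bmeas g -> EE (fun w => f w + g w) = EE f + EE g.
Proof. by move=> bf bg; rewrite /EE RintegralD //; apply: bmeas_integrable. Qed.

Lemma EEZ c f : bmeas f -> EE (fun w => c * f w) = c * EE f.
Proof. by move=> bf; rewrite /EE RintegralZl //; apply: bmeas_integrable. Qed.

Lemma EEB f g : bmeas f -> bmeas g -> EE (fun w => f w - g w) = EE f - EE g.
Proof. by move=> bf bg; rewrite /EE RintegralB //; apply: bmeas_integrable. Qed.

Lemma EE_sum (I : Type) (r : seq I) (Q : pred I) (F : I -> T -> R) :
  (forall i, bmeas (F i)) ->
  EE (fun w => \sum_(i <- r | Q i) F i w) = \sum_(i <- r | Q i) EE (F i).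
Proof.
move=> bF; elim: r => [|i r IH].
  by under eq_fun do rewrite big_nil; rewrite EE_cst big_nil.
rewrite big_cons -IH; under eq_fun do rewrite big_cons; case: (Q i) => //.
by rewrite EED //; apply: bmeas_sum.
Qed.

Lemma le_EE f g : bmeas f -> bmeas g -> (forall w, f w <= g w) -> EE f <= EE g.
Proof.
by move=> bf bg fg; apply: le_Rintegral => //; apply: bmeas_integrable.
Qed.

Lemma eq_EE f g : f =1 g -> EE f = EE g.
Proof. by move=> /funext ->. Qed.

Lemma EE_ge0 f : (forall w, 0 <= f w) -> 0 <= EE f.
Proof. by move=> f0; apply: Rintegral_ge0. Qed.

Lemma EE_indic A : measurable A -> (EE \1_A)%:E = P A.
Proof.
move=> mA; rewrite /EE /Rintegral fineK; first by rewrite integral_indic // setIT.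
rewrite integral_indic // setIT.
by rewrite fin_num_measure.
Qed.

Lemma EE_norm_le f K : bmeas f -> (forall w, `|f w| <= K) -> `|EE f| <= K.
Proof.
move=> bf fK; rewrite ler_norml; apply/andP; split.
  rewrite -(EE_cst (- K)); apply: le_EE => //; first exact: bmeas_cst.
  by move=> w; have := fK w; rewrite ler_norml => /andP[].
rewrite -(EE_cst K); apply: le_EE => //; first exact: bmeas_cst.
by move=> w; have := fK w; rewrite ler_norml => /andP[].
Qed.

Lemma markov_EE A f : measurable A -> bmeas f -> (forall w, 0 <= f w) ->
  (forall w, A w -> 1 <= f w) -> (P A <= (EE f)%:E)%E.
Proof.
move=> mA bf f0 f1; rewrite -EE_indic // lee_fin; apply: le_EE => //.
  exact: bmeas_indic.
move=> w; rewrite indicE; case: (boolP (w \in A)) => // /set_mem; exact: f1.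
Qed.

(* Independence from the indicators of X extends to bounded functions of X by
   rounding them down to multiples of 1/N. *)
Lemma EE_indep_ext d' (T' : measurableType d') (W : T -> R) (X : T -> T') (f : T' -> R) :
  bmeas W -> measurable_fun setT X -> measurable_fun setT f ->
  (exists K : R, forall x, `|f x| <= K) ->
  (forall A, measurable A -> EE (fun w => W w * \1_A (X w)) = EE W * EE (fun w => \1_A (X w))) ->
  EE (fun w => W w * f (X w)) = EE W * EE (fun w => f (X w)).
Proof.
move=> bW mX mf [K fK] HA; have [mW [L WL]] := bW.
have L0 : 0 <= L := le_trans (normr_ge0 _) (WL point).
have bX (g : T' -> R) : measurable_fun setT g -> (exists K : R, forall x, `|g x| <= K) ->
    bmeas (fun w => g (X w)).
  move=> mg [K' gK]; split; last by exists K' => w.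
  exact: measurableT_comp.
have bfX : bmeas (fun w => f (X w)) by apply: bX => //; exists K.
(* Equality follows from closeness at every scale [1 / N]; rounding [f] costs [L / N] in each of the
   two terms. *)
suff close N : `|EE (fun w => W w * f (X w)) - EE W * EE (fun w => f (X w))| <= 2 * L / N.+1%:R.
  apply/eqP; rewrite -subr_eq0 -normr_eq0; apply/eqP/le_anti; rewrite normr_ge0 andbT.
  rewrite leNgt; apply/negP => e0; set e := `|_| in close e0.
  have := close (Num.truncn (e^-1 * (2 * L))); rewrite leNgt => /negP; apply.
  rewrite ltr_pdivrMr ?ltr0n // -ltr_pdivrMl //.
  exact: truncnS_gt.
pose M := (Num.truncn (N.+1%:R * K + 1)).+1.
have MK : N.+1%:R * K + 1 < M%:R by apply: truncnS_gt.
pose v (k : 'I_(M + M).+1) : int := k%:Z - M%:Z.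
pose A (k : 'I_(M + M).+1) := [set x | Num.floor (N.+1%:R * f x) == v k].
pose fN x : R := \sum_k ((v k)%:~R / N.+1%:R) * \1_(A k) x.
have mA k : measurable (A k).
  have -> : A k = (fun x => N.+1%:R * f x) @^-1` `[(v k)%:~R, (v k + 1)%:~R[.
    by apply/seteqP; split => x; rewrite /A /= floor_eq in_itv.
  rewrite -[X in measurable X]setTI; apply: measurable_funM => //.
have N0 : 0 < N.+1%:R :> R by rewrite ltr0n.
have fNE x : fN x = (Num.floor (N.+1%:R * f x))%:~R / N.+1%:R.
  set y := N.+1%:R * f x; set z := Num.floor y.
  have zy : z%:~R <= y := floor_le _.
  have yz : y < z%:~R + 1 by have := floorD1_gt y; rewrite intrD.
  have yM : - (M%:R - 1) < y < M%:R - 1.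
    have := fK x; rewrite ler_norml => /andP[h1 h2]; rewrite /y.
    have := ler_wpM2l (ltW N0) h1; have := ler_wpM2l (ltW N0) h2.
    by move: MK; rewrite mulrN; lra.
  have z0 : 0 <= z + M%:Z.
    by rewrite -(ler_int R) intrD -[M%:~R]pmulrn; move: yM; lra.
  have zM : (`|(z + M%:Z)%R|%N < (M + M).+1)%N.
    by rewrite -(ltr_nat R) natr_absz ger0_norm // intrD -[M%:~R]pmulrn -natr1 natrD; move: yM;
      lra.
  have vz : v (Ordinal zM) = z by rewrite /v /= gez0_abs // addrK.
  rewrite /fN (bigD1 (Ordinal zM)) //= vz indicE mem_set /A ?vz //= mulr1.
  rewrite big1 ?addr0 // => k kz; rewrite indicE memNset ?mulr0 //= => /eqP zk.
  move: kz; rewrite -val_eqE /= -/y -/z in zk *; rewrite zk /v addrNK.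
  by rewrite absz_nat eqxx.
have fNf x : `|f x - fN x| <= N.+1%:R^-1.
  rewrite fNE; set y := N.+1%:R * f x.
  have zy := floor_le y; have := floorD1_gt y; rewrite intrD => yz.
  have -> : f x = y / N.+1%:R by rewrite /y mulrAC divff ?mul1r // gt_eqF.
  have iN : 0 <= N.+1%:R^-1 :> R by rewrite invr_ge0.
  rewrite -mulrBl normrM [`|_^-1|]ger0_norm //.
  rewrite ler_piMl // ger0_norm; lra.
have bA k : bmeas (fun w => \1_(A k) (X w)).
  apply: bX; first exact: measurable_indic.
  by exists 1 => x; rewrite indicE; case: (_ \in _); rewrite ?normr1 ?normr0.
have bfN : bmeas (fun w => fN (X w)) by apply: bmeas_sum => k; apply: bmeasZ.
have EN : EE (fun w => W w * fN (X w)) = EE W * EE (fun w => fN (X w)).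
  rewrite (eq_EE (g := fun w => \sum_k ((v k)%:~R / N.+1%:R) * (W w * \1_(A k) (X w))));
    last first.
    by move=> w; rewrite /fN mulr_sumr; apply: eq_bigr => k _; rewrite mulrCA.
  rewrite EE_sum; last by move=> k; apply/bmeasZ/bmeasM.
  rewrite /fN EE_sum; last by move=> k; apply: bmeasZ.
  rewrite mulr_sumr; apply: eq_bigr => k _; rewrite !EEZ //; last exact: bmeasM.
  by rewrite HA // mulrCA.
have d1 : `|EE (fun w => W w * f (X w)) - EE (fun w => W w * fN (X w))| <= L / N.+1%:R.
  rewrite -EEB; try exact: bmeasM.
  apply: EE_norm_le; first by apply: bmeasB; apply: bmeasM.
  by move=> w; rewrite -mulrBr normrM ler_pM.
have d2 : `|EE (fun w => fN (X w)) - EE (fun w => f (X w))| <= N.+1%:R^-1.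
  rewrite -EEB //; apply: EE_norm_le; first exact: bmeasB.
  by move=> w; rewrite distrC.
have d3 : `|EE W| <= L by apply: EE_norm_le.
have -> : EE (fun w => W w * f (X w)) - EE W * EE (fun w => f (X w)) =
  (EE (fun w => W w * f (X w)) - EE (fun w => W w * fN (X w))) +
  EE W * (EE (fun w => fN (X w)) - EE (fun w => f (X w))).
  by rewrite EN mulrBr addrA addrNK.
apply: le_trans (ler_normD _ _) _; rewrite normrM.
have : `|EE W| * `|EE (fun w => fN (X w)) - EE (fun w => f (X w))| <= L / N.+1%:R.
  by apply: ler_pM.
move=> d4; apply: le_trans (lerD d1 d4) _.
by rewrite -mulrDl (_ : L + L = 2 * L) //; ring.
Qed.

End BoundedExpectation.

(** * Joint law of mask and noise *)

Section MatrixMeasurability.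
Context {R : realType} {m1 m2 : nat}.

Lemma measurable_real_mx_entry i j :
  measurable_fun setT (fun M : real_mx R m1 m2 => M i j : measurableTypeR R).
Proof.
move=> _ A mA; rewrite setTI; apply: sub_sigma_algebra.
by exists i, j, A.
Qed.

Lemma measurable_bool_mx_entry i j :
  measurable_fun setT (fun M : bool_mx m1 m2 => M i j : bool).
Proof.
move=> _ A mA; rewrite setTI; apply: sub_sigma_algebra.
by exists i, j, A.
Qed.

Lemma measurable_to_real_mx d (T : measurableType d) (F : T -> real_mx R m1 m2) :
  (forall i j, measurable_fun setT (fun w => F w i j : measurableTypeR R)) ->
  measurable_fun setT F.
Proof.
move=> mF; apply: (@measurability _ _ _ _ setT F (@mx_cylinders _ (measurableTypeR R) m1 m2)).
  by [].
move=> _ [_ [i [j [A [mA ->]]]] <-].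
by apply: (mF i j).
Qed.

Lemma measurable_to_bool_mx d (T : measurableType d) (F : T -> bool_mx m1 m2) :
  (forall i j, measurable_fun setT (fun w => F w i j : bool)) ->
  measurable_fun setT F.
Proof.
move=> mF; apply: (@measurability _ _ _ _ setT F (@mx_cylinders _ bool m1 m2)).
  by [].
move=> _ [_ [i [j [A [mA ->]]]] <-].
by apply: (mF i j).
Qed.

End MatrixMeasurability.

Lemma measurable_forall_fin d (T : measurableType d) (I : finType) (A : I -> set T) :
  (forall i, measurable (A i)) -> measurable [set w | forall i, A i w].
Proof.
move=> mA; have -> : [set w | forall i, A i w] = \bigcap_(i in [set: I]) A i.
  by apply/seteqP; split => w /= H i //; apply: H.
by apply: fin_bigcap_measurable.
Qed.

Section Design.
Context {R : realType} {m1 m2 : nat}.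
Variables (D : design R m1 m2) (n : nat) (sigma U : R).
Local Notation I := ('I_m1 * 'I_m2)%type.
Local Notation P := (design_prob D).
Local Notation Om := (design_space D).
Local Notation p := (n%:R / (m1 * m2)%:R : R).
Hypotheses (p01 : 0 <= p <= 1) (U0 : 0 < U).
Hypotheses (Bsamp : bernoulli_sampling D n) (Nass : noise_assumption D sigma U).

(** The noise is bounded by [U] only almost surely. The truncated noise is bounded everywhere and
    equals it off a null set, hence has the same moments. *)
Definition clamp (x : R) : R := Num.max (- U) (Num.min U x).

Lemma clamp_id x : `|x| <= U -> clamp x = x.
Proof.
by rewrite ler_norml /clamp => /andP[x1 x2]; rewrite min_r // max_r.
Qed.

Lemma clamp_le x : `|clamp x| <= U.
Proof.
rewrite ler_norml /clamp le_max lexx /= ge_max ge_min lexx /= andbT.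
by rewrite (@le_trans _ _ 0) // ?oppr_le0 ltW.
Qed.

Lemma bmeas_clamp : bmeas (T := measurableTypeR R) clamp.
Proof.
split; last by exists U => x; apply: clamp_le.
apply: measurable_maxr; first exact: measurable_cst.
by apply: measurable_minr => //; exact: measurable_cst.
Qed.

Definition cnoise (i : I) (w : Om) : R := clamp (noise D i.1 i.2 w).
Definition mask (w : Om) : {ffun I -> bool} := [ffun i => bmask D i.1 i.2 w].
Definition maskset (b : {ffun I -> bool}) : set Om := [set w | mask w = b].

Lemma bmeas_cnoise_comp (f : R -> R) : bmeas (T := measurableTypeR R) (fun x => f (clamp x)) ->
  forall i, bmeas (fun w => f (cnoise i w)).
Proof.
move=> [mf [K fK]] i; split; last by exists K => w; apply: fK.
have := measurableT_comp mf (measurable_funP (noise D i.1 i.2)); exact.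
Qed.

Lemma bmeas_cnoise i : bmeas (cnoise i).
Proof. exact: (bmeas_cnoise_comp (f := id) bmeas_clamp). Qed.

Lemma masksetE b : maskset b = [set w | forall i : I, bmask D i.1 i.2 w \in [set b i]].
Proof.
apply/seteqP; split => w /=; first by move=> <- i; rewrite ffunE inE.
by move=> H; apply/ffunP => i; rewrite ffunE; have := H i; rewrite inE.
Qed.

Lemma measurable_maskset b : measurable (maskset b).
Proof.
rewrite masksetE; apply: measurable_forall_fin => i.
have : measurable (bmask D i.1 i.2 @^-1` [set b i]) by exact: measurable_funPTI.
by congr measurable; apply/seteqP; split => w /=; rewrite inE.
Qed.

Lemma prob_maskset b : P (maskset b) = (pweight (bern p) b)%:E.
Proof.
have [dB iB _] := Bsamp.
have -> : maskset b = [set w | forall i : I, [set b i] (bmask D i.1 i.2 w)].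
  by rewrite masksetE; apply/seteqP; split => w /= H i; have := H i; rewrite inE.
rewrite (iB (fun i => [set b i])) // -prodEFin; apply: eq_bigr => i _.
have := dB i.1 i.2 [set b i]; rewrite /distribution /pushforward => ->.
rewrite bernoulli_probE // !diracE; case: (b i); rewrite /bern.
  by rewrite mem_set // memNset //= mule1 mule0 adde0.
by rewrite memNset // mem_set //= mule1 mule0 add0e.
Qed.

(** On rectangles the three independence assumptions (among mask entries, among noise entries, mask
    against noise) apply directly, as the events are finite intersections of cylinders. *)
Lemma EE_mask_noise_rect b (A : I -> set R) :
  (forall i, measurable (A i : set (measurableTypeR R))) ->
  EE P (fun w => \1_(maskset b) w * \prod_i \1_(A i) (noise D i.1 i.2 w)) =
  pweight (bern p) b * \prod_i EE P (fun w => \1_(A i) (noise D i.1 i.2 w)).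
Proof.
move=> mA; have [_ _ iMN] := Bsamp; have [iN _ _ _] := Nass.
pose N i := (noise D i.1 i.2 : Om -> R) @^-1` A i.
have mN i : measurable (N i) by exact: (measurable_funPTI (noise D i.1 i.2) (mA i)).
have ind i : (fun w => \1_(A i) (noise D i.1 i.2 w)) = \1_(N i) :> (Om -> R).
  by apply/funext => w; rewrite !indicE.
pose NN := [set w | forall i, N i w].
have mNN : measurable NN by exact: measurable_forall_fin.
have -> : (fun w => \1_(maskset b) w * \prod_i \1_(A i) (noise D i.1 i.2 w)) =
    \1_(maskset b `&` NN) :> (Om -> R).
  apply/funext => w; rewrite indicI /=; congr (_ * _).
  have [wN|wN] := pselect (NN w).
    by rewrite indicE mem_set // big1 // => i _; rewrite indicE mem_set //; apply: wN.
  rewrite indicE memNset //; have /existsNP[i iw] := wN.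
  by rewrite (bigD1 i) //= indicE memNset // mul0r.
apply: EFin_inj; rewrite EE_indic; last by apply: measurableI => //; exact: measurable_maskset.
have mb : measurable ([set M : bool_mx m1 m2 | forall i : I, [set b i] (M i.1 i.2)]).
  apply: measurable_forall_fin => i; rewrite -[X in measurable X]setTI.
  exact: (measurable_bool_mx_entry i.1 i.2).
have mr : measurable ([set M : real_mx R m1 m2 | forall i : I, A i (M i.1 i.2)]).
  apply: measurable_forall_fin => i; rewrite -[X in measurable X]setTI.
  exact: (measurable_real_mx_entry i.1 i.2).
have := iMN _ _ mb mr.
have -> : @mask_mx R m1 m2 D @^-1` [set M : bool_mx m1 m2 | forall i : I, [set b i] (M i.1
  i.2)] = maskset b.
  apply/seteqP; split => w /=.
    by move=> H; apply/ffunP => i; have := H i; rewrite ffunE mxE.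
  by move=> <- i; rewrite ffunE mxE.
have -> : @noise_mx R m1 m2 D @^-1` [set M : real_mx R m1 m2 | forall i : I, A i (M i.1 i.2)] =
  NN.
  by apply/seteqP; split => w /= H i; have := H i; rewrite /N /= mxE.
move=> ->; rewrite prob_maskset EFinM; congr (_ * _)%E.
have := iN A mA; rewrite -[X in P X]/NN => ->.
rewrite -prodEFin; apply: eq_bigr => i _.
by rewrite ind EE_indic.
Qed.

Lemma bmeas_noise_comp (f : R -> R) i : bmeas (T := measurableTypeR R) f ->
  bmeas (fun w => f (noise D i.1 i.2 w)).
Proof.
move=> [mf [K fK]]; split; last by exists K => w; apply: fK.
by have := measurableT_comp mf (measurable_funP (noise D i.1 i.2)); exact.
Qed.

(** Indicators are replaced by bounded functions one coordinate at a time: with the other factors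
    collected in [W], the induction hypothesis for all sets [A'] at coordinate [j] is what
    [EE_indep_ext] asks for. *)
Lemma EE_mask_noise b (f : I -> R -> R) :
  (forall i, bmeas (T := measurableTypeR R) (f i)) ->
  EE P (fun w => \1_(maskset b) w * \prod_i f i (noise D i.1 i.2 w)) =
  pweight (bern p) b * \prod_i EE P (fun w => f i (noise D i.1 i.2 w)).
Proof.
move=> bf.
pose mix (J : seq I) (A : I -> set R) i x := if i \in J then f i x else \1_(A i) x.
have bmix J A : (forall i, measurable (A i : set (measurableTypeR R))) ->
    forall i, bmeas (T := measurableTypeR R) (mix J A i).
  move=> mA i; rewrite /mix; case: (i \in J); first exact: bf.
  exact: bmeas_indic.
have b1 : bmeas (\1_(maskset b) : Om -> R) by apply: bmeas_indic; apply: measurable_maskset.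
have claim J : uniq J -> forall A, (forall i, measurable (A i : set (measurableTypeR R))) ->
    EE P (fun w => \1_(maskset b) w * \prod_i mix J A i (noise D i.1 i.2 w)) =
    pweight (bern p) b * \prod_i EE P (fun w => mix J A i (noise D i.1 i.2 w)).
  elim: J => [_ A mA|j J IH /= /andP[jJ uJ] A mA]; first exact: EE_mask_noise_rect.
  pose upd A' i := if i == j then A' else A i.
  have mupd A' : measurable (A' : set (measurableTypeR R)) ->
      forall i, measurable (upd A' i : set (measurableTypeR R)).
    by move=> mA' i; rewrite /upd; case: eqP.
  have updj A' x : mix J (upd A') j x = \1_A' x by rewrite /mix (negPf jJ) /upd eqxx.
  have updi A' i x : i != j -> mix J (upd A') i x = mix J A i x.
    by move=> ij; rewrite /mix /upd (negPf ij).
  pose W w := \1_(maskset b) w * \prod_(i | i != j) mix J A i (noise D i.1 i.2 w).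
  pose Q := pweight (bern p) b * \prod_(i | i != j) EE P (fun w => mix J A i (noise D i.1 i.2 w)).
  have bW : bmeas W.
    apply: bmeasM => //; apply: bmeas_prod => i; apply: bmeas_noise_comp; exact: bmix.
  have HA A' : measurable (A' : set (measurableTypeR R)) ->
      EE P (fun w => W w * \1_A' (noise D j.1 j.2 w)) =
      Q * EE P (fun w => \1_A' (noise D j.1 j.2 w)).
    move=> mA'; have := IH uJ _ (mupd _ mA').
    rewrite (eq_EE P (g := fun w => W w * \1_A' (noise D j.1 j.2 w))); last first.
      move=> w; rewrite (bigD1 j) //= updj /W mulrAC -mulrA; congr (_ * _).
      by congr (_ * _); apply: eq_bigr => i ij; rewrite updi.
    move=> ->; rewrite (bigD1 j) //= /Q -[RHS]mulrA; congr (_ * _); rewrite [RHS]mulrC.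
    congr (_ * _); first by apply: eq_EE => w; rewrite updj.
    by apply: eq_bigr => i ij; apply: eq_EE => w; rewrite updi.
  (* The choice [A' = setT] isolates the expectation of [W]. *)
  have EW : EE P W = Q.
    have := HA setT measurableT.
    rewrite (eq_EE P (g := W)); last by move=> w; rewrite indicT mulr1.
    have -> : EE P (fun w => \1_[set: measurableTypeR R] (noise D j.1 j.2 w)) = 1.
      by rewrite -[RHS](EE_cst P); apply: eq_EE => w; rewrite indicT.
    by rewrite mulr1.
  have [mfj bfj] := bf j.
  have := @EE_indep_ext _ _ _ P _ _ W (noise D j.1 j.2) (f j) bW
    (measurable_funP _) mfj bfj.
  rewrite EW => /(_ HA).
  have mixj A' x : mix (j :: J) A' j x = f j x by rewrite /mix mem_head.
  have mixi i x : i != j -> mix (j :: J) A i x = mix J A i x.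
    by move=> ij; rewrite /mix in_cons (negPf ij).
  have -> : EE P (fun w => \1_(maskset b) w * \prod_i mix (j :: J) A i (noise D i.1 i.2 w)) =
      EE P (fun w => W w * f j (noise D j.1 j.2 w)).
    apply: eq_EE => w; rewrite (bigD1 j) //= mixj /W -[RHS]mulrA; congr (_ * _).
    rewrite [RHS]mulrC.
    by congr (_ * _); apply: eq_bigr => i ij; rewrite mixi.
  move=> ->; rewrite [in RHS](bigD1 j) //= /Q -[LHS]mulrA; congr (_ * _); rewrite [LHS]mulrC.
  congr (_ * _); first by apply: eq_EE => w; rewrite mixj.
  by apply: eq_bigr => i ij; apply: eq_EE => w; rewrite mixi.
have mE A i x : mix (index_enum I) A i x = f i x by rewrite /mix mem_index_enum.
have := claim _ (index_enum_uniq I) (fun=> setT) (fun=> measurableT).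
rewrite (eq_EE P (g := fun w => \1_(maskset b) w * \prod_i f i (noise D i.1 i.2 w))); last first.
  by move=> w; congr (_ * _); apply: eq_bigr => i _; rewrite mE.
move=> ->; congr (_ * _); apply: eq_bigr => i _.
by apply: eq_EE => w; rewrite mE.
Qed.

Lemma mask_indic_sum (F : {ffun I -> bool} -> R) w :
  F (mask w) = \sum_b \1_(maskset b) w * F b.
Proof.
rewrite (bigD1 (mask w)) //= indicE mem_set // mul1r big1 ?addr0 // => b bw.
by rewrite indicE memNset ?mul0r // /maskset /= => wb; move: bw; rewrite wb eqxx.
Qed.

Lemma EE_mask (F : {ffun I -> bool} -> R) :
  EE P (fun w => F (mask w)) = Ex (bern p) F.
Proof.
rewrite (eq_EE P (g := fun w => \sum_b F b * \1_(maskset b) w)); last first.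
  by move=> w; rewrite (mask_indic_sum F); apply: eq_bigr => b _; rewrite mulrC.
have bm b : bmeas (\1_(maskset b) : Om -> R).
  by apply: bmeas_indic; apply: measurable_maskset.
rewrite EE_sum; last by move=> b; apply: bmeasZ.
apply: eq_bigr => b _; rewrite EEZ // mulrC; congr (_ * _).
by apply: EFin_inj; rewrite EE_indic ?prob_maskset //; apply: measurable_maskset.
Qed.

Lemma EE_mask_cnoise (g : I -> bool -> R -> R) :
  (forall i v, bmeas (T := measurableTypeR R) (fun x => g i v (clamp x))) ->
  EE P (fun w => \prod_i g i (mask w i) (cnoise i w)) =
  \prod_i \sum_v bern p v * EE P (fun w => g i v (cnoise i w)).
Proof.
move=> bg.
have bm b : bmeas (\1_(maskset b) : Om -> R).
  by apply: bmeas_indic; apply: measurable_maskset.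
have bc i v : bmeas (fun w => g i v (cnoise i w)).
  by apply: bmeas_cnoise_comp.
rewrite (eq_EE P (g := fun w => \sum_b \1_(maskset b) w * \prod_i g i (b i) (cnoise i w)));
  last first.
  by move=> w; rewrite -(mask_indic_sum (fun b => \prod_i g i (b i) (cnoise i w))).
rewrite EE_sum; last by move=> b; apply: bmeasM => //; apply: bmeas_prod.
rewrite bigA_distr_bigA; apply: eq_bigr => b _.
rewrite (@EE_mask_noise b (fun i x => g i (b i) (clamp x))) //.
by rewrite /pweight -big_split.
Qed.

End Design.

(** * Moments of the observed noise *)

(** A coefficient [kappa] of [s ^+ 2] bounds the lower tail of the noise energy at the deviation
    [sqrt n * xi] by [alpha ^ (1 / kappa)], so any [kappa < 1] gives strictly less than [alpha]. The
    inequality [(1 + s / 2) ^+ 2 <= expR s] already yields 3/4. *)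
Lemma expRN_le_quadratic {R : realType} (s : R) : 0 <= s ->
  expR (- s) <= 1 - s + 3 / 4 * s ^+ 2.
Proof.
move=> s0; have h : (1 + s / 2) ^+ 2 <= expR s.
  rewrite [in leRHS](_ : s = s / 2 + s / 2); last by rewrite -splitr.
  by rewrite expRD expr2 ler_pM ?expR_ge1Dx // addr_ge0 // divr_ge0.
rewrite expRN; have e0 := expR_gt0 s.
rewrite -[leLHS]mul1r ler_pdivrMr //.
have q0 : 0 <= 1 - s + 3 / 4 * s ^+ 2 by nra.
apply: le_trans (ler_wpM2l q0 h).
have s3 : 0 <= s ^+ 3 by rewrite exprn_ge0.
have s4 : 0 <= s ^+ 4 by rewrite exprn_ge0.
rewrite [leRHS](_ : _ = 1 + s ^+ 3 / 2 + 3 / 16 * s ^+ 4); last by field.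
lra.
Qed.

Section NoiseMoments.
Context {R : realType} {m1 m2 : nat}.
Variables (D : design R m1 m2) (n : nat) (sigma U : R).
Local Notation I := ('I_m1 * 'I_m2)%type.
Local Notation P := (design_prob D).
Local Notation Om := (design_space D).
Local Notation p := (n%:R / (m1 * m2)%:R : R).
Hypotheses (p01 : 0 <= p <= 1) (U0 : 0 < U).
Hypotheses (Bsamp : bernoulli_sampling D n) (Nass : noise_assumption D sigma U).

Local Notation e := (cnoise (D := D) U).
Local Notation B := (mask (D := D)).

Lemma cnoise_ae : {ae P, forall w, forall i : I, e i w = noise D i.1 i.2 w}.
Proof.
have [_ _ _] := Nass; apply: filterS => w H i.
by rewrite /cnoise clamp_id.
Qed.

(** The second alternative spares a finiteness proof: it contradicts the finite moment values of the
    noise assumption. *)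
Lemma EE_cnoise_eq (f : R -> R) i : measurable_fun setT (f : measurableTypeR R ->
  measurableTypeR R) ->
  (EE P (fun w => f (e i w)))%:E = (\int[P]_w (f (noise D i.1 i.2 w))%:E)%E \/
  ~ (\int[P]_w (f (noise D i.1 i.2 w))%:E)%E \is a fin_num.
Proof.
move=> mf.
have E : (\int[P]_w (f (noise D i.1 i.2 w))%:E = \int[P]_w (f (e i w))%:E)%E.
  apply: ae_eq_integral => //.
  - apply/measurable_EFinP; exact: (measurableT_comp mf (measurable_funP (noise D i.1 i.2))).
  - apply/measurable_EFinP; apply: (measurableT_comp mf).
    by have [] := bmeas_cnoise D U0 i.
  - have := cnoise_ae; apply: filterS => w H _.
    by rewrite H.
rewrite E /EE /Rintegral; case: (boolP ((\int[P]_w (f (e i w))%:E)%E \is a fin_num)) => h.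
  by left; rewrite fineK.
by right.
Qed.

Lemma EE_cnoise i : EE P (e i) = 0.
Proof.
have [_ N1 _ _] := Nass.
have := @EE_cnoise_eq id i (@measurable_id _ _ _).
have := N1 i.1 i.2; rewrite unlock => -> [[->]//|].
by rewrite fin_numE.
Qed.

Lemma EE_cnoise2 i : EE P (fun w => e i w ^+ 2) = sigma ^+ 2.
Proof.
have [_ _ N2 _] := Nass.
have := @EE_cnoise_eq (fun x => x ^+ 2) i (exprn_measurable _).
have := N2 i.1 i.2; rewrite unlock => -> [[->]//|].
by rewrite fin_numE.
Qed.

Lemma bclampX k : bmeas (T := measurableTypeR R) (fun x => clamp U x ^+ k).
Proof. by apply: bmeasX; apply: bmeas_clamp. Qed.

Lemma norm_cnoiseX i w k : `|e i w ^+ k| <= U ^+ k.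
Proof. by rewrite normrX lerXn2r ?nnegrE ?normr_ge0 ?clamp_le ?(ltW U0). Qed.

Lemma sigma_le (i : I) : sigma ^+ 2 <= U ^+ 2.
Proof.
rewrite -(EE_cnoise2 i) -(EE_cst P (U ^+ 2)).
apply: le_EE; first exact: (bmeas_cnoise_comp D (f := fun x => x ^+ 2) (bclampX 2)).
  exact: bmeas_cst.
by move=> w; apply: le_trans (ler_norm _) (norm_cnoiseX _ _ _).
Qed.

Lemma bmeas_mask (F : {ffun I -> bool} -> R) : bmeas (fun w => F (B w)).
Proof.
have -> : (fun w => F (B w)) = (fun w => \sum_b \1_(maskset (D := D) b) w * F b).
  by apply/funext => w; rewrite mask_indic_sum.
apply: bmeas_sum => b; apply: bmeasM; last exact: bmeas_cst.
by apply: bmeas_indic; apply: measurable_maskset.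
Qed.

Lemma bmeas_mask_cnoise (f : bool -> R -> R) i :
  (forall v, bmeas (T := measurableTypeR R) (fun x => f v (clamp U x))) ->
  bmeas (fun w => f (B w i) (e i w)).
Proof.
move=> bf.
have -> : (fun w => f (B w i) (e i w)) = (fun w =>
    maskv (B w i) * f true (e i w) + (1 - maskv (B w i)) * f false (e i w)).
  by apply/funext => w; case: (B w i); rewrite /maskv ?mul1r ?subrr ?mul0r ?addr0 // subr0
    mul1r add0r.
apply: bmeasD; apply: bmeasM.
- exact: (bmeas_mask (fun b => maskv (b i))).
- exact: bmeas_cnoise_comp.
- exact: (bmeas_mask (fun b => 1 - maskv (b i))).
- exact: bmeas_cnoise_comp.
Qed.

Definition obs_noise (w : Om) : 'M[R]_(m1, m2) :=
  \matrix_(i, j) (maskv (B w (i, j)) * e (i, j) w).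

Lemma EE_prod_count (s : seq I) :
  EE P (fun w => \prod_(i <- s) (maskv (B w i) * e i w)) =
  \prod_i (fun i k => \sum_v bern p v * EE P (fun w => (maskv v * e i w) ^+ k))
     i (count_mem i s).
Proof.
rewrite (eq_EE P (g := fun w => \prod_i
    (fun i v x => (maskv v * x) ^+ count_mem i s) i (B w i) (e i w))).
  rewrite (EE_mask_cnoise p01 Bsamp Nass (g := fun i v x => (maskv v * x) ^+ count_mem i s)) //
    => i v.
  by apply: bmeasX; apply: bmeasZ; apply: bmeas_clamp.
by move=> w; rewrite prod_count.
Qed.

Lemma EE_trace_obs_noise K q : walk_moment_const K -> (0 < q)%N ->
  (m1 + m2)%:R * p <= q%:R ->
  EE P (fun w => \tr (mpow (obs_noise w *m (obs_noise w)^T) q)) <=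
  (m1 + m2)%:R * (K * U ^+ 2 * q%:R) ^+ q.
Proof.
move=> HK q0 dp; have p0 : 0 <= p by case/andP: p01.
pose M (i : I) k : R := \sum_v bern p v * EE P (fun w => (maskv v * e i w) ^+ k).
have ME i k : (0 < k)%N -> M i k = p * EE P (fun w => e i w ^+ k).
  move=> k0; have -> : M i k = p * EE P (fun w => (1 * e i w) ^+ k) +
      (1 - p) * EE P (fun w => (0 * e i w) ^+ k) by rewrite /M big_bool.
  rewrite (eq_EE P (f := fun w => (0 * e i w) ^+ k) (g := fun=> 0)); last first.
    by move=> w; rewrite mul0r expr0n eqn0Ngt k0.
  rewrite EE_cst mulr0 addr0; congr (_ * _).
  by apply: eq_EE => w; rewrite mul1r.
have := HK m1 m2 q p U M q0 p01 dp (ltW U0).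
have H0 i : M i 0%N = 1.
  rewrite /M -[RHS](bern_sum p); apply: eq_bigr => v _.
  rewrite (eq_EE P (g := fun=> 1)) ?EE_cst ?mulr1 // => w; exact: expr0.
have H1 i : M i 1%N = 0.
  by rewrite ME // (eq_EE P (g := e i)) ?EE_cnoise ?mulr0 // => w; rewrite expr1.
have bX i k : bmeas (fun w => e i w ^+ k).
  exact: (bmeas_cnoise_comp D (f := fun x => x ^+ k) (bclampX k)).
have H2 i k : (0 < k)%N -> `|M i k| <= p * U ^+ k.
  move=> k0; rewrite ME // normrM (ger0_norm p0) ler_wpM2l //.
  by apply: EE_norm_le => // w; apply: norm_cnoiseX.
move=> /(_ H0 H1 H2); apply: le_trans; rewrite le_eqVlt; apply/orP; left; apply/eqP.
have bprod (E : seq I) : bmeas (fun w => \prod_(i <- E) (maskv (B w i) * e i w)).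
  apply: bmeas_prod => i; apply: (bmeas_mask_cnoise (f := fun v x => maskv v * x)) => v.
  by apply: bmeasZ; apply: bmeas_clamp.
rewrite (eq_EE P (g := fun w => \sum_(s : q.-tuple 'I_m1) \sum_(js : q.-tuple 'I_m2)
    \prod_(i <- cedges s js) (maskv (B w i) * e i w))); last first.
  move=> w; rewrite trace_pow_walks //; apply: eq_bigr => s _; apply: eq_bigr => js _.
  by apply: eq_bigr => -[i j] _; rewrite mxE.
rewrite EE_sum; last by move=> s; apply: bmeas_sum => js; apply: bprod.
apply: eq_bigr => s _; rewrite EE_sum; last by move=> js; apply: bprod.
by apply: eq_bigr => js _; rewrite -EE_prod_count.
Qed.

Lemma EE_sqr_sum (h : I -> bool -> R -> R) :
  (forall i v, bmeas (T := measurableTypeR R) (fun x => h i v (clamp U x))) ->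
  (forall i, \sum_v bern p v * EE P (fun w => h i v (e i w)) = 0) ->
  EE P (fun w => (\sum_i h i (B w i) (e i w)) ^+ 2) =
  \sum_i \sum_v bern p v * EE P (fun w => h i v (e i w) ^+ 2).
Proof.
move=> bh h0.
have b1 i : bmeas (fun w => h i (B w i) (e i w)) by apply: bmeas_mask_cnoise.
have Eprod (g : I -> bool -> R -> R) :
    (forall i v, bmeas (T := measurableTypeR R) (fun x => g i v (clamp U x))) ->
    EE P (fun w => \prod_i g i (B w i) (e i w)) =
    \prod_i \sum_v bern p v * EE P (fun w => g i v (e i w)).
  by move=> bg; rewrite (EE_mask_cnoise p01 Bsamp Nass (g := g)).
have one : \sum_v bern p v * EE P (fun w => 1) = 1 by rewrite EE_cst -mulr_suml bern_sum mul1r.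
rewrite (eq_EE P (g := fun w => \sum_i \sum_j h i (B w i) (e i w) * h j (B w j) (e j w)));
  last first.
  by move=> w; rewrite expr2 mulr_suml; apply: eq_bigr => i _; rewrite mulr_sumr.
rewrite EE_sum; last by move=> i; apply: bmeas_sum => j; apply: bmeasM.
apply: eq_bigr => i _; rewrite EE_sum; last by move=> j; apply: bmeasM.
rewrite (bigD1 i) //= [X in _ + X]big1 ?addr0 => [|j ji].
  pose g k v x := if k == i then h i v x ^+ 2 else 1.
  rewrite (eq_EE P (g := fun w => \prod_k g k (B w k) (e k w))); last first.
    by move=> w; rewrite (bigD1 i) //= /g eqxx big1 ?mulr1 ?expr2 // => k /negPf ->.
  rewrite Eprod; last first.
    by move=> k v; rewrite /g; case: eqP => _; [exact: bmeasX|exact: bmeas_cst].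
  rewrite (bigD1 i) //= [X in _ * X]big1 ?mulr1 /g ?eqxx // => k /negPf ->; exact: one.
pose g k v x := if k == i then h i v x else if k == j then h j v x else 1.
rewrite (eq_EE P (g := fun w => \prod_k g k (B w k) (e k w))); last first.
  move=> w; rewrite (bigD1 i) //= /g eqxx (bigD1 j) //= (negPf ji) eqxx.
  by rewrite big1 ?mulr1 // => k /andP[/negPf -> /negPf ->].
rewrite Eprod; last first.
  by move=> k v; rewrite /g; case: eqP => _ //; case: eqP => _ //; exact: bmeas_cst.
by rewrite (bigD1 i) //= /g eqxx h0 mul0r.
Qed.

Lemma EE_ip_obs_noise (X : 'M[R]_(m1, m2)) :
  EE P (fun w => ip (obs_noise w) X ^+ 2) <= p * U ^+ 2 * ip X X.
Proof.
have p0 : 0 <= p by case/andP: p01.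
pose h (i : I) v x := maskv v * x * X i.1 i.2.
rewrite (eq_EE P (g := fun w => (\sum_i h i (B w i) (e i w)) ^+ 2)); last first.
  by move=> w; rewrite ip_pairE; congr (_ ^+ 2); apply: eq_bigr => -[i j] _; rewrite mxE.
rewrite EE_sqr_sum.
- rewrite ip_pairE mulr_sumr; apply: ler_sum => i _.
  rewrite (eq_bigr (fun v => bern p v * (maskv v ^+ 2 * X i.1 i.2 ^+ 2 * EE P (fun w => e i w
    ^+ 2)))); last first.
    move=> v _; congr (_ * _); rewrite -EEZ;
      last exact: (bmeas_cnoise_comp D (f := fun x => x ^+ 2) (bclampX 2)).
    by apply: eq_EE => w; rewrite /h !exprMn mulrAC.
  rewrite EE_cnoise2 big_bool /bern /maskv /=.
  have := sigma_le i; set s2 := sigma ^+ 2 => s2U.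
  have : p * (X i.1 i.2 * X i.1 i.2) * s2 <= p * (X i.1 i.2 * X i.1 i.2) * U ^+ 2.
    by rewrite ler_wpM2l // mulr_ge0 // -expr2 sqr_ge0.
  by rewrite !expr2 !mul1r !mul0r mulr0 addr0; lra.
- move=> i v; apply: bmeasM; last exact: bmeas_cst.
  by apply: bmeasZ; apply: bmeas_clamp.
- move=> i; rewrite big1 // => v _.
  rewrite (eq_EE P (g := fun w => maskv v * X i.1 i.2 * e i w)).
    by rewrite EEZ ?EE_cnoise ?mulr0 //; apply: bmeas_cnoise.
  by move=> w; rewrite /h mulrAC.
Qed.

Definition energy (w : Om) : R := \sum_i maskv (B w i) * e i w ^+ 2.

Lemma EE_energy_var : (0 < m1 * m2)%N ->
  EE P (fun w => (energy w - n%:R * sigma ^+ 2) ^+ 2) <= n%:R * U ^+ 4.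
Proof.
move=> m0; have p0 : 0 <= p by case/andP: p01.
have p1 : p <= 1 by case/andP: p01.
have pn : \sum_(i : I) p = n%:R.
  by rewrite sumr_const -[LHS]mulr_natr card_prod !card_ord divfK // pnatr_eq0 -lt0n.
pose h (i : I) v x := maskv v * x ^+ 2 - p * sigma ^+ 2.
have be2 i : bmeas (fun w => e i w ^+ 2).
  exact: (bmeas_cnoise_comp D (f := fun x => x ^+ 2) (bclampX 2)).
rewrite (eq_EE P (g := fun w => (\sum_i h i (B w i) (e i w)) ^+ 2)); last first.
  move=> w; by congr (_ ^+ 2); rewrite sumrB -mulr_suml pn.
rewrite EE_sqr_sum.
- apply: (@le_trans _ _ (\sum_(i : I) p * U ^+ 4)); last first.
    by rewrite -mulr_suml pn.
  apply: ler_sum => i _.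
  have E4 : EE P (fun w => e i w ^+ 4) <= U ^+ 4.
    have := @EE_norm_le _ _ _ P (fun w => e i w ^+ 4) (U ^+ 4)
      (bmeas_cnoise_comp D (f := fun x => x ^+ 4) (bclampX 4) i) (fun w => norm_cnoiseX i w 4).
    by apply: le_trans; apply: ler_norm.
  have be4 : bmeas (fun w => e i w ^+ 4).
    exact: (bmeas_cnoise_comp D (f := fun x => x ^+ 4) (bclampX 4)).
  have Ev v : EE P (fun w => h i v (e i w) ^+ 2) = maskv v ^+ 2 * EE P (fun w => e i w ^+ 4)
      - 2 * maskv v * p * sigma ^+ 4 + (p * sigma ^+ 2) ^+ 2.
    rewrite (eq_EE P (g := fun w => maskv v ^+ 2 * e i w ^+ 4 +
       ((- 2 * maskv v * p * sigma ^+ 2) * e i w ^+ 2 + (p * sigma ^+ 2) ^+ 2))); last first.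
      by move=> w; rewrite /h; ring.
    rewrite EED; [|exact: bmeasZ|by apply: bmeasD; [exact: bmeasZ|exact: bmeas_cst]].
    rewrite EED; [|exact: bmeasZ|exact: bmeas_cst].
    by rewrite EE_cst EEZ // EEZ // EE_cnoise2; ring.
  rewrite (eq_bigr _ (fun v _ => congr1 _ (Ev v))) big_bool /bern /maskv /=.
  have s4 : 0 <= (p * sigma ^+ 2) ^+ 2 by rewrite sqr_ge0.
  have : p * EE P (fun w => e i w ^+ 4) <= p * U ^+ 4 by rewrite ler_wpM2l.
  move: s4; rewrite expr1n expr0n /=; move: (EE _ _) => x; move: (U ^+ 4) => y; lra.
- move=> i v; apply: bmeasB; last exact: bmeas_cst.
  by apply: bmeasZ; apply: bclampX.
- move=> i; rewrite (eq_bigr (fun v => bern p v * (maskv v * sigma ^+ 2 - p * sigma ^+ 2))).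
    by rewrite big_bool /bern /maskv /=; ring.
  move=> v _; congr (_ * _); rewrite /h EEB ?EE_cst ?EEZ ?EE_cnoise2 //.
    exact: bmeasZ.
  exact: bmeas_cst.
Qed.

Lemma energy_lower_tail (t : R) : (0 < m1 * m2)%N -> (0 < n)%N -> 0 < t ->
  EE P (\1_[set w | energy w <= n%:R * sigma ^+ 2 - t]) <=
  expR (- (t ^+ 2 / (3 * n%:R * U ^+ 4))).
Proof.
move=> m0 n0 t0; have p0 : 0 <= p by case/andP: p01.
have nR : 0 < n%:R :> R by rewrite ltr0n.
have U40 : 0 < U ^+ 4 by rewrite exprn_gt0.
have pn : \sum_(i : I) p = n%:R.
  by rewrite sumr_const -[LHS]mulr_natr card_prod !card_ord divfK // pnatr_eq0 -lt0n.
(* The minimizer of [- la * t + 3 / 4 * la ^+ 2 * n * U ^+ 4]. *)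
pose la := 2 * t / (3 * n%:R * U ^+ 4).
have la0 : 0 < la by rewrite /la !(mulr_gt0, invr_gt0, ltr0n).
have laE : 3 * n%:R * U ^+ 4 * la = 2 * t.
  rewrite /la mulrC divfK // gt_eqF // !mulr_gt0 // ?ltr0n //.
have expo : - (t ^+ 2 / (3 * n%:R * U ^+ 4)) = - (la * t / 2).
  by rewrite /la; field; rewrite !gt_eqF.
rewrite expo; clearbody la.
(* Bounding [y ^+ 2] by [U ^+ 2 * y] makes the majorant of [expR (- (la * y))] affine in the squared
   noise [y], so that its mean involves [sigma ^+ 2] alone. *)
pose ka := la - 3 / 4 * la ^+ 2 * U ^+ 2.
pose g (i : I) (v : bool) x := 1 - ka * (maskv v * x ^+ 2).
have bg i v : bmeas (T := measurableTypeR R) (fun x => g i v (clamp U x)).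
  by apply: bmeasB; [exact: bmeas_cst|do 2 apply: bmeasZ; exact: bclampX].
have be2 i : bmeas (fun w => e i w ^+ 2).
  exact: (bmeas_cnoise_comp D (f := fun x => x ^+ 2) (bclampX 2)).
have ge i v w : expR (- (la * (maskv v * e i w ^+ 2))) <= g i v (e i w).
  rewrite /g; case: v; rewrite /maskv /=; last by rewrite !mul0r !mulr0 oppr0 expR0 addr0.
  rewrite !mul1r.
  have yU : e i w ^+ 2 <= U ^+ 2 by apply: le_trans (ler_norm _) (norm_cnoiseX _ _ _).
  have y0 : 0 <= e i w ^+ 2 by rewrite sqr_ge0.
  move: (e i w ^+ 2) yU y0 => y yU y0.
  apply: le_trans (expRN_le_quadratic _) _; first by rewrite mulr_ge0 // (ltW la0).
  have : la ^+ 2 * y ^+ 2 <= la ^+ 2 * (U ^+ 2 * y).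
    by rewrite ler_wpM2l ?sqr_ge0 // expr2 ler_wpM2r.
  by rewrite /ka exprMn; lra.
pose c := expR (la * (n%:R * sigma ^+ 2 - t)).
have mA : measurable [set w | energy w <= n%:R * sigma ^+ 2 - t].
  rewrite -[X in measurable X]setTI.
  have [me _] : bmeas energy.
    by apply: bmeas_sum => i; apply: bmeasM => //; exact: (bmeas_mask (fun b => maskv (b i))).
  have := me measurableT _ (measurable_itv `]-oo, n%:R * sigma ^+ 2 - t]).
  by congr (measurable (_ `&` _)); apply/seteqP; split => w /=; rewrite in_itv.
have bprod : bmeas (fun w => c * \prod_i g i (B w i) (e i w)).
  by apply: bmeasZ; apply: bmeas_prod => i; exact: bmeas_mask_cnoise.
have g0 i v w : 0 <= g i v (e i w) by apply: le_trans (ge i v w); exact: expR_ge0.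
have := @markov_EE _ _ _ P _ (fun w => c * \prod_i g i (B w i) (e i w)) mA bprod.
rewrite -EE_indic // lee_fin => H; apply: le_trans (H _ _) _.
- by move=> w; rewrite mulr_ge0 ?expR_ge0 // prodr_ge0.
- move=> w /= Ew; apply: (@le_trans _ _ (c * expR (- (la * energy w)))).
    rewrite -expRD -[leLHS]expR0 ler_expR.
    by have := ler_wpM2l (ltW la0) Ew; lra.
  rewrite ler_wpM2l ?expR_ge0 // /energy mulr_sumr -sumrN expR_sum.
  by apply: ler_prod => i _; rewrite expR_ge0 ge.
have Eg i : \sum_v bern p v * EE P (fun w => g i v (e i w)) = 1 - ka * (p * sigma ^+ 2).
  rewrite (eq_bigr (fun v => bern p v * (1 - ka * maskv v * sigma ^+ 2))).
    by rewrite big_bool /bern /maskv /=; ring.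
  move=> v _; congr (_ * _).
  rewrite (eq_EE P (g := fun w => 1 - ka * maskv v * e i w ^+ 2)); last first.
    by move=> w; rewrite /g mulrA.
  rewrite EEB; [|exact: bmeas_cst|exact: bmeasZ].
  by rewrite EE_cst EEZ // EE_cnoise2.
rewrite EEZ; last by apply: bmeas_prod => i; exact: bmeas_mask_cnoise.
rewrite (EE_mask_cnoise p01 Bsamp Nass (g := g)) //.
apply: (@le_trans _ _ (c * \prod_(i : I) expR (- (ka * (p * sigma ^+ 2))))).
  rewrite ler_wpM2l ?expR_ge0 //; apply: ler_prod => i _; apply/andP; split.
    apply: sumr_ge0 => v _; rewrite mulr_ge0 //; last by apply: EE_ge0.
    by apply: bern_ge0; case/andP: p01 => -> ->.
  by rewrite Eg; apply: expR_ge1Dx.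
rewrite -expR_sum /c -expRD ler_expR sumrN -mulr_sumr -mulr_suml pn.
have [->|i0] : sigma ^+ 2 = 0 \/ sigma ^+ 2 <= U ^+ 2.
- have [i _|I0] := pickP (@predT I); first by right; exact: (sigma_le i).
  by exfalso; have := n0; rewrite -(ltr0n R) -pn big1 ?ltxx // => i; have := I0 i.
- by rewrite !mulr0; have := mulr_gt0 la0 t0; rewrite mulrDr !mulrN; lra.
have : la * (3 / 4 * la * (n%:R * (sigma ^+ 2 * U ^+ 2))) <= la * (t / 2).
  rewrite ler_wpM2l ?(ltW la0) //.
  have : n%:R * (sigma ^+ 2 * U ^+ 2) <= n%:R * U ^+ 4.
    by rewrite ler_wpM2l ?(ltW nR) // (_ : U ^+ 4 = U ^+ 2 * U ^+ 2) ?ler_wpM2r ?sqr_ge0 //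
      -exprD.
  by move=> /(ler_wpM2l (ltW la0)); move: laE; lra.
rewrite /ka; lra.
Qed.

End NoiseMoments.

(** * Frobenius geometry *)

Section MatrixGeometry.
Context {R : realType} {m1 m2 : nat}.
Implicit Types A B C M T : 'M[R]_(m1, m2).

Lemma frob_sqr A : frob A ^+ 2 = ip A A.
Proof.
rewrite /frob sqr_sqrtr ?ipE //; last by do 2!apply: sumr_ge0 => ? _; rewrite sqr_ge0.
Qed.

Lemma frob_ge0 A : 0 <= frob A.
Proof. exact: sqrtr_ge0. Qed.

Lemma le_frob A x : 0 <= x -> ip A A <= x ^+ 2 -> frob A <= x.
Proof. by move=> x0; rewrite -frob_sqr ler_pXn2r // nnegrE ?frob_ge0. Qed.

Lemma frob_triangle A B : frob (A + B) <= frob A + frob B.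
Proof.
apply: le_frob; first by rewrite addr_ge0 ?frob_ge0.
rewrite sqrrD !frob_sqr ipDl !ipDr (ipC B A).
have : ip A B <= frob A * frob B.
  rewrite (le_trans (ler_norm _)) // -(@ler_pXn2r _ 2) ?nnegrE ?mulr_ge0 ?frob_ge0 //.
  by rewrite real_normK ?num_real // exprMn !frob_sqr ip_CS.
lra.
Qed.

Lemma frobN A : frob (- A) = frob A.
Proof.
apply/eqP; rewrite -(@eqrXn2 _ 2) ?frob_ge0 // !frob_sqr.
by rewrite ipNl ipNr opprK.
Qed.

Lemma frob_sub C A B : frob (A - B) <= frob (A - C) + frob (B - C).
Proof. by rewrite -(frobN (B - C)) opprB (le_trans _ (frob_triangle _ _)) // subrKA. Qed.

Lemma ip_sub_le A B : ip (A - B) (A - B) <= 2 * ip A A + 2 * ip B B.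
Proof.
have := ip_ge0 (A + B); rewrite !ipDl !ipDr !ipNl !ipNr (ipC B A); lra.
Qed.

(* A ball has diameter twice its radius; for s < 0 the ball is empty and the
   square root vanishes. *)
Lemma frob_diam_ball T (s : R) : (0 < m1)%N -> (0 < m2)%N ->
  frob_diam [set M | frob (M - T) ^+ 2 <= s] = (2 * Num.sqrt s)%:E.
Proof.
move=> m10 m20; apply/eqP; rewrite eq_le; apply/andP; split.
  apply: ge_ereal_sup => _ /= [->|[A As [B Bs <-]]].
    by rewrite lee_fin mulr_ge0 ?sqrtr_ge0.
  have r C : frob (C - T) ^+ 2 <= s -> frob (C - T) <= Num.sqrt s.
    by rewrite frob_sqr => h; apply: le_frob;
      rewrite ?sqrtr_ge0 // sqr_sqrtr // (le_trans (ip_ge0 _) h).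
  by rewrite lee_fin (le_trans (frob_sub T A B)) // mulr_natl mulr2n lerD // r.
have [s0|s0] := ltP s 0.
  by rewrite ltr0_sqrtr // mulr0; apply: ereal_sup_ubound; left.
apply: ereal_sup_ubound; right => /=.
pose E := Num.sqrt s *: delta_mx (Ordinal m10) (Ordinal m20) : 'M[R]_(m1, m2).
have ipE1 : ip E E = s.
  rewrite /E ipZl ipZr mulrA -expr2 sqr_sqrtr // ipE (bigD1 (Ordinal m10)) //=.
  rewrite (bigD1 (Ordinal m20)) //= !mxE !eqxx !big1 ?addr0 ?mulr1 //.
    by move=> i /negPf hi; rewrite big1 // => j _; rewrite !mxE hi mulr0.
  by move=> j /negPf hj; rewrite !mxE hj andbF mulr0.
exists (T + E); first by rewrite addrC addKr frob_sqr ipE1.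
exists (T - E); first by rewrite addrC addKr frobN frob_sqr ipE1.
congr (_%:E); apply/eqP; rewrite -(@eqrXn2 _ 2) ?frob_ge0 ?mulr_ge0 ?sqrtr_ge0 //.
rewrite frob_sqr (_ : T + E - (T - E) = E + E); last first.
  by apply/matrixP => i j; rewrite !mxE; ring.
by rewrite ipDl !ipDr ipE1 exprMn sqr_sqrtr //; apply/eqP; ring.
Qed.

Lemma low_rank_entry k (a : R) M i j : low_rank k a M -> `|M i j| <= a.
Proof.
move=> [_]; apply: le_trans; rewrite [leRHS]/Num.norm /= mx_normrE.
by apply/bigmax_geP; right => /=; exists (i, j).
Qed.

(** An approximate minimizer avoids a compactness argument; the slack, used below with the value
    [a ^+ 2], is of the size of one squared entry. *)
Lemma low_rank_near_minimizer k (a eps : R) M : 0 <= a -> 0 < eps ->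
  exists2 A0, low_rank k a A0 &
    forall A, low_rank k a A -> ip (M - A0) (M - A0) <= ip (M - A) (M - A) + eps.
Proof.
move=> a0 eps0; pose S := [set ip (M - A) (M - A) | A in low_rank k a].
have S0 : has_inf S.
  split; last by exists 0 => _ [A _ <-]; apply: ip_ge0.
  by exists (ip (M - 0) (M - 0)); exists 0 => //; split; rewrite ?mxrank0 // normr0.
have [_ [A0 A0k <-] h] := inf_adherent eps0 S0.
exists A0 => // A Ak; apply: (le_trans (ltW h)); rewrite lerD2r.
by apply: ge_inf; [exact: S0.2|exists A].
Qed.

Lemma rank_sub_low_rank k (a : R) A B : low_rank k a A -> low_rank k a B ->
  (\rank (A - B)%R <= k + k)%N.
Proof.
move=> [rA _] [rB _]; apply: leq_trans (leq_add rA rB).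
by rewrite (leq_trans (mxrank_add _ _)) // mxrank_opp.
Qed.

End MatrixGeometry.

(** Supplies the moment order: a power of two within a factor 2 of [d * p]. *)
Lemma pow2_between {R : realType} (x : R) : 1 <= x ->
  exists e, x <= (2 ^ e)%:R <= 2 * x.
Proof.
move=> x1; have ex : exists e, x <= (2 ^ e)%:R.
  exists (Num.bound x); have /ltW h := archi_boundP (le_trans ler01 x1).
  by apply: le_trans h _; rewrite ler_nat ltnW // ltn_expl.
case: (ex_minnP ex) => e xe emin; exists e; rewrite xe /=.
case: e xe emin => [|e] xe emin; first by rewrite expn0; lra.
have [/emin|h] := leP x (2 ^ e)%:R; first by rewrite ltnn.
by rewrite expnS natrM ler_wpM2l // (ltW h).
Qed.

(** Cruder than a logarithm but sufficient: the sum of [1 / (d k)] over ranks [k <= m <= d] becomes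
    [O(1 / sqrt d)]. *)
Lemma sum_inv_le_sqrt {R : realType} m :
  \sum_(k < m) (k.+1%:R : R)^-1 <= 2 * Num.sqrt m%:R.
Proof.
elim: m => [|m IH]; first by rewrite big_ord0 sqrtr0 mulr0.
rewrite big_ord_recr /=.
set x := Num.sqrt m%:R in IH *; set y := Num.sqrt m.+1%:R.
have x0 : 0 <= x by apply: sqrtr_ge0.
have y0 : 0 < y by rewrite sqrtr_gt0 ltr0n.
have yE : m.+1%:R = y ^+ 2 :> R by rewrite sqr_sqrtr.
have xE : m%:R = x ^+ 2 :> R by rewrite sqr_sqrtr.
have xyE : y ^+ 2 = x ^+ 2 + 1 by rewrite -yE -xE natr1.
apply: (@le_trans _ _ (2 * x + (y ^+ 2)^-1)); first by rewrite -yE lerD2r.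
have y2 : 0 < y ^+ 2 by rewrite exprn_gt0.
have y1 : 1 <= y by nra.
suff : (y ^+ 2)^-1 <= 2 * (y - x) by lra.
rewrite -[leLHS]mul1r ler_pdivrMr //.
have xy : x <= y by nra.
have : (y - x) * (y + x) = 1 by rewrite -subr_sqr xyE; ring.
nra.
Qed.

Lemma sqrt_le_norm_bound {R : realType} (x y w : R) : 0 <= x -> 0 <= y ->
  w ^+ 2 <= x * y -> `|w| <= x / 2 + y / 2.
Proof.
move=> x0 y0 h; apply: ler_AGM2; rewrite ?divr_ge0 //.
rewrite real_normK ?num_real //; lra.
Qed.

(** * Tail bounds at a fixed sample size *)

Lemma bmeas_mulmx_entry {d} {T : measurableType d} {R : realType} m n k
    (F : T -> 'M[R]_(m, n)) (G : T -> 'M[R]_(n, k)) :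
  (forall i j, bmeas (fun w => F w i j)) -> (forall i j, bmeas (fun w => G w i j)) ->
  forall i j, bmeas (fun w => (F w *m G w) i j).
Proof.
move=> bF bG i j.
have -> : (fun w => (F w *m G w) i j) = (fun w => \sum_l F w i l * G w l j).
  by apply/funext => w; rewrite mxE.
by apply: bmeas_sum => l; apply: bmeasM.
Qed.

Section Events.
Context {R : realType} {m1 m2 : nat}.
Variables (D : design R m1 m2) (n : nat) (sigma U K : R) (e : nat).
Local Notation I := ('I_m1 * 'I_m2)%type.
Local Notation P := (design_prob D).
Local Notation Om := (design_space D).
Local Notation p := (n%:R / (m1 * m2)%:R : R).
Local Notation d := ((m1 + m2)%:R : R).
Local Notation q := (2 ^ e)%N.
Hypotheses (p01 : 0 < p <= 1) (U0 : 0 < U) (K1 : 1 <= K) (HK : walk_moment_const K).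
Hypotheses (Bsamp : bernoulli_sampling D n) (Nass : noise_assumption D sigma U).
Hypotheses (d16 : 16 < d) (dp : d * p <= q%:R <= 2 * (d * p)) (ld : ln d <= d * p).

Local Notation W := (obs_noise (D := D) U).
Local Notation B := (mask (D := D)).
Local Notation E3 := (expR 3 : R).

Let p0 : 0 < p. Proof. by case/andP: p01. Qed.
Let p01' : 0 <= p <= 1. Proof. by case/andP: p01 => /ltW -> ->. Qed.
Let d0 : 0 < d. Proof. exact: lt_trans (ltr0n _ 16) d16. Qed.
Let q0 : (0 < q)%N. Proof. by rewrite expn_gt0. Qed.
Let K0 : 0 < K. Proof. exact: lt_le_trans ltr01 K1. Qed.

(* With q >= log d, a ratio below s / e^3 raised to the power q beats the
   dimension factor d. *)
Lemma dim_geometric (s x : R) : 0 <= s <= 1 -> 0 <= x -> x * E3 <= s ->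
  d * x ^+ q <= s * (d ^+ 2)^-1.
Proof.
case/andP=> s0 s1 x0 xs; have E0 : 0 < E3 by apply: expR_gt0.
have xE : x <= s * expR (- 3) by rewrite expRN ler_pdivlMr.
have sq : s ^+ q <= s.
  by rewrite -[leRHS]expr1 ler_wiXn2l.
have Eq : expR (- 3) ^+ q <= (d ^+ 3)^-1.
  rewrite -expRM_natl -[d in leRHS]lnK ?posrE // -expRM_natl -expRN ler_expR.
  case/andP: dp => dq _; have := le_trans ld dq; lra.
apply: (@le_trans _ _ (d * (s * (d ^+ 3)^-1))).
  rewrite ler_wpM2l ?(ltW d0) //; apply: (@le_trans _ _ ((s * expR (- 3)) ^+ q)).
    by rewrite lerXn2r ?nnegrE ?mulr_ge0 ?expR_ge0.
  by rewrite exprMn ler_pM ?exprn_ge0 ?expR_ge0.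
by rewrite mulrCA [d ^+ 3]exprS invfM mulVKf ?gt_eqF.
Qed.

Definition trace_noise w : R := \tr (mpow (W w *m (W w)^T) q).

Lemma bmeas_obs_noise i j : bmeas (fun w => W w i j).
Proof.
have -> : (fun w => W w i j) = (fun w => maskv (B w (i, j)) * cnoise U (i, j) w).
  by apply/funext => w; rewrite mxE.
apply: (bmeas_mask_cnoise D (f := fun v x => maskv v * x)) => v.
by apply: bmeasZ; apply: bmeas_clamp.
Qed.

Lemma bmeas_trace_noise : bmeas trace_noise.
Proof.
have bH i j : bmeas (fun w => (W w *m (W w)^T) i j).
  apply: bmeas_mulmx_entry => [|k l]; first exact: bmeas_obs_noise.
  have -> : (fun w => (W w)^T k l) = (fun w => W w l k) by apply/funext => w; rewrite mxE.
  exact: bmeas_obs_noise.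
apply: bmeas_sum => i; elim: q i {2}i => [|l IH] i j.
  by apply: bmeas_cst.
by apply: (bmeas_mulmx_entry (F := fun w => W w *m (W w)^T)).
Qed.

Lemma measurable_gt (f : Om -> R) x : bmeas f -> measurable [set w | x < f w].
Proof.
move=> [mf _]; rewrite -[X in measurable X]setTI.
have := mf measurableT _ (measurable_itv `]x, +oo[).
by congr (measurable (_ `&` _)); apply/seteqP; split => w /=; rewrite in_itv /= andbT.
Qed.

Lemma EE_markov (f : Om -> R) x c : bmeas f -> (forall w, 0 <= f w) -> 0 < x ->
  EE P f <= c * x -> EE P (\1_[set w | x < f w]) <= c.
Proof.
move=> bf f0 x0 h; have mA := measurable_gt x bf.
have := @markov_EE _ _ _ P _ (fun w => x^-1 * f w) mA (bmeasZ _ bf).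
rewrite -EE_indic // lee_fin EEZ // => H; apply: le_trans (H _ _) _.
- by move=> w; rewrite mulr_ge0 ?invr_ge0 ?(ltW x0).
- by move=> w /= /ltW xf; rewrite mulrC ler_pdivlMr // mul1r.
- by rewrite mulrC ler_pdivrMr.
Qed.

(** Threshold for the squared operator norm of the observed noise. The base [K U^2 q] of the moment
    bound is enlarged by [E3 / s]; as [q >= ln d], the power [E3 ^+ q] is at least [d ^+ 3], which
    pays for the dimension factor and leaves a failure probability [s / d^2]. *)
Definition tau0 (s : R) : R := K * U ^+ 2 * q%:R * E3 / s.

Lemma trace_event (s : R) : 0 < s <= 1 ->
  EE P (\1_[set w | tau0 s ^+ q < trace_noise w]) <= s * (d ^+ 2)^-1.
Proof.
move=> /andP[s0 s1]; have E0 : 0 < E3 by apply: expR_gt0.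
have U2 : 0 < U ^+ 2 by rewrite exprn_gt0.
have qR : 0 < q%:R :> R by rewrite ltr0n.
have t0 : 0 < tau0 s by rewrite /tau0 divr_gt0 // !mulr_gt0.
apply: EE_markov.
- exact: bmeas_trace_noise.
- by move=> w; apply: trace_pow_ge0.
- by rewrite exprn_gt0.
have dq : d * p <= q%:R by case/andP: dp.
apply: (le_trans (EE_trace_obs_noise p01' U0 Bsamp Nass HK q0 dq)).
have x0 : 0 <= s / E3 by rewrite divr_ge0 ?(ltW s0) ?(ltW E0).
have -> : K * U ^+ 2 * q%:R = s / E3 * tau0 s.
  by rewrite /tau0; field; rewrite !gt_eqF.
rewrite exprMn mulrA ler_wpM2r ?exprn_ge0 ?(ltW t0) //.
apply: dim_geometric => //; first by rewrite (ltW s0).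
by rewrite divfK ?gt_eqF.
Qed.

Lemma trace_good (s : R) w r (X : 'M[R]_(m1, m2)) : 0 < s ->
  ~~ (tau0 s ^+ q < trace_noise w) -> (\rank X <= r)%N ->
  ip (W w) X ^+ 2 <= r%:R * tau0 s * ip X X.
Proof.
move=> s0; rewrite -leNgt => h rX; have [tau [t0 tE ob]] := opbound_trace (W w) e.
have t1 : 0 <= tau0 s.
  by rewrite /tau0 divr_ge0 ?(ltW s0) // !mulr_ge0 ?expR_ge0 ?(ltW U0) ?(ltW K0).
apply: (le_trans (ip_rank t0 ob rX)); rewrite ler_wpM2r ?ip_ge0 // ler_wpM2l //.
by rewrite -(@ler_pXn2r _ q) ?nnegrE // tE.
Qed.

Lemma tau0_le (s : R) : 0 < s -> tau0 s <= 2 * K * E3 * U ^+ 2 * (d * p) / s.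
Proof.
move=> s0; rewrite /tau0 ler_pM2r ?invr_gt0 //; case/andP: dp => _ h.
have c0 : 0 <= K * U ^+ 2 * E3 by rewrite !mulr_ge0 ?expR_ge0 ?(ltW U0) ?(ltW K0).
by have := ler_wpM2l c0 h; lra.
Qed.

(** The condition on [cut] makes the ratio in the power at most [s / E3]: 512 comes from the process
    bound, and 4 from the rank [k + k] and from [q <= 2 * (d * p)]. *)
Lemma mask_rate (a cut s : R) k : (0 < k)%N -> 0 < a -> 0 < s <= 1 ->
  512 * 4 * K * E3 * a ^+ 2 * (d * k%:R) <= s * cut ->
  d * (512 * a ^+ 2 * (k + k)%:R * K * q%:R / (p * cut)) ^+ q + 128 * a ^+ 2 / cut
  <= s * (d ^+ 2)^-1 + s * (d * k%:R)^-1.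
Proof.
move=> k0 a0 /andP[s0 s1] hcut; have E0 : 1 <= E3.
  by rewrite -[leLHS]expR0 ler_expR ler0n.
have kR : 0 < k%:R :> R by rewrite ltr0n.
have a2 : 0 < a ^+ 2 by rewrite exprn_gt0.
have E00 : 0 < E3 by apply: expR_gt0.
have n512 : 0 < 512 :> R by exact: ltr0n.
have N0 : 0 < d * k%:R by rewrite mulr_gt0.
have cut0 : 0 < cut.
  rewrite -(pmulr_rgt0 _ s0); apply: lt_le_trans hcut.
  by rewrite !mulr_gt0 // ltr0n.
move: n512 hcut; have e128 : 128 * 4 = 512 :> R by ring.
rewrite -{}e128; have : 0 < 128 :> R by exact: ltr0n.
move: (128 : R) => c c0 c40 hcut.
apply: lerD; first apply: dim_geometric.
- by rewrite (ltW s0).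
- apply: divr_ge0; last exact: ltW (mulr_gt0 p0 cut0).
  by rewrite !mulr_ge0 ?(ltW c0) ?(ltW a0) ?(ltW K0).
- rewrite mulrAC ler_pdivrMr; last exact: mulr_gt0.
  have [_ h] := andP dp; have kk : (k + k)%:R = 2 * k%:R :> R by rewrite natrD; ring.
  apply: (@le_trans _ _ (c * 4 * a ^+ 2 * (k + k)%:R * K * (2 * (d * p)) * E3)).
    rewrite ler_wpM2r ?(ltW E00) // ler_wpM2l // !mulr_ge0 ?(ltW c0) ?(ltW a0) ?(ltW K0) //.
  by have := ler_wpM2l (ltW p0) hcut; rewrite kk; lra.
rewrite ler_pdivrMr // mulrAC ler_pdivlMr //; apply: le_trans hcut.
have : c * a ^+ 2 * (d * k%:R) * 1 <= c * a ^+ 2 * (d * k%:R) * (16 * K * E3).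
  rewrite ler_wpM2l ?mulr_ge0 ?(ltW c0) ?(ltW a0) ?(ltW d0) //.
  have : 1 <= K * E3 by rewrite mulr_ege1.
  lra.
lra.
Qed.

(** Chebyshev's inequality with a threshold adapted to [D0]: by [4 x y <= (x + y)^2] its square is
    at least [N] times the second moment bound [p U^2 |D0|^2]. The first summand is later absorbed
    by the quadratic term. *)
Lemma noise_event (D0 : 'M[R]_(m1, m2)) (N : R) : 0 < N ->
  EE P (\1_[set w | (p * ip D0 D0 / 16 + 4 * U ^+ 2 * N) ^+ 2 < ip (W w) D0 ^+ 2]) <= N^-1.
Proof.
move=> N0; have v0 := ip_ge0 D0; have U2 : 0 < U ^+ 2 by rewrite exprn_gt0.
have x0 : 0 < p * ip D0 D0 / 16 + 4 * U ^+ 2 * N.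
  by rewrite ltr_wpDl ?divr_ge0 ?mulr_ge0 ?(ltW p0) // !mulr_gt0.
apply: EE_markov.
- apply: bmeasX; have -> : (fun w => ip (W w) D0) = (fun w => \sum_i \sum_j W w i j * D0 i j).
    by apply/funext => w; rewrite ipE.
  do 2 apply: bmeas_sum => ?; apply: bmeasM; [exact: bmeas_obs_noise|exact: bmeas_cst].
- by move=> w; rewrite sqr_ge0.
- by rewrite exprn_gt0.
apply: (le_trans (EE_ip_obs_noise p01' U0 Bsamp Nass D0)).
rewrite [leRHS]mulrC ler_pdivlMr //.
move: (ip D0 D0) (U ^+ 2) v0 U2 x0 => v u v0 u0 _.
have := sqr_ge0 (p * v / 16 - 4 * u * N); lra.
Qed.

(** Chebyshev's inequality; since [n <= m1 * m2 <= d ^+ 2 / 4], the standard deviation is at most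
    [d * U ^+ 2 / 2], which is within the order of the rate. *)
Lemma energy_event (x s : R) : (0 < m1 * m2)%N -> (n <= m1 * m2)%N -> 0 < s <= 1 -> 1 <= x ->
  EE P (\1_[set w | (U ^+ 2 * (d * x) / s) ^+ 2 < (energy U w - n%:R * sigma ^+ 2) ^+ 2])
  <= s / 4.
Proof.
move=> m0 nm /andP[s0 s1] x1; have U2 : 0 < U ^+ 2 by rewrite exprn_gt0.
have x0 : 0 < x by lra.
apply: EE_markov.
- apply: bmeasX; apply: bmeasB; last exact: bmeas_cst.
  apply: bmeas_sum => i; apply: bmeasM; first exact: (bmeas_mask D (fun b => maskv (b i))).
  exact: (bmeas_cnoise_comp D (f := fun x => x ^+ 2) (bclampX U0 2)).
- by move=> w; rewrite sqr_ge0.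
- by rewrite exprn_gt0 // divr_gt0 // !mulr_gt0.
apply: (le_trans (EE_energy_var p01' U0 Bsamp Nass m0)).
have nd : n%:R <= d ^+ 2 / 4.
  apply: (@le_trans _ _ (m1 * m2)%:R); first by rewrite ler_nat.
  by rewrite natrM natrD; have := sqr_ge0 (m1%:R - m2%:R : R); lra.
have -> : s / 4 * (U ^+ 2 * (d * x) / s) ^+ 2 = (d ^+ 2 / 4) * U ^+ 4 * (x ^+ 2 / s).
  by field; rewrite gt_eqF.
have h1 : 1 <= x ^+ 2 / s by rewrite ler_pdivlMr // mul1r; nra.
have U4 : 0 <= U ^+ 4 by rewrite exprn_ge0 // (ltW U0).
apply: (@le_trans _ _ (d ^+ 2 / 4 * U ^+ 4 * 1)).
  by rewrite mulr1 ler_wpM2r.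
by rewrite ler_wpM2l // mulr_ge0 // divr_ge0 // sqr_ge0.
Qed.

Lemma bmeas_energy : bmeas (energy (D := D) U).
Proof.
apply: bmeas_sum => i; apply: bmeasM; first exact: (bmeas_mask D (fun b => maskv (b i))).
exact: (bmeas_cnoise_comp D (f := fun x => x ^+ 2) (bclampX U0 2)).
Qed.

(* n times the empirical risk excess of M - X, when the noise is bounded. *)
Definition excess w (X : 'M[R]_(m1, m2)) : R :=
  \sum_i maskv (B w i) * X i.1 i.2 ^+ 2 + 2 * ip (W w) X +
  (energy U w - n%:R * sigma ^+ 2).

Lemma noise_null : exists N : set Om, [/\ measurable N, EE P (\1_N) = 0 &
  forall w, ~ N w -> forall i : I, cnoise U i w = noise D i.1 i.2 w].
Proof.
have [N [mN PN sub]] := cnoise_ae Nass; exists N; split => //.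
  by apply: EFin_inj; rewrite EE_indic.
by move=> w wN; apply: contrapT => h; apply/wN/sub.
Qed.

Local Notation m := (minn m1 m2).

(** The failure probabilities for honesty: once for the noise trace, then for each rank the two
    terms of the mask bound and the one of [noise_event]. With [2 m <= d] the sums of [1 / (d k)]
    dominate. *)
Lemma sum_failure : (d ^+ 2)^-1 + \sum_(k < m) ((d ^+ 2)^-1 + (d * k.+1%:R)^-1 + (d * k.+1%:R)^-1)
  <= 5 / Num.sqrt d.
Proof.
rewrite big_split big_split /= sumr_const card_ord -[_ *+ m]mulr_natl.
rewrite (eq_bigr (fun k : 'I_m => d^-1 * (k.+1%:R)^-1)); last by move=> k _; rewrite invfM.
rewrite -mulr_sumr; have := sum_inv_le_sqrt (R := R) m.
move: (\sum_(_ < _) _) => y hy.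
have md := leq_add (geq_minl m1 m2) (geq_minr m1 m2).
have {md} : m%:R + m%:R <= d by rewrite -natrD ler_nat.
have [r r0 rE] : exists2 r, 0 < r & d = r ^+ 2.
  by exists (Num.sqrt d); rewrite ?sqrtr_gt0 // sqr_sqrtr // (ltW d0).
move: hy; rewrite rE sqrtr_sqr (ger0_norm (ltW r0)).
have sE : m%:R = Num.sqrt m%:R ^+ 2 :> R by rewrite sqr_sqrtr.
have := sqrtr_ge0 (m%:R : R); move: sE d16; rewrite {}rE.
move: (Num.sqrt m%:R) => x; move: (m%:R : R) => mm -> r16 x0 hy hx.
have r4 : 4 <= r by nra.
have xr : x <= r by nra.
have r2 : 0 < r ^+ 2 by rewrite exprn_gt0.
have r40 : 0 < (r ^+ 2) ^+ 2 by rewrite exprn_gt0.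
have -> : 5 / r = ((r ^+ 2) ^+ 2)^-1 * (5 * r ^+ 3) by field; rewrite gt_eqF.
have -> : (r ^+ 2)^-1 * y = ((r ^+ 2) ^+ 2)^-1 * (r ^+ 2 * y) by field; rewrite gt_eqF.
have -> : ((r ^+ 2) ^+ 2)^-1 + (x ^+ 2 * ((r ^+ 2) ^+ 2)^-1 + ((r ^+ 2) ^+ 2)^-1 * (r ^+ 2 * y) +
  ((r ^+ 2) ^+ 2)^-1 * (r ^+ 2 * y)) = ((r ^+ 2) ^+ 2)^-1 * (1 + x ^+ 2 + 2 * (r ^+ 2 * y)) by
    ring.
rewrite ler_wpM2l ?invr_ge0 ?(ltW r40) //.
have : r ^+ 2 * y <= r ^+ 2 * (2 * r) by rewrite ler_wpM2l ?(ltW r2) //; lra.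
have : r ^+ 2 * 1 <= r ^+ 2 * r by rewrite ler_wpM2l ?(ltW r2) //; lra.
have := exprS r 2; lra.
Qed.

(** [A] and [k] depend on the outcome. In [M - A = (M - A0 k) + (A0 k - A)] the first part is
    deterministic for each [k], and the second has rank at most [2k], where operator norm bounds are
    uniform. Outside the null set, failure requires a low energy, a large noise trace or, for some
    [k], a bad mask or a large [<W, M - A0 k>]; the indicators of these events are summed. *)
Lemma honest_tail (a z t : R) (M : 'M[R]_(m1, m2)) (S : set Om) :
  (0 < m1 * m2)%N -> (0 < n)%N -> 0 < a -> 0 < t ->
  4 * (512 * 4 * K * E3) + 1 <= z -> low_rank m a M -> measurable S ->
  (forall w, (forall i : I, cnoise U i w = noise D i.1 i.2 w) -> S w ->
    exists k A, [/\ (1 <= k <= m)%N, low_rank k a A &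
      excess w (M - A) < p / 256 * ip (M - A) (M - A)
        - z * (a ^+ 2 + 4 * U ^+ 2) * (d * k%:R) - t]) ->
  EE P (\1_S) <= expR (- (t ^+ 2 / (3 * n%:R * U ^+ 4))) + 5 / Num.sqrt d.
Proof.
move=> m0 n0 a0 t0 hz Mm mS HS.
have a2 : 0 < a ^+ 2 by rewrite exprn_gt0.
pose A0 k := projT1 (cid2 (low_rank_near_minimizer k M (ltW a0) a2)).
have A0k k : low_rank k a (A0 k) by rewrite /A0; case: cid2.
have A0m k A : low_rank k a A ->
    ip (M - A0 k) (M - A0 k) <= ip (M - A) (M - A) + a ^+ 2.
  by rewrite /A0; case: cid2 => /= B0 _; apply.
clearbody A0.
have k0 : 1 <= K * E3.
  by rewrite mulr_ege1 // -[leLHS]expR0 ler_expR ler0n.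
pose cut k : R := 512 * 4 * K * E3 * a ^+ 2 * (d * k%:R).
pose C k := [set M - A | A in low_rank k a].
pose F k (b : {ffun I -> bool}) : R := `[< exists2 X, C k X &
  \sum_i maskv (b i) * X i.1 i.2 ^+ 2 < p / 2 * ip X X - 4 * cut k >]%:R.
pose Bk k := [set w | (p * ip (M - A0 k) (M - A0 k) / 16 + 4 * U ^+ 2 * (d * k%:R)) ^+ 2
                 < ip (W w) (M - A0 k) ^+ 2].
have [N [mN EN NP]] := noise_null.
pose En := [set w : Om | energy U w <= n%:R * sigma ^+ 2 - t].
pose Tr := [set w | tau0 1 ^+ q < trace_noise w].
have mEn : measurable En.
  have -> : En = ~` [set w | n%:R * sigma ^+ 2 - t < energy U w].
    by apply/seteqP; split => w /=; rewrite /En /= leNgt => /negP.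
  by apply: measurableC; apply: measurable_gt; exact: bmeas_energy.
have mTr : measurable Tr by apply: measurable_gt; exact: bmeas_trace_noise.
have mBk k : measurable (Bk k).
  apply: measurable_gt; apply: bmeasX.
  have -> : (fun w => ip (W w) (M - A0 k)) = (fun w => \sum_i \sum_j W w i j * (M - A0 k) i j).
    by apply/funext => w; rewrite ipE.
  by do 2 apply: bmeas_sum => ?; apply: bmeasM; [exact: bmeas_obs_noise|exact: bmeas_cst].
have bF k : bmeas (fun w => F k (B w)) by exact: bmeas_mask.
have bI (A : set Om) : measurable A -> bmeas (\1_A : Om -> R) by exact: bmeas_indic.
have i0 (A : set Om) w : 0 <= \1_A w :> R by rewrite indicE.
have F0 k b : 0 <= F k b by rewrite /F; case: asboolP.
pose G w := \1_N w + (\1_En w + (\1_Tr w + \sum_(k < m) (F k.+1 (B w) + \1_(Bk k.+1) w))).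
have bsum : bmeas (fun w => \sum_(k < m) (F k.+1 (B w) + \1_(Bk k.+1) w)).
  by apply: bmeas_sum => k; apply: bmeasD => //; apply: bI.
have bTs : bmeas (fun w => \1_Tr w + \sum_(k < m) (F k.+1 (B w) + \1_(Bk k.+1) w)).
  by apply: bmeasD => //; apply: bI.
have bEs : bmeas (fun w => \1_En w + (\1_Tr w + \sum_(k < m) (F k.+1 (B w) + \1_(Bk k.+1) w))).
  by apply: bmeasD => //; apply: bI.
have SG w : \1_S w <= G w.
  have s0 : 0 <= \sum_(k < m) (F k.+1 (B w) + \1_(Bk k.+1) w).
    by apply: sumr_ge0 => k _; rewrite addr_ge0.
  rewrite /G [\1_S w]indicE; case: (boolP (w \in S)) => wS; last by rewrite !addr_ge0.
  rewrite [\1_N w]indicE; case: (boolP (w \in N)) => wN; first by rewrite lerDl !addr_ge0.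
  rewrite [\1_En w]indicE; case: (boolP (w \in En)) => wE.
    by rewrite add0r lerDl addr_ge0.
  rewrite [\1_Tr w]indicE; case: (boolP (w \in Tr)) => wT; first by rewrite !add0r lerDl.
  rewrite !add0r.
  have [|k [A [/andP[k1 km] Ak lt]]] := HS w _ (set_mem wS).
    by apply: NP => h; move: wN; rewrite mem_set.
  have kE : k = (k.-1).+1 by rewrite prednK.
  have km' : (k.-1 < m)%N by rewrite -kE.
  rewrite (bigD1 (Ordinal km')) //= -kE.
  suff h : 1 <= F k (B w) + \1_(Bk k) w.
    by rewrite (le_trans h) // lerDl sumr_ge0 // => j _; rewrite addr_ge0.
  rewrite /F; case: asboolP => [_|nF]; first by rewrite lerDl.
  rewrite add0r indicE; case: (boolP (w \in Bk k)) => // wB; exfalso.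
  have kR : 1 <= k%:R :> R by rewrite ler1n.
  set X := M - A in lt; set D0 := M - A0 k.
  have v0 := A0m k A Ak; rewrite -/X -/D0 in v0.
  have S1 : p / 2 * ip X X - 4 * cut k <= \sum_i maskv (B w i) * X i.1 i.2 ^+ 2.
    by rewrite leNgt; apply/negP => h; apply: nF; exists X => //; exists A.
  have w1 : `|ip (W w) D0| <= p * ip D0 D0 / 16 + 4 * U ^+ 2 * (d * k%:R).
    have hle : ip (W w) D0 ^+ 2 <= (p * ip D0 D0 / 16 + 4 * U ^+ 2 * (d * k%:R)) ^+ 2.
      by rewrite leNgt; apply/negP => h; move: wB; rewrite mem_set.
    rewrite -(@ler_pXn2r _ 2) ?nnegrE ?real_normK ?num_real //.
    by rewrite addr_ge0 ?divr_ge0 ?mulr_ge0 ?ip_ge0 ?(ltW U0).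
  have wT' : ~~ (tau0 1 ^+ q < trace_noise w).
    by apply: contra wT => h; rewrite mem_set.
  set Y := A0 k - A; have y0 := ip_ge0 Y.
  have rY : (\rank Y <= k + k)%N by exact: rank_sub_low_rank (A0k k) Ak.
  have hY : ip Y Y <= 2 * ip D0 D0 + 2 * ip X X.
    have -> : Y = X - D0 by rewrite /Y /X /D0; apply/matrixP => i j; rewrite !mxE; ring.
    by have := ip_sub_le X D0; lra.
  have w2 := trace_good ltr01 wT' rY.
  have t1 := tau0_le (s := 1) ltr01; rewrite divr1 in t1.
  have {}w2 : ip (W w) Y ^+ 2 <= (256 * (K * E3) * (U ^+ 2 * (d * k%:R))) * (p * ip Y Y / 64).
    apply: (le_trans w2).
    have c0 : 0 <= (k + k)%:R * ip Y Y by rewrite mulr_ge0.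
    by have := ler_wpM2l c0 t1; rewrite natrD; lra.
  have u0 : 0 <= U ^+ 2 * (d * k%:R) by rewrite !mulr_ge0 ?(ltW U0) ?(ltW d0).
  have py : 0 <= p * ip Y Y by exact: mulr_ge0 (ltW p0) y0.
  have {}w2 := sqrt_le_norm_bound (mulr_ge0 (mulr_ge0 (ler0n R 256) (le_trans ler01 k0)) u0)
    (divr_ge0 py (ler0n R 64)) w2.
  have XE : X = D0 + Y by rewrite /Y /X /D0; apply/matrixP => i j; rewrite !mxE; ring.
  have wX : ip (W w) X = ip (W w) D0 + ip (W w) Y by rewrite {1}XE ipDr.
  have en : n%:R * sigma ^+ 2 - t < energy U w.
    by rewrite ltNge; apply/negP => h; move: wE; rewrite mem_set.
  move: lt; rewrite /excess wX; apply/negP; rewrite -leNgt.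
  have N1 : 1 <= d * k%:R.
    by apply: (le_trans kR); rewrite ler_peMl // (le_trans _ (ltW d16)) // ler1n.
  have p1 : p <= 1 by case/andP: p01.
  have pv := ler_wpM2l (ltW p0) v0; have pY := ler_wpM2l (ltW p0) hY.
  have pa : p * a ^+ 2 <= a ^+ 2 * (d * k%:R).
    by rewrite mulrC; apply: (ler_pM (ltW a2) (ltW p0) (lexx _) (le_trans p1 N1)).
  have b0 : 0 <= a ^+ 2 * (d * k%:R) by rewrite mulr_ge0 ?(ltW a2) // (le_trans ler01 N1).
  have zb := ler_wpM2r b0 hz; have zu := ler_wpM2r u0 hz.
  have px0 : 0 <= p * ip X X by exact: mulr_ge0 (ltW p0) (ip_ge0 X).
  have ku : 1 * (U ^+ 2 * (d * k%:R)) <= K * E3 * (U ^+ 2 * (d * k%:R)) by rewrite ler_wpM2r.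
  (* Of [p |X|^2] there remains [1/2 - 1/8 - 1/16 = 5/16], more than 1/256. The remainders are of
     order [d k]: [4 * cut k] dictates the main term of the lower bound on [z], and the slack
     [a ^+ 2] is covered by its summand 1. *)
  move: w1 w2; rewrite !ler_norml => /andP[w1 _] /andP[w2 _].
  move: S1 w1 w2 en pv pY pa zb zu px0 ku b0 u0; rewrite /cut.
  lra.
have bS : bmeas (\1_S : Om -> R) by apply: bI.
apply: (le_trans (le_EE P bS (bmeasD (bI _ mN) bEs) SG)).
rewrite EED //; last by apply: bI.
rewrite EED //; last by apply: bI.
rewrite EED //; last by apply: bI.
rewrite EE_sum; last by move=> k; apply: bmeasD => //; apply: bI.
rewrite EN add0r; apply: lerD.
  exact: energy_lower_tail p01' U0 Bsamp Nass _ m0 n0 t0.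
apply: le_trans sum_failure; apply: lerD.
  by have := @trace_event 1; rewrite ltr01 lexx mul1r; apply.
apply: ler_sum => k _; rewrite EED //; last by apply: bI.
apply: lerD; last first.
  by apply: noise_event; rewrite mulr_gt0 // ltr0n.
rewrite (EE_mask p01' Bsamp (F k.+1)).
have cE : 512 * 4 * K * E3 * a ^+ 2 * (d * k.+1%:R) <= 1 * cut k.+1 by rewrite mul1r.
have cut0 : 0 < cut k.+1.
  have n512 : 0 < 512 :> R by exact: ltr0n.
  have kd : 0 < d * k.+1%:R by rewrite mulr_gt0 // ltr0n.
  exact: mulr_gt0 (mulr_gt0 (mulr_gt0 (mulr_gt0 (mulr_gt0 n512 (ltr0Sn R 3)) K0)
    (expR_gt0 3)) a2) kd.
have := @mask_rate a (cut k.+1) 1 k.+1 (ltn0Sn _) a0 _ cE.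
rewrite ltr01 lexx !mul1r => /(_ isT); apply: le_trans.
have [dq _] := andP dp.
apply: (mask_lower_tail (D := M - A0 k.+1) (eta := a) HK p01 dq a0 cut0).
  have p1 : p <= 1 by case/andP: p01.
  apply: (@le_trans _ _ (1 * a ^+ 2)); first by rewrite ler_wpM2r // (ltW a2).
  rewrite mul1r /cut -mulrA [_ * (d * _)]mulrC mulrA ler_peMl ?(ltW a2) //.
  rewrite -[leLHS]mulr1; apply: ler_pM => //.
    rewrite -mulrA -[leLHS]mulr1; apply: ler_pM => //.
    by rewrite -natrM ler1n.
  rewrite -[leLHS]mulr1; apply: ler_pM => //; last by rewrite ler1n.
  by rewrite (le_trans _ (ltW d16)) // ler1n.
move=> _ [A Ak <-]; split.
- rewrite (_ : M - A - (M - A0 k.+1) = A0 k.+1 - A); last by apply/matrixP => i j;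
  rewrite !mxE; ring.
  exact: rank_sub_low_rank (A0k _) Ak.
- move=> i j; rewrite !mxE (le_trans (ler_normB _ _)) // mulr_natl mulr2n.
  by apply: lerD; [exact: low_rank_entry Mm|exact: low_rank_entry Ak].
have := A0m _ _ Ak; have := ip_ge0 (M - A); lra.
Qed.

(** Both [M] and [A] have rank at most [k], so their difference has rank at most [2k] and a norm
    controlled by [rho2]. Any failure probability [s] is reached by dividing the thresholds by
    [s]. *)
Lemma adaptive_tail (a s cut rho2 : R) k (M : 'M[R]_(m1, m2)) (S : set Om) :
  (0 < m1 * m2)%N -> (n <= m1 * m2)%N -> (0 < k)%N -> 0 < a -> 0 < s <= 1 ->
  512 * 4 * K * E3 * a ^+ 2 * (d * k%:R) <= s * cut -> p * rho2 <= cut ->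
  low_rank k a M -> measurable S ->
  (forall w, (forall i : I, cnoise U i w = noise D i.1 i.2 w) -> S w ->
    exists A, [/\ low_rank k a A, ip (M - A) (M - A) <= rho2 &
      6 * cut + (4 * K * E3 + 1) * (U ^+ 2 * (d * k%:R) / s) < excess w (M - A)]) ->
  EE P (\1_S) <= s.
Proof.
move=> m0 nm k0 a0 s01 hcut hrho Mk mS HS; have [s0 s1] := andP s01.
have kR : 1 <= k%:R :> R by rewrite ler1n.
have E0 : 0 < E3 by apply: expR_gt0.
have N0 : 0 < d * k%:R by rewrite mulr_gt0 // (lt_le_trans ltr01 kR).
have cut0 : 0 < cut.
  rewrite -(pmulr_rgt0 _ s0); apply: lt_le_trans hcut.
  have n512 : 0 < 512 :> R by exact: ltr0n.
  exact: mulr_gt0 (mulr_gt0 (mulr_gt0 (mulr_gt0 (mulr_gt0 n512 (ltr0Sn R 3)) K0)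
    E0) (exprn_gt0 2 a0)) N0.
pose C := [set M - A | A in [set A | low_rank k a A /\ ip (M - A) (M - A) <= rho2]].
pose F (b : {ffun I -> bool}) : R := `[< exists2 X, C X &
  5 * cut < \sum_i maskv (b i) * X i.1 i.2 ^+ 2 >]%:R.
have [N [mN EN NP]] := noise_null.
pose En := [set w : Om | (U ^+ 2 * (d * k%:R) / s) ^+ 2 < (energy U w - n%:R * sigma ^+ 2) ^+ 2].
pose Tr := [set w | tau0 s ^+ q < trace_noise w].
have mEn : measurable En.
  by apply: measurable_gt; apply: bmeasX; apply: bmeasB; [exact: bmeas_energy|exact: bmeas_cst].
have mTr : measurable Tr by apply: measurable_gt; exact: bmeas_trace_noise.
have bF : bmeas (fun w => F (B w)) by exact: bmeas_mask.
have bI (A : set Om) : measurable A -> bmeas (\1_A : Om -> R) by exact: bmeas_indic.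
have i0 (A : set Om) w : 0 <= \1_A w :> R by rewrite indicE.
have F0 b : 0 <= F b by rewrite /F; case: asboolP.
have bTF : bmeas (fun w => \1_Tr w + F (B w)) by apply: bmeasD => //; apply: bI.
have bETF : bmeas (fun w => \1_En w + (\1_Tr w + F (B w))) by apply: bmeasD => //; apply: bI.
have SG w : \1_S w <= \1_N w + (\1_En w + (\1_Tr w + F (B w))).
  rewrite [\1_S w]indicE; case: (boolP (w \in S)) => wS; last by rewrite !addr_ge0.
  rewrite [\1_N w]indicE; case: (boolP (w \in N)) => wN; first by rewrite lerDl !addr_ge0.
  rewrite [\1_En w]indicE; case: (boolP (w \in En)) => wE.
    by rewrite add0r lerDl addr_ge0.
  rewrite [\1_Tr w]indicE; case: (boolP (w \in Tr)) => wT; first by rewrite !add0r lerDl.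
  rewrite !add0r /F; case: asboolP => // nF; exfalso.
  have [|A [Ak hA lt]] := HS w _ (set_mem wS).
    by apply: NP => h; move: wN; rewrite mem_set.
  set X := M - A in hA lt.
  have S1 : \sum_i maskv (B w i) * X i.1 i.2 ^+ 2 <= 5 * cut.
    by rewrite leNgt; apply/negP => h; apply: nF; exists X => //; exists A.
  have wT' : ~~ (tau0 s ^+ q < trace_noise w).
    by apply: contra wT => h; rewrite mem_set.
  have rX : (\rank X <= k + k)%N by exact: rank_sub_low_rank Mk Ak.
  have w2 := trace_good s0 wT' rX; have t1 := tau0_le s0.
  have u0 : 0 <= U ^+ 2 * (d * k%:R) / s by rewrite divr_ge0 ?(ltW s0) // !mulr_ge0 ?(ltW U0)
    ?(ltW d0).
  have KE : 0 < K * E3 by rewrite mulr_gt0.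
  have {}w2 : ip (W w) X ^+ 2 <= (4 * (K * E3) * (U ^+ 2 * (d * k%:R) / s)) * cut.
    apply: (le_trans w2).
    have c0 : 0 <= (k + k)%:R * ip X X by rewrite mulr_ge0 ?ip_ge0.
    have h1 := ler_wpM2l c0 t1.
    have h2 : p * ip X X <= cut.
      by apply: le_trans hrho; rewrite ler_wpM2l ?(ltW p0).
    have h3 := ler_wpM2l (mulr_ge0 (mulr_ge0 (ler0n R 4) (ltW KE)) u0) h2.
    by move: h1 h3; rewrite natrD; lra.
  have {}w2 := sqrt_le_norm_bound (mulr_ge0 (mulr_ge0 (ler0n R 4) (ltW KE)) u0) (ltW cut0) w2.
  have en : energy U w - n%:R * sigma ^+ 2 <= U ^+ 2 * (d * k%:R) / s.
    apply: (le_trans (ler_norm _)); rewrite -(@ler_pXn2r _ 2) ?nnegrE // real_normK ?num_real //.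
    by rewrite leNgt; apply/negP => h; move: wE; rewrite mem_set.
  move: lt; rewrite /excess; apply/negP; rewrite -leNgt.
  move: w2; rewrite ler_norml => /andP[_ w2].
  move: S1 w2 en; lra.
have bS : bmeas (\1_S : Om -> R) by apply: bI.
apply: (le_trans (le_EE P bS (bmeasD (bI _ mN) bETF) SG)).
rewrite EED //; last by apply: bI.
rewrite EED //; last by apply: bI.
rewrite EED //; last by apply: bI.
rewrite EN add0r (EE_mask p01' Bsamp F).
have h1 := energy_event m0 nm s01 kR; have h2 := trace_event s01.
have h3 : Ex (bern p) F <= s * (d ^+ 2)^-1 + s * (d * k%:R)^-1.
  have [dq _] := andP dp.
  apply: le_trans (mask_rate k0 a0 s01 hcut).
  apply: (mask_upper_tail (rho2 := rho2) HK p01 dq a0 cut0 hrho).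
  move=> _ [A [Ak hA] <-]; split => //.
    exact: rank_sub_low_rank Mk Ak.
  move=> i j; rewrite !mxE (le_trans (ler_normB _ _)) // mulr_natl mulr2n.
  by apply: lerD; [exact: low_rank_entry Mk|exact: low_rank_entry Ak].
(* The energy costs [s / 4], the noise trace and the two mask terms at most [s / 16] each because
   [d > 16]. *)
have inv16 x : 16 <= x -> x^-1 <= 16^-1 :> R.
  move=> x16; have x0 : 0 < x by apply: lt_le_trans x16; exact: ltr0n.
  by rewrite lef_pV2 ?posrE // ltr0n.
have d2 : (d ^+ 2)^-1 <= 16^-1.
  by apply: inv16; rewrite expr2 (le_trans (ltW d16)) // ler_peMl ?(ltW d0) // (le_trans _ (ltW
    d16)) // ler1n.
have d3 : (d * k%:R)^-1 <= 16^-1.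
  by apply: inv16; rewrite (le_trans (ltW d16)) // ler_peMr ?(ltW d0).
have := ler_wpM2l (ltW s0) d2; have := ler_wpM2l (ltW s0) d3.
move: h1 h2 h3; rewrite -/En -/Tr; lra.
Qed.

End Events.

(** * The confidence set *)

Section Procedure.
Context {R : realType} {m1 m2 : nat}.
Variables (n : nat) (C0 alpha a sigma U Cstar z : R).
Variables (Mhat : data R m1 m2 -> 'M[R]_(m1, m2))
  (Mproj : nat -> data R m1 m2 -> 'M[R]_(m1, m2)).
Local Notation m := (minn m1 m2).
Local Notation p := (n%:R / (m1 * m2)%:R : R).
Local Notation d := ((m1 + m2)%:R : R).
Local Notation mfun f := (measurable_fun setT (f : data R m1 m2 -> measurableTypeR R)).
Hypotheses (m10 : (0 < m1)%N) (m20 : (0 < m2)%N).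
Hypotheses (eMhat : estimator Mhat) (bestP : best_approximations a Mhat Mproj).

Local Notation ks := (kstar n C0 a sigma Mhat Mproj).
Local Notation Mt := (Mtilde n C0 a sigma Mhat Mproj).
Local Notation inSx := (inS n C0 a sigma Mhat Mproj).

Lemma kstar_itv x : (1 <= ks x <= m)%N.
Proof.
have m0 : (0 < m)%N by rewrite leq_min m10.
rewrite /kstar big_seq_cond; apply: (big_ind (fun v => 1 <= v <= m)%N).
- by rewrite m0 leqnn.
- by move=> u v /andP[u1 um] /andP[v1 vm]; rewrite leq_min u1 v1 geq_min um.
- by move=> k /andP[]; rewrite mem_index_iota ltnS.
Qed.

Lemma kstar_le x k : (1 <= k <= m)%N -> inSx x k -> (ks x <= k)%N.
Proof.
move=> km kS; have : k \in index_iota 1 m.+1 by rewrite mem_index_iota ltnS.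
rewrite /kstar; elim: (index_iota _ _) => // j r IH.
rewrite inE big_cons => /orP[/eqP <-|/IH h]; first by rewrite kS geq_minl.
by case: ifP => _ //; rewrite geq_min h orbT.
Qed.

(** The minimum is either in the set or the default [m]; in the latter case [m = kstar <= k <= m]
    forces [k = m], so that [m] is in the set as well. *)
Lemma inS_kstar x k : (1 <= k <= m)%N -> inSx x k -> inSx x (ks x).
Proof.
move=> km kS.
have [|km'] : inSx x (ks x) \/ ks x = m.
- rewrite /kstar; apply: (big_ind (fun v => inSx x v \/ v = m)); [by right| |by left].
  by move=> u v hu hv; rewrite /minn; case: ifP.
- by [].
have := kstar_le km kS; rewrite km' => mk.
by rewrite (_ : m = k) //; apply/eqP; rewrite eqn_leq mk; case/andP: km.
Qed.

Lemma Mtilde_low_rank x : low_rank (ks x) a (Mt x).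
Proof. by have [_ h] := bestP (kstar_itv x); have [] := h x. Qed.

Lemma measurable_entry (F : data R m1 m2 -> 'M[R]_(m1, m2)) i j :
  estimator F -> mfun (fun x => F x i j).
Proof. by move=> eF; exact: (measurableT_comp (measurable_real_mx_entry i j) eF). Qed.

Lemma measurable_ip_sub (F G : data R m1 m2 -> 'M[R]_(m1, m2)) :
  (forall i j, mfun (fun x => F x i j)) -> (forall i j, mfun (fun x => G x i j)) ->
  mfun (fun x => frob (F x - G x) ^+ 2).
Proof.
move=> mF mG; rewrite (_ : (fun x => _) =
  fun x => \sum_i \sum_j (F x i j - G x i j) * (F x i j - G x i j)).
  apply: measurable_sum => i; apply: measurable_sum => j.
  have h := measurable_funB (mF i j) (mG i j).
  exact: (measurable_funM h h).
apply/funext => x; rewrite frob_sqr ipE.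
by apply: eq_bigr => i _; apply: eq_bigr => j _; rewrite !mxE.
Qed.

Lemma measurable_leb (f : data R m1 m2 -> R) c : mfun f ->
  measurable_fun setT (fun x => f x <= c : bool).
Proof. by move=> mf; apply: (measurable_fun_ler mf); exact: measurable_cst. Qed.

Lemma measurable_kstar : measurable_fun setT (ks : _ -> nat).
Proof.
rewrite /kstar; have : forall k, k \in index_iota 1 m.+1 -> (1 <= k <= m)%N.
  by move=> k; rewrite mem_index_iota ltnS.
elim: (index_iota _ _) => [|k r IH] hr.
  rewrite (_ : (fun x => _) = fun=> m); first exact: measurable_cst.
  by apply/funext => x; rewrite big_nil.
rewrite (_ : (fun x => _) = fun x => if inSx x k then
    minn k (\big[minn/m]_(j <- r | inSx x j) j) else \big[minn/m]_(j <- r | inSx x j) j);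
      last first.
  by apply/funext => x; rewrite big_cons.
have mr : measurable_fun setT (fun x => \big[minn/m]_(j <- r | inSx x j) j).
  by apply: IH => j jr; apply: hr; rewrite inE jr orbT.
apply: measurable_fun_ifT => //; last exact: (measurableT_comp (f := minn k)).
have [eMk _] := bestP (hr k (mem_head _ _)).
apply: measurable_leb; apply: measurable_funM; last exact: measurable_cst.
by apply: measurable_ip_sub => i j; apply: measurable_entry.
Qed.

Lemma measurable_kstar_fun (f : nat -> R) : mfun (fun x => f (ks x)).
Proof. exact: (measurableT_comp (f := f : nat -> measurableTypeR R) _ measurable_kstar). Qed.

(** A finite sum over the possible values of [kstar] replaces evaluation at a random index. *)
Lemma measurable_Mtilde i j : mfun (fun x => Mt x i j).
Proof.
rewrite (_ : (fun x => _) = fun x => \sum_(k < m) (ks x == k.+1)%:R * Mproj k.+1 x i j).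
  apply: measurable_sum => k; apply: measurable_funM.
    exact: (measurable_kstar_fun (fun l => (l == k.+1)%:R)).
  by apply: measurable_entry; have [] := bestP (k := k.+1) _; rewrite ?ltn_ord.
apply/funext => x; have /andP[k1 km] := kstar_itv x.
have kE : ks x = (ks x).-1.+1 by rewrite prednK.
have km' : ((ks x).-1 < m)%N by rewrite -kE.
rewrite (bigD1 (Ordinal km')) //= -kE eqxx mul1r big1 ?addr0 // => l.
by rewrite -val_eqE /= kE eqSS eq_sym => /negPf ->; rewrite mul0r.
Qed.

(** The quadratic part of [zbar] equals half of the left-hand side of the inequality defining the
    set, since 128 / 256 = 1/2. Moving it across doubles 128 to 256 and turns the set into a ball
    about [Mtilde] with this squared radius. *)
Definition sq_radius x : R :=
  256 * (m1 * m2)%:R * (rhat n C0 a sigma Mhat Mproj x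
    + (a ^+ 2 * z * ((m1 + m2) * ks x)%:R
       + z * (U * Cstar) ^+ 2 * ((m1 + m2) * ks x)%:R) / n%:R
    + xi n alpha U / Num.sqrt n%:R).

Lemma conf_setE x : (0 < n)%N ->
  conf_set n C0 alpha a sigma U Cstar z Mhat Mproj x =
  [set M | frob (M - Mt x) ^+ 2 <= sq_radius x].
Proof.
move=> n0; apply/seteqP; have nR : 0 < n%:R :> R by rewrite ltr0n.
have mR : 0 < (m1 * m2)%:R :> R by rewrite ltr0n muln_gt0 m10.
have key M : (frob (M - Mt x) ^+ 2 / (m1 * m2)%:R <= 128 * (rhat n C0 a sigma Mhat Mproj x
           + (a ^+ 2 * z * ((m1 + m2) * ks x)%:R + zbar n C0 a sigma U Cstar z Mhat Mproj x M)
             / n%:R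
           + xi n alpha U / Num.sqrt n%:R)) = (frob (M - Mt x) ^+ 2 <= sq_radius x).
  rewrite /zbar /sq_radius; set f := frob _ ^+ 2; set y := xi _ _ _ / _; clearbody f y.
  move: (rhat _ _ _ _ _ _ _) => r; move: ((_ * ks x)%:R : R) => N.
  rewrite ler_pdivrMr //.
  have -> : (a ^+ 2 * z * N + (n%:R / (m1 * m2)%:R / 256 * f + z * (U * Cstar) ^+ 2 * N)) / n%:R
     = (a ^+ 2 * z * N + z * (U * Cstar) ^+ 2 * N) / n%:R + f / (m1 * m2)%:R / 256.
    move: nR mR; move: (n%:R : R) ((m1 * m2)%:R : R) => n' m' hn hm.
    by field; rewrite !gt_eqF.
  move: ((a ^+ 2 * z * N + z * (U * Cstar) ^+ 2 * N) / n%:R) => w.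
  have fE : f / (m1 * m2)%:R * (m1 * m2)%:R = f by rewrite divfK // gt_eqF.
  move: (f / (m1 * m2)%:R) ((m1 * m2)%:R : R) fE => g h fE.
  by apply/idP/idP; move: fE; lra.
by split => M /=; rewrite /conf_set /= key.
Qed.

Lemma measurable_rhat : mfun (rhat n C0 a sigma Mhat Mproj).
Proof.
apply: measurable_funB; last exact: measurable_cst.
apply: measurable_funM; first exact: measurable_cst.
apply: measurable_sum => i; apply: measurable_sum => j; apply: measurable_funX.
apply: measurable_funB.
  exact: (measurableT_comp (measurable_real_mx_entry i j) measurable_fst).
apply: measurable_funM; last exact: measurable_Mtilde.
have h := measurableT_comp (measurable_bool_mx_entry i j) (measurable_snd (T1 := real_mx R m1
  m2)).
by apply: (measurableT_comp (f := fun b : bool => b%:R : measurableTypeR R) _ h).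
Qed.

Lemma measurable_sq_radius : mfun sq_radius.
Proof.
apply: measurable_funM; first exact: measurable_cst.
apply: measurable_funD; last exact: measurable_cst.
apply: measurable_funD; first exact: measurable_rhat.
exact: (measurable_kstar_fun (fun k => (a ^+ 2 * z * ((m1 + m2) * k)%:R
       + z * (U * Cstar) ^+ 2 * ((m1 + m2) * k)%:R) / n%:R)).
Qed.

End Procedure.

Lemma expR1_le4 {R : realType} : expR 1 <= 4 :> R.
Proof.
have h : 1 / 2 <= expR (- (1 / 2)) :> R.
  by have := expR_ge1Dx (- (1 / 2) : R); lra.
have e0 := expR_gt0 (1 / 2 : R).
have e2 : expR (1 / 2) <= 2 :> R.
  by move: h; rewrite expRN mul1r lef_pV2 ?posrE.
have -> : 1 = 1 / 2 + 1 / 2 :> R by field.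
rewrite expRD; nra.
Qed.

(** [d * p = n (1 / m1 + 1 / m2) >= n / m >= ln d], and [ln d >= 1] because [d >= 4 >= expR 1]. *)
Lemma sampling_rate {R : realType} (m1 m2 n : nat) :
  let p := n%:R / (m1 * m2)%:R : R in let d := (m1 + m2)%:R : R in
  (0 < m1)%N -> (0 < m2)%N -> (16 < m1 + m2)%N ->
  (minn m1 m2)%:R * ln d <= n%:R -> (n <= m1 * m2)%N ->
  [/\ (0 < n)%N, 0 < p <= 1, ln d <= d * p & 1 <= d * p].
Proof.
move=> p d m10 m20 d16 ln_n nm.
have d4 : 4 <= d by rewrite /d ler_nat (leq_trans _ (ltnW d16)).
have ln1 : 1 <= ln d.
  by rewrite -[1]expRK ler_ln ?posrE ?expR_gt0 ?(le_trans expR1_le4) // (lt_le_trans _ d4).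
have m0 : (0 < minn m1 m2)%N by rewrite leq_min m10.
have nR : 0 < n%:R :> R.
  by apply: lt_le_trans ln_n; rewrite mulr_gt0 ?ltr0n // (lt_le_trans ltr01).
have mR : 0 < (m1 * m2)%:R :> R by rewrite ltr0n muln_gt0 m10.
have ldp : ln d <= d * p.
  rewrite /p mulrA ler_pdivlMr //.
  apply: (@le_trans _ _ (d * ((minn m1 m2)%:R * ln d))); last first.
    by rewrite ler_wpM2l // ler0n.
  rewrite [leLHS]mulrC mulrA ler_wpM2r ?(le_trans ler01 ln1) //.
  rewrite -natrM ler_nat mulnDl; case: (leqP m1 m2) => _; last exact: leq_addr.
  by rewrite [(m2 * _)%N]mulnC leq_addl.
split => //; first by rewrite -(ltr0n R).
- by rewrite /p divr_gt0 //= ler_pdivrMr // mul1r ler_nat.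
- exact: le_trans ldp.
Qed.

Lemma adaptive_arith {R : realType} (Ga u4 u zz Xi N y xi r : R) :
  y <= zz * N -> xi <= Xi * N ->
  (6 * Ga + u4 * u + zz + Xi) * N < r + y + xi -> 6 * (Ga * N) + u4 * (u * N) < r.
Proof. by rewrite !mulrDl; lra. Qed.

(** * Coverage and diameter at a fixed sample size *)

Section Coverage.
Context {R : realType} {m1 m2 : nat}.
Variables (n : nat) (C0 alpha beta a sigma U z K : R).
Variable D : design R m1 m2.
Variables (Mhat : data R m1 m2 -> 'M[R]_(m1, m2))
  (Mproj : nat -> data R m1 m2 -> 'M[R]_(m1, m2)).
Local Notation m := (minn m1 m2).
Local Notation p := (n%:R / (m1 * m2)%:R : R).
Local Notation d := ((m1 + m2)%:R : R).
Local Notation P := (design_prob D).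
Local Notation Om := (design_space D).
Local Notation E3 := (expR 3 : R).
Hypotheses (m10 : (0 < m1)%N) (m20 : (0 < m2)%N) (d16 : (16 < m1 + m2)%N).
Hypotheses (ln_n : m%:R * ln d <= n%:R) (nm : (n <= m1 * m2)%N).
Hypotheses (C00 : 0 < C0) (alpha01 : 0 < alpha < 1) (a0 : 0 < a) (s0 : 0 <= sigma) (U0 : 0 < U).
Hypotheses (K1 : 1 <= K) (HK : walk_moment_const K).
Hypothesis zK : 4 * (512 * 4 * K * E3) + 1 <= z.
Hypotheses (eMhat : estimator Mhat) (bestP : best_approximations a Mhat Mproj).
Hypotheses (Bsamp : bernoulli_sampling D n) (Nass : noise_assumption D sigma U).

Local Notation ks := (kstar n C0 a sigma Mhat Mproj).
Local Notation Mt := (Mtilde n C0 a sigma Mhat Mproj).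
Local Notation obs := (observation (D := D)).
Local Notation L := (ln (alpha^-1)).
Local Notation rad := (sq_radius n C0 alpha a sigma U 2 z Mhat Mproj).
Local Notation conf := (conf_set n C0 alpha a sigma U 2 z Mhat Mproj).

Lemma measurable_observation M : measurable_fun setT (obs M : Om -> data R m1 m2).
Proof.
have mb i j : measurable_fun setT (fun w => bmask D i j w : bool) by exact: measurable_funP.
apply: measurable_fun_pair.
  apply: measurable_to_real_mx => i j.
  rewrite (_ : (fun w => _) = fun w => (bmask D i j w)%:R * (M i j + noise D i j w)); last first.
    by apply/funext => w; rewrite mxE.
  apply: measurable_funM.
    exact: (measurableT_comp (f := fun b : bool => b%:R : measurableTypeR R) _ (mb i j)).
  by apply: measurable_funD; [exact: measurable_cst|exact: measurable_funP].
apply: measurable_to_bool_mx => i j.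
by rewrite (_ : (fun w => _) = fun w => bmask D i j w) //; apply/funext => w; rewrite mxE.
Qed.

Lemma rhat_excess M w : (0 < n)%N ->
  (forall i : 'I_m1 * 'I_m2, cnoise U i w = noise D i.1 i.2 w) ->
  n%:R * rhat n C0 a sigma Mhat Mproj (obs M w) =
  excess n sigma U w (M - Mt (obs M w)).
Proof.
move=> n0 nw; have nR : n%:R != 0 :> R by rewrite pnatr_eq0 -lt0n.
rewrite /rhat /excess; move: (Mt _) => T; rewrite mulrBr mulVKf // addrA; congr (_ - _).
rewrite /energy ip_pairE pair_big mulr_sumr -!big_split; apply: eq_bigr => -[i j] _ /=.
have := nw (i, j) => /= nij; rewrite !mxE nij /mask !ffunE /= /maskv.
by case: (bmask D i j w) => /=; ring.
Qed.

Lemma sq_radiusE x : (0 < n)%N ->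
  p / 256 * rad x = n%:R * rhat n C0 a sigma Mhat Mproj x +
    z * (a ^+ 2 + 4 * U ^+ 2) * (d * (ks x)%:R) + Num.sqrt n%:R * xi n alpha U.
Proof.
move=> n0; rewrite /sq_radius ![((m1 + m2) * ks x)%:R]natrM.
have mR : 0 < (m1 * m2)%:R :> R by rewrite ltr0n muln_gt0 m10.
have [r r0 nE] : exists2 r, 0 < r & n%:R = r ^+ 2 :> R.
  by exists (Num.sqrt n%:R); rewrite ?sqrtr_gt0 ?ltr0n // sqr_sqrtr // ler0n.
rewrite nE sqrtr_sqr (ger0_norm (ltW r0)).
move: (rhat _ _ _ _ _ _ _) (xi _ _ _) => rh y; move: (d) ((ks x)%:R : R) => d' k'.
move: ((m1 * m2)%:R : R) mR => h h0.
by field; rewrite !gt_eqF.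
Qed.

Lemma ln_inv_alpha_gt0 : 0 < L.
Proof.
by have /andP[al0 al1] := alpha01; rewrite ln_gt0 // invf_gt1.
Qed.

Lemma sqrt_xi : (0 < n)%N -> Num.sqrt n%:R * xi n alpha U =
  2 * U ^+ 2 * (Num.sqrt n%:R * Num.sqrt L) + 4 / 3 * (U ^+ 2 * L).
Proof.
move=> n0; rewrite /xi; have r0 : 0 < Num.sqrt n%:R :> R by rewrite sqrtr_gt0 ltr0n.
by move: (Num.sqrt n%:R) r0 (Num.sqrt L) (L) => r r0 l l'; field; rewrite gt_eqF.
Qed.

Lemma measurable_conf M : (0 < n)%N -> measurable [set x | conf x M].
Proof.
move=> n0; have mr := measurable_sq_radius n C0 alpha sigma U 2 z m10 m20 eMhat bestP.
have mf : measurable_fun setT (fun x : data R m1 m2 => frob (M - Mt x) ^+ 2 : measurableTypeR R).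
  apply: (measurable_ip_sub (F := fun=> M)) => i j; first exact: measurable_cst.
  exact: (measurable_Mtilde n C0 sigma m10 m20 eMhat bestP).
have mt : measurable [set true] by [].
have := measurable_fun_ler mf mr measurableT mt.
rewrite setTI; congr measurable; apply/seteqP; split => x /=; rewrite conf_setE //=.
Qed.

Lemma honest_finite M : low_rank m a M ->
  ((1 - (expR (- (4 / 3 * L)) + 5 / Num.sqrt d))%:E <= law D M [set x | conf x M])%E.
Proof.
move=> Mm; have [n0 p01 ldp dp1] := sampling_rate m10 m20 d16 ln_n nm.
have [e dq] := pow2_between dp1.
have L0 := ln_inv_alpha_gt0.
have nR : 0 < n%:R :> R by rewrite ltr0n.
pose t := Num.sqrt n%:R * xi n alpha U.
have tE := sqrt_xi n0; rewrite -/t in tE.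
(* Squared and divided by [3 * n * U ^+ 4], this lower bound gives the exponent [4 / 3 * L], that is
   the probability [alpha ^ (4/3)]. *)
have t1 : 2 * U ^+ 2 * (Num.sqrt n%:R * Num.sqrt L) <= t.
  by rewrite tE lerDl !mulr_ge0 ?(ltW U0) ?(ltW L0).
have t10 : 0 < 2 * U ^+ 2 * (Num.sqrt n%:R * Num.sqrt L).
  by rewrite mulr_gt0 // ?mulr_gt0 // ?sqrtr_gt0 // ?exprn_gt0.
have t0 : 0 < t by apply: lt_le_trans t1.
have mC := measurable_conf M n0.
have mO : measurable (obs M @^-1` [set x | conf x M]).
  by have := measurable_observation M measurableT mC; rewrite setTI.
have mS : measurable (~` (obs M @^-1` [set x | conf x M])) by exact: measurableC.
have d16' : 16 < d by rewrite ltr_nat.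
have := honest_tail p01 U0 K1 HK Bsamp Nass d16' dq ldp _ n0 a0 t0 zK Mm mS.
have m0 : (0 < m1 * m2)%N by rewrite muln_gt0 m10.
move=> /(_ m0) H.
have {}H : EE P (\1_(~` (obs M @^-1` [set x | conf x M]))) <=
    expR (- (4 / 3 * L)) + 5 / Num.sqrt d.
  apply: (le_trans (H _)); last first.
    rewrite lerD2r ler_expR lerN2 ler_pdivlMr; last by rewrite !mulr_gt0 // exprn_gt0.
    have : (2 * U ^+ 2 * (Num.sqrt n%:R * Num.sqrt L)) ^+ 2 <= t ^+ 2.
      by rewrite lerXn2r ?nnegrE ?(ltW t0) ?(ltW t10).
    rewrite !exprMn !sqr_sqrtr ?(ltW L0) ?(ltW nR) //.
    by apply: le_trans; rewrite le_eqVlt; apply/orP; left; apply/eqP; field.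
  move=> w nw; rewrite /= conf_setE //= => /negP; rewrite -ltNge => lt.
  exists (ks (obs M w)), (Mt (obs M w)); split.
  - exact: kstar_itv.
  - exact: Mtilde_low_rank.
  rewrite -(rhat_excess M n0 nw).
  have p0 : 0 < p / 256 by rewrite divr_gt0 ?ltr0n //; case/andP: p01.
  move: lt; rewrite -(ltr_pM2l p0) sq_radiusE // frob_sqr /t.
  by move: (_ * ip _ _) => g; lra.
rewrite /law /pushforward.
have -> : P (obs M @^-1` [set x | conf x M]) =
    (1 - P (~` (obs M @^-1` [set x | conf x M])))%E.
  by rewrite -probability_setC // setCK.
rewrite -EE_indic // -EFinB lee_fin lerD2l lerN2.
exact: H.
Qed.

(** The deviation term is within the order of the rate, as
    [sqrt n <= sqrt (m1 * m2) <= d <= d * k]. *)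
Lemma sqrt_xi_le k : (0 < n)%N -> (0 < k)%N ->
  Num.sqrt n%:R * xi n alpha U <=
  (2 * U ^+ 2 * Num.sqrt L + 2 * (U ^+ 2 * L)) * (d * k%:R).
Proof.
move=> n0 k0; rewrite sqrt_xi //; have L0 := ltW ln_inv_alpha_gt0.
have kR : 1 <= k%:R :> R by rewrite ler1n.
have d1 : 1 <= d by rewrite ler1n (leq_trans _ (ltnW d16)).
have dN : d <= d * k%:R by rewrite ler_peMr ?ler0n.
have N1 := le_trans d1 dN.
have nd : Num.sqrt n%:R <= d.
  rewrite -(@ler_pXn2r _ 2) ?nnegrE ?sqrtr_ge0 ?ler0n // sqr_sqrtr ?ler0n //.
  rewrite -natrX ler_nat (leq_trans nm) // expnS expn1.
  by rewrite leq_mul ?leq_addr ?leq_addl.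
have u1 : 0 <= 2 * U ^+ 2 * Num.sqrt L by rewrite !mulr_ge0 ?sqrtr_ge0 ?(ltW U0).
have u2 : 0 <= U ^+ 2 * L by rewrite !mulr_ge0 ?(ltW U0).
have h1 := ler_wpM2l u1 (le_trans nd dN); have h2 := ler_wpM2l u2 N1.
rewrite mulrDl; move: h1 h2 u1 u2.
move: (Num.sqrt L) (Num.sqrt n%:R) (U ^+ 2 * L) (U ^+ 2) (d * k%:R) => sl sn ul u N.
by lra.
Qed.

(** On the risk event [M] competes in the projection onto rank [k], so [k] passes the test and
    [kstar <= k]. Both [M] and [Mtilde] are then within the rate at [k] of [Mhat], and the
    parallelogram inequality gives the factor 4. *)
Lemma risk_kstar M x k : (1 <= k <= m)%N -> (0 < n)%N -> low_rank k a M ->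
  frob (Mhat x - M) ^+ 2 / (m1 * m2)%:R <= rate C0 sigma a m1 m2 n k ->
  (ks x <= k)%N /\
  ip (M - Mt x) (M - Mt x) <= 4 * (rate C0 sigma a m1 m2 n k * (m1 * m2)%:R).
Proof.
move=> km n0 Mk h; have mR : 0 < (m1 * m2)%:R :> R by rewrite ltr0n muln_gt0 m10.
have kS : inS n C0 a sigma Mhat Mproj x k.
  have [_ /(_ x) [_ best]] := bestP km.
  apply: le_trans h; rewrite ler_wpM2r ?invr_ge0 ?(ltW mR) //.
  by rewrite lerXn2r ?nnegrE ?frob_ge0 // best.
have kk := kstar_le km kS; split => //.
have := inS_kstar km kS; rewrite /inS -/(Mt x) => hS.
have rk : rate C0 sigma a m1 m2 n (ks x) <= rate C0 sigma a m1 m2 n k.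
  rewrite /rate ler_wpM2r ?invr_ge0 ?ler0n //; apply: ler_wpM2l.
    exact: mulr_ge0 (ltW C00) (sqr_ge0 _).
  by rewrite ler_nat leq_mul2l kk orbT.
move: h (le_trans hS rk); rewrite !ler_pdivrMr // !frob_sqr => h1 h2.
have -> : M - Mt x = (Mhat x - Mt x) - (Mhat x - M) by apply/matrixP => i j; rewrite !mxE; ring.
have := ip_sub_le (Mhat x - Mt x) (Mhat x - M).
move: h1 h2; rewrite /Mtilde; lra.
Qed.

(** 1024 is 4 for the squared diameter times 256 for the squared radius. The summands bound, in
    units of [d * k / s], the mask term with its share of the cross term ([6 * cut]), the noise norm
    and energy, the [z] terms of the radius, and [xi]. *)
Definition adaptivity_const : R :=
  1024 * (6 * (512 * 4 * K * E3 * a ^+ 2 + 4 * (C0 * (sigma + a) ^+ 2))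
    + (4 * K * E3 + 1) * U ^+ 2 + z * (a ^+ 2 + 4 * U ^+ 2)
    + (2 * U ^+ 2 * Num.sqrt L + 2 * (U ^+ 2 * L))).

Let K0 : 0 < K. Proof. exact: lt_le_trans ltr01 K1. Qed.

Let z0 : 0 <= z.
Proof.
have ka0 : 0 <= 512 * 4 * K * E3.
  exact: mulr_ge0 (mulr_ge0 (mulr_ge0 (ler0n R 512) (ler0n R 4)) (ltW K0)) (expR_ge0 3).
exact: le_trans (addr_ge0 (mulr_ge0 (ler0n R 4) ka0) ler01) zK.
Qed.

Lemma deviation_const_ge0 : 0 <= 2 * U ^+ 2 * Num.sqrt L + 2 * (U ^+ 2 * L).
Proof.
by rewrite addr_ge0 // !mulr_ge0 ?sqrtr_ge0 ?(ltW U0) // (ltW ln_inv_alpha_gt0).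
Qed.

Lemma adaptivity_const_gt0 : 0 < adaptivity_const.
Proof.
have U2 : 0 < U ^+ 2 by rewrite exprn_gt0.
have ka0 : 0 <= 512 * 4 * K * E3.
  exact: mulr_ge0 (mulr_ge0 (mulr_ge0 (ler0n R 512) (ler0n R 4)) (ltW K0)) (expR_ge0 3).
have Cs0 : 0 <= C0 * (sigma + a) ^+ 2 by rewrite mulr_ge0 ?(ltW C00) ?sqr_ge0.
rewrite /adaptivity_const; apply: mulr_gt0; first exact: ltr0n.
apply: ltr_wpDr; first exact: deviation_const_ge0.
apply: ltr_wpDr.
  by rewrite mulr_ge0 // addr_ge0 ?sqr_ge0 // mulr_ge0 ?sqr_ge0.
apply: ltr_wpDl.
  exact: mulr_ge0 (ler0n R 6) (addr_ge0 (mulr_ge0 ka0 (sqr_ge0 a)) (mulr_ge0 (ler0n R 4) Cs0)).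
by rewrite mulr_gt0 // ltr_wpDl // !mulr_ge0 ?(ltW K0) ?expR_ge0.
Qed.

Lemma diameterE x : (0 < n)%N ->
  (frob_diam (conf x) ^+ 2 * ((m1 * m2)%:R^-1)%:E)%E =
  (4 * Num.max (rad x) 0 / (m1 * m2)%:R)%:E.
Proof.
move=> n0; rewrite conf_setE // frob_diam_ball // -EFin_expe -EFinM exprMn.
congr (_ * _ / _)%:E; first by rewrite -natrX.
case: (leP 0 (rad x)) => h; first by rewrite sqr_sqrtr.
by rewrite ltr0_sqrtr // expr0n.
Qed.

Lemma measurable_too_large c : (0 < n)%N ->
  measurable [set x | (c%:E < frob_diam (conf x) ^+ 2 * ((m1 * m2)%:R^-1)%:E)%E].
Proof.
move=> n0.
have mr := measurable_sq_radius n C0 alpha sigma U 2 z m10 m20 eMhat bestP.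
have mf : measurable_fun setT (fun x => 4 * Num.max (rad x) 0 / (m1 * m2)%:R : measurableTypeR R).
  apply: measurable_funM; last exact: measurable_cst.
  apply: measurable_funM; first exact: measurable_cst.
  by apply: measurable_maxr => //; exact: measurable_cst.
have mt : measurable [set true] by [].
have := measurable_fun_ltr (@measurable_cst _ _ _ _ setT c) mf measurableT mt.
rewrite setTI; congr measurable; apply/seteqP.
by split => x /=; rewrite diameterE // lte_fin.
Qed.

(** The complement of the risk event costs [beta]. On the risk event a large diameter means a large
    excess at a difference of two matrices of rank at most [k], which costs [s]. *)
Lemma adaptive_finite k M s C : (1 <= k <= m)%N -> 0 < s <= 1 ->
  risk_bound n C0 a sigma Mhat D beta -> low_rank k a M ->
  adaptivity_const / s <= C * (C0 * (sigma + a) ^+ 2) ->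
  (law D M [set x | ((C * rate C0 sigma a m1 m2 n k)%:E <
      frob_diam (conf x) ^+ 2 * ((m1 * m2)%:R^-1)%:E)%E] <= (beta + s)%:E)%E.
Proof.
move=> km s01 risk Mk hC; have [n0 p01 ldp dp1] := sampling_rate m10 m20 d16 ln_n nm.
have [e dq] := pow2_between dp1; have [s1 s2] := andP s01.
have [k0 _] := andP km.
set c := C * _; pose T := [set x | (c%:E < frob_diam (conf x) ^+ 2 * ((m1 * m2)%:R^-1)%:E)%E].
pose G := [set x | frob (Mhat x - M) ^+ 2 / (m1 * m2)%:R <= rate C0 sigma a m1 m2 n k].
have mT : measurable T by exact: measurable_too_large.
have mG : measurable G.
  have mf : measurable_fun setT (fun x : data R m1 m2 => frob (Mhat x - M) ^+ 2 / (m1 * m2)%:R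
    : measurableTypeR R).
    apply: measurable_funM; last exact: measurable_cst.
    apply: (measurable_ip_sub (G := fun=> M)) => i j; last exact: measurable_cst.
    exact: measurable_entry.
  have mt : measurable [set true] by [].
  have := measurable_leb (rate C0 sigma a m1 m2 n k) mf measurableT mt.
  by rewrite setTI; congr measurable; apply/seteqP; split.
have mO (A : set (data R m1 m2)) : measurable A -> measurable (obs M @^-1` A).
  by move=> mA; have := measurable_observation M measurableT mA; rewrite setTI.
have mOT := mO _ mT; have mOG := mO _ mG.
have mS := mO _ (measurableI _ _ mT mG).
have hG : 1 - beta <= EE P (\1_(obs M @^-1` G)).
  rewrite -lee_fin EE_indic //.
  apply: le_trans (risk k km) _; apply: ereal_inf_lbound; exists M => //.
have m0 : (0 < m1 * m2)%N by rewrite muln_gt0 m10.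
have d16' : 16 < d by rewrite ltr_nat.
(* The two summands meet the two demands on [cut]: the first that of the mask bound, the second
   [p * rho2 <= cut]. *)
pose cut := (512 * 4 * K * E3 * a ^+ 2 + 4 * (C0 * (sigma + a) ^+ 2)) * (d * k%:R) / s.
pose rho2 := 4 * (rate C0 sigma a m1 m2 n k * (m1 * m2)%:R).
have nR : 0 < n%:R :> R by rewrite ltr0n.
have mR : 0 < (m1 * m2)%:R :> R by rewrite ltr0n.
have N0 : 0 < d * k%:R.
  by rewrite mulr_gt0 // ltr0n // addn_gt0 m10.
have rateE : n%:R * rate C0 sigma a m1 m2 n k = C0 * (sigma + a) ^+ 2 * (d * k%:R).
  by rewrite /rate mulrC divfK ?gt_eqF // natrM.
have Cs0 : 0 <= C0 * (sigma + a) ^+ 2 by rewrite mulr_ge0 ?(ltW C00) ?sqr_ge0.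
have E0 : 0 < E3 by apply: expR_gt0.
have n512 : 0 <= 512 :> R by exact: ler0n.
have ka0 : 0 <= 512 * 4 * K * E3.
  exact: mulr_ge0 (mulr_ge0 (mulr_ge0 n512 (ler0n R 4)) (ltW K0)) (ltW E0).
have hcut1 : 512 * 4 * K * E3 * a ^+ 2 * (d * k%:R) <= s * cut.
  rewrite /cut [s * _]mulrC divfK ?gt_eqF // ler_wpM2r ?(ltW N0) // lerDl.
  exact: mulr_ge0 (ler0n R 4) Cs0.
have prho : p * rho2 = 4 * (C0 * (sigma + a) ^+ 2) * (d * k%:R).
  rewrite /rho2 -[RHS]mulrA -rateE; move: (rate _ _ _ _ _ _ _) (n%:R : R) ((m1 * m2)%:R : R) mR
    => r n' h h0.
  by field; rewrite gt_eqF.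
have hcut2 : p * rho2 <= cut.
  rewrite prho /cut ler_pdivlMr //.
  apply: (@le_trans _ _ (4 * (C0 * (sigma + a) ^+ 2) * (d * k%:R) * 1)).
    rewrite ler_wpM2l //; exact: mulr_ge0 (mulr_ge0 (ler0n R 4) Cs0) (ltW N0).
  rewrite mulr1 ler_wpM2r ?(ltW N0) // lerDr.
  exact: mulr_ge0 ka0 (sqr_ge0 a).
have := adaptive_tail p01 U0 K1 HK Bsamp Nass d16' dq ldp m0 nm k0 a0 s01 hcut1 hcut2 Mk mS.
move=> H.
have {}H : EE P (\1_(obs M @^-1` (T `&` G))) <= s.
  apply: H => w nw [/= wT wG]; exists (Mt (obs M w)).
  have [kk hip] := risk_kstar km n0 Mk wG.
  split => //; first by have [r1 r2] := Mtilde_low_rank n C0 sigma m10 m20 bestP (obs M w);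
    split => //; exact: leq_trans r1 kk.
  rewrite -(rhat_excess M n0 nw).
  have rE := sq_radiusE (obs M w) n0; have hx := sqrt_xi_le n0 k0.
  have hk : z * (a ^+ 2 + 4 * U ^+ 2) * (d * (ks (obs M w))%:R) <= z * (a ^+ 2 + 4 * U ^+ 2) *
    (d * k%:R / s).
    rewrite ler_wpM2l //; first by rewrite mulr_ge0 // addr_ge0 ?sqr_ge0 // mulr_ge0 ?sqr_ge0.
    rewrite ler_pdivlMr //; apply: (@le_trans _ _ (d * (ks (obs M w))%:R)).
      by rewrite ler_piMr // -natrM ler0n.
    by rewrite ler_wpM2l ?ler0n // ler_nat.
  have Xi0 := deviation_const_ge0.
  have hx2 : Num.sqrt n%:R * xi n alpha U <= (2 * U ^+ 2 * Num.sqrt L + 2 * (U ^+ 2 * L)) * (d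
    * k%:R / s).
    apply: (le_trans hx); rewrite ler_wpM2l // ler_pdivlMr // -[leRHS]mulr1.
    by rewrite ler_wpM2l // (ltW N0).
  have hC2 : adaptivity_const * (d * k%:R / s) <= n%:R * c.
    have -> : n%:R * c = C * (C0 * (sigma + a) ^+ 2) * (d * k%:R).
      by rewrite /c mulrCA rateE [LHS]mulrA.
    have -> : adaptivity_const * (d * k%:R / s) = adaptivity_const / s * (d * k%:R).
      by rewrite [RHS]mulrAC -[RHS]mulrA.
    by rewrite ler_wpM2r // (ltW N0).
  have N1 : 0 < d * k%:R / s by rewrite divr_gt0.
  have A0 := adaptivity_const_gt0.
  have c0 : 0 < n%:R * c by apply: lt_le_trans hC2; rewrite mulr_gt0.
  move: wT; rewrite /T /= diameterE // lte_fin => wT.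
  (* For a negative squared radius the set is empty with diameter 0, which is not above the positive
     bound [c]. *)
  have rad0 : 0 <= rad (obs M w).
    rewrite leNgt; apply/negP => h; move: wT; rewrite max_r ?(ltW h) // mulr0 mul0r.
    by rewrite ltNge -(pmulr_rge0 _ nR) (ltW c0).
  move: wT; rewrite max_l // -(ltr_pM2l nR) => wT.
  have {}wT : n%:R * c < 1024 * (p / 256 * rad (obs M w)).
    apply: (lt_le_trans wT); rewrite le_eqVlt; apply/orP; left; apply/eqP.
    by move: (rad _) (n%:R : R) ((m1 * m2)%:R : R) mR => r n' h h0; field; rewrite gt_eqF.
  have h1024 : 0 < 1024 :> R by exact: ltr0n.
  move: (le_lt_trans hC2 wT); rewrite /adaptivity_const -[X in X < _]mulrA (ltr_pM2l h1024) rE.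
  rewrite /cut -[_ * (d * k%:R) / s]mulrA -[U ^+ 2 * _ / s]mulrA.
  exact: adaptive_arith hk hx2.
have bT : bmeas (\1_(obs M @^-1` T) : Om -> R) by exact: bmeas_indic.
have bG : bmeas (\1_(obs M @^-1` G) : Om -> R) by exact: bmeas_indic.
have bS : bmeas (\1_(obs M @^-1` (T `&` G)) : Om -> R) by exact: bmeas_indic.
have b1 : bmeas (fun _ : Om => 1 : R) by exact: bmeas_cst.
rewrite /law /pushforward -EE_indic // lee_fin.
have le1 w : \1_(obs M @^-1` T) w <= (1 - \1_(obs M @^-1` G) w) + \1_(obs M @^-1` (T `&` G)) w
  :> R.
  rewrite preimage_setI indicI /= !indicE.
  by case: (w \in _); case: (w \in _); rewrite /= ?mulr1 ?mulr0 ?subrr ?subr0 ?addr0 ?add0r.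
apply: (le_trans (le_EE P bT (bmeasD (bmeasB b1 bG) bS) le1)).
rewrite EED //; last exact: bmeasB.
rewrite EEB // EE_cst; apply: lerD => //.
by rewrite lerBlDr -lerBlDl.
Qed.

End Coverage.

(** * Passage to all sample sizes *)

Lemma limn_einf_ge0 {R : realType} (u : (\bar R)^nat) N :
  (forall n, (N <= n)%N -> 0 <= u n)%E -> (0 <= limn_einf u)%E.
Proof.
move=> u0; rewrite limn_einf_lim; apply: lime_ge; first exact: is_cvg_einfs.
exists N => // n /= Nn; apply: le_ereal_inf_tmp => _ [k /= nk <-].
by apply: u0; apply: leq_trans nk.
Qed.

Theorem corollary1 (R : realType) :
  exists Cstar z0 : R, 2 <= Cstar /\ 0 < z0 /\
  forall z C0 alpha beta a sigma U : R,
  z0 <= z -> 0 < C0 -> 0 < alpha < 1 -> 0 < beta -> 0 < a -> 0 <= sigma ->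
  0 < U ->
  exists (c : R) (C : R -> R -> R),
  0 < c /\ (forall gamma gamma' : R, 0 < C gamma gamma') /\
  forall (n0 : nat) (m1 m2 : nat -> nat)
    (D : forall n, design R (m1 n) (m2 n))
    (Mhat : forall n, data R (m1 n) (m2 n) -> 'M[R]_(m1 n, m2 n))
    (Mproj : forall n, nat -> data R (m1 n) (m2 n) -> 'M[R]_(m1 n, m2 n)),
  (forall n, (n0 <= n)%N ->
    [/\ (1 <= m1 n)%N /\ (1 <= m2 n)%N,
        (16 < m1 n + m2 n)%N,
        (minn (m1 n) (m2 n))%:R * ln ((m1 n + m2 n)%:R : R) <= n%:R
      & (n <= m1 n * m2 n)%N]) ->
  (forall n, (n0 <= n)%N ->
    bernoulli_sampling (D n) n /\ noise_assumption (D n) sigma U) ->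
  (forall n, (n0 <= n)%N ->
    [/\ estimator (Mhat n),
        forall x, `|Mhat n x| <= a,
        risk_bound n C0 a sigma (Mhat n) (D n) beta
      & best_approximations a (Mhat n) (Mproj n)]) ->
  let Cn n := conf_set n C0 alpha a sigma U Cstar z (Mhat n) (Mproj n) in
  forall gamma gamma' : nat -> R,
  (forall n, (n0 <= n)%N ->
    alpha + expR (- c * (m1 n + m2 n)%:R) <= gamma n /\
    beta + expR (- c * (m1 n + m2 n)%:R) <= gamma' n) ->
  honest D a (fun n x => Cn n x `&` low_rank (minn (m1 n) (m2 n)) a) gamma /\
  forall k : nat -> nat,
  (forall n, (n0 <= n)%N -> (1 <= k n <= minn (m1 n) (m2 n))%N) ->
  adaptive D a Cn n0 C0 sigma C k gamma gamma'.
Proof.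
have [K K1 HK] := walk_moment_bound R.
have E0 : 0 < expR 3 :> R by apply: expR_gt0.
have K0 : 0 < K by apply: lt_le_trans K1.
(* [Cstar = 2] makes [(U * Cstar) ^+ 2] the [4 * U ^+ 2] of the honest tail bound, and the threshold
   for [z] is the one under which that bound closes. *)
exists 2, (4 * (512 * 4 * K * expR 3) + 1); split; first exact: lexx.
split.
  apply: ltr_wpDl; last exact: ltr01.
  exact: mulr_ge0 (ler0n R 4) (mulr_ge0 (mulr_ge0 (mulr_ge0 (ler0n R 512) (ler0n R 4))
    (ltW K0)) (ltW E0)).
move=> z C0 alpha beta a sigma U hz C00 al be0 a0 s0 U0.
have A0 := adaptivity_const_gt0 a sigma C00 al U0 K1 hz.
have sa0 : 0 < C0 * (sigma + a) ^+ 2.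
  by rewrite mulr_gt0 // exprn_gt0 // ltr_wpDl.
(* [1 + 1 / (g' - beta)] is the inverse of the failure probability [s] chosen for adaptivity; the
   absolute value keeps the constant positive for all arguments. *)
exists 1, (fun _ g' => adaptivity_const C0 alpha a sigma U z K *
  (1 + `|(g' - beta)^-1|) / (C0 * (sigma + a) ^+ 2)).
split => //; split.
  by move=> _ g'; rewrite divr_gt0 // mulr_gt0 // ltr_wpDr.
move=> n0 m1 m2 D Mhat Mproj hdim hdesign hest Cn gamma gamma' hg.
split; first split.
- by move=> n x M [].
- have L0 : 0 < ln alpha^-1 by exact: ln_inv_alpha_gt0 al.
  have /andP[al0 al1] := al.
  pose al' := expR (- (4 / 3 * ln alpha^-1)).
  have al'1 : 0 < alpha - al'.
    rewrite subr_gt0 /al' -[ltRHS]lnK ?posrE // ltr_expR lnV ?posrE //.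
    by move: L0; rewrite lnV ?posrE //; lra.
  (* The gap [alpha - alpha ^ (4/3)] has to absorb [5 / sqrt d]. As [n <= m1 * m2 <= d ^+ 2], this
     happens once [n >= y ^+ 4]. *)
  pose y := 5 / (alpha - al').
  have y0 : 0 < y by rewrite divr_gt0 // ltr0n.
  pose N := Num.bound (y ^+ 4).
  apply: (@limn_einf_ge0 _ _ (maxn n0 N)) => n; rewrite geq_max => /andP[n0n Nn].
  have [[m10 m20] d16 ln_n nm] := hdim n n0n.
  have [Bs Na] := hdesign n n0n; have [eM _ _ best] := hest n n0n.
  have [gn _] := hg n n0n.
  rewrite sube_ge0 //; apply: le_ereal_inf_tmp => _ [M Mm <-].
  have -> : [set x | (Cn n x `&` low_rank (minn (m1 n) (m2 n)) a) M] = [set x | Cn n x M].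
    by apply/seteqP; split => x //= [].
  apply: le_trans (honest_finite C0 m10 m20 d16 ln_n nm al a0 U0 K1 HK hz eM best Bs Na Mm).
  rewrite lee_fin lerD2l lerN2; apply: (@le_trans _ _ alpha); last first.
    by apply: le_trans gn; rewrite lerDl expR_ge0.
  rewrite -lerBrDl; have d0 : 0 < (m1 n + m2 n)%:R :> R by rewrite ltr0n addn_gt0 m10.
  have yd : y <= Num.sqrt (m1 n + m2 n)%:R.
    rewrite -(@ler_pXn2r _ 4) ?nnegrE ?sqrtr_ge0 ?(ltW y0) //.
    have y4 : 0 <= y ^+ 4 by rewrite exprn_ge0 // (ltW y0).
    apply: (le_trans (ltW (archi_boundP y4))).
    rewrite [leRHS](exprM _ 2 2) sqr_sqrtr ?ler0n // -natrX ler_nat.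
    rewrite (leq_trans Nn) // (leq_trans nm) // expnS expn1.
    by rewrite leq_mul ?leq_addr ?leq_addl.
  rewrite ler_pdivrMr ?sqrtr_gt0 // mulrC -ler_pdivrMr //.
move=> k hk n n0n too_large.
have [[m10 m20] d16 ln_n nm] := hdim n n0n.
have [Bs Na] := hdesign n n0n; have [eM _ risk best] := hest n n0n.
have [_ gn] := hg n n0n.
pose de := gamma' n - beta.
have de0 : 0 < de.
  by rewrite subr_gt0; apply: lt_le_trans gn; rewrite ltrDl expR_gt0.
(* This [s] is at most 1, as the tail bound asks, and at most [de], so that [beta + s <= gamma']. *)
have s01 : 0 < de / (1 + de) <= 1.
  have h : 0 < 1 + de by rewrite addr_gt0.
  by rewrite divr_gt0 //= ler_pdivrMr // mul1r lerDr.
have key l : (1 <= l <= minn (m1 n) (m2 n))%N ->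
    (ereal_sup [set law (D n) M (too_large l) | M in low_rank l a] <= (gamma' n)%:E)%E.
  move=> lm; apply: ge_ereal_sup => _ [M Mk <-].
  apply: (le_trans (adaptive_finite m10 m20 d16 ln_n nm C00 al a0 U0 K1 HK hz eM best Bs Na
    lm s01 risk Mk _)).
    rewrite divfK ?gt_eqF // ger0_norm ?invr_ge0 ?(ltW de0) //.
    rewrite le_eqVlt; apply/orP; left; apply/eqP; rewrite -/de.
    by field; rewrite !gt_eqF // addr_gt0.
  rewrite lee_fin -lerBrDl -/de ler_pdivrMr; last exact: addr_gt0.
  by rewrite ler_peMr ?(ltW de0) // lerDl (ltW de0).
split; first by apply: key; exact: hk.
by apply: key; rewrite leqnn andbT leq_min m10.
Qed.
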